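(* The Mordell-Weil rank is not a sum of local invariants. That is, there is no invariant $\lambda$ of elliptic curves over local fields with values in $\mathbb{Z}$ such that for every number field $K$ and every elliptic curve $E/K$ one has $\lambda(E/K_v)=0$ for all but finitely many places $v$ of $K$ and $$\operatorname{rk}(E/K)=\sum_v \lambda(E/K_v),$$ where $v$ runs over all places of $K$.
   Context: $\operatorname{rk}(E/K)$ denotes the Mordell-Weil rank, i.e. the rank of the finitely generated abelian group $E(K)$. For a place $v$ of a number field $K$ (finite or infinite), $K_v$ is the completion of $K$ at $v$. Local fields here include the archimedean fields $\mathbb{R}$ and $\mathbb{C}$. An invariant $\Lambda$ of elliptic curves over number fields (with values in an abelian group $A$) assigns to each number field $K$ and elliptic curve $E/K$ an element $\Lambda(E/K)\in A$, such that if $K\cong K'$ and $E/K$ and $E'/K'$ are isomorphic elliptic curves (identifying $K$ with $K'$), then $\Lambda(E/K)=\Lambda(E'/K')$. An invariant $\lambda$ of elliptic curves over local fields is defined in the same way, with local fields in place of number fields. One says that $\Lambda$ is a sum of local invariants if there is an $A$-valued invariant $\lambda$ of elliptic curves over local fields such that, for all $E/K$, $\lambda(E/K_v)=0$ for all but finitely many places $v$ of $K$ and $\Lambda(E/K)=\sum_v\lambda(E/K_v)$, the sum being over all places of $K$. *)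

(* Defs.v *)
From HB Require Import structures.
From mathcomp Require Import all_boot all_order all_algebra all_field.
From mathcomp Require Import generic_quotient.
From mathcomp Require Import all_classical all_reals all_analysis.
From mathcomp Require Import ring.

Set Implicit Arguments.
Unset Strict Implicit.
Unset Printing Implicit Defensive.

Import Order.TTheory GRing.Theory Num.Theory.
Import numFieldTopology.Exports.

Local Open Scope classical_set_scope.
Local Open Scope quotient_scope.
Local Open Scope ring_scope.

(* An elliptic curve over [F] is given by a Weierstrass equation
     [y^2 + a1 x y + a3 y = x^3 + a2 x^2 + a4 x + a6]
   of nonzero discriminant, in any characteristic. *)

Definition weierstrass_disc (F : fieldType) (a1 a2 a3 a4 a6 : F) : F :=
  let b2 := a1 ^+ 2 + 4%:R * a2 in
  let b4 := 2%:R * a4 + a1 * a3 in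
  let b6 := a3 ^+ 2 + 4%:R * a6 in
  let b8 := a1 ^+ 2 * a6 + 4%:R * a2 * a6 - a1 * a3 * a4 + a2 * a3 ^+ 2
            - a4 ^+ 2 in
  - b2 ^+ 2 * b8 - 8%:R * b4 ^+ 3 - 27%:R * b6 ^+ 2 + 9%:R * b2 * b4 * b6.

Record ellCurve (F : fieldType) := EllCurve {
  ec_a1 : F; ec_a2 : F; ec_a3 : F; ec_a4 : F; ec_a6 : F;
  ec_disc_neq0 : weierstrass_disc ec_a1 ec_a2 ec_a3 ec_a4 ec_a6 != 0 }.

Lemma ec_map_disc (F F' : fieldType) (f : {rmorphism F -> F'})
    (E : ellCurve F) :
  weierstrass_disc (f (ec_a1 E)) (f (ec_a2 E)) (f (ec_a3 E)) (f (ec_a4 E))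
    (f (ec_a6 E)) != 0.
Proof.
suff -> : weierstrass_disc (f (ec_a1 E)) (f (ec_a2 E)) (f (ec_a3 E))
    (f (ec_a4 E)) (f (ec_a6 E)) =
  f (weierstrass_disc (ec_a1 E) (ec_a2 E) (ec_a3 E) (ec_a4 E) (ec_a6 E)).
  by rewrite fmorph_eq0 ec_disc_neq0.
rewrite /weierstrass_disc.
ring.
Qed.

Definition ec_map (F F' : fieldType) (f : {rmorphism F -> F'})
  (E : ellCurve F) : ellCurve F' := EllCurve (ec_map_disc f E).

(* Isomorphisms of pointed curves are the substitutions
   [x = u^2 x' + r], [y = u^3 y' + s u^2 x' + t]; the equations are the
   resulting relations between the coefficients. *)
Definition ec_isom (F : fieldType) (E E' : ellCurve F) : Prop :=
  exists u r s t : F,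
  u != 0 /\
  [/\ u * ec_a1 E' = ec_a1 E + 2%:R * s,
      u ^+ 2 * ec_a2 E' = ec_a2 E - s * ec_a1 E + 3%:R * r - s ^+ 2,
      u ^+ 3 * ec_a3 E' = ec_a3 E + r * ec_a1 E + 2%:R * t,
      u ^+ 4 * ec_a4 E' = ec_a4 E - s * ec_a3 E + 2%:R * r * ec_a2 E
        - (t + r * s) * ec_a1 E + 3%:R * r ^+ 2 - 2%:R * s * t &
      u ^+ 6 * ec_a6 E' = ec_a6 E + r * ec_a4 E + r ^+ 2 * ec_a2 E + r ^+ 3
        - t * ec_a3 E - t ^+ 2 - r * t * ec_a1 E].

Section Points.
Context (F : fieldType) (E : ellCurve F).
Implicit Types (P Q : option (F * F)).

Local Notation a1 := (ec_a1 E).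
Local Notation a2 := (ec_a2 E).
Local Notation a3 := (ec_a3 E).
Local Notation a4 := (ec_a4 E).
Local Notation a6 := (ec_a6 E).

(* [None] is the point at infinity. *)
Definition on_curve P : bool :=
  if P is Some (x, y) then
    y ^+ 2 + a1 * x * y + a3 * y == x ^+ 3 + a2 * x ^+ 2 + a4 * x + a6
  else true.

Definition opp_coord P : option (F * F) :=
  if P is Some (x, y) then Some (x, - y - a1 * x - a3) else None.

(* Third intersection of the line [y = l x + n] with the curve, reflected,
   where the first two intersections have abscissae [x1] and [x2]. *)
Definition line_coord (l n x1 x2 : F) : option (F * F) :=
  let x3 := l ^+ 2 + a1 * l - a2 - x1 - x2 in
  opp_coord (Some (x3, l * x3 + n)).

Definition add_coord P Q : option (F * F) :=
  match P, Q with
  | None, _ => Q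
  | _, None => P
  | Some (x1, y1), Some (x2, y2) =>
    if x1 == x2 then
      if y1 + y2 + a1 * x2 + a3 == 0 then None else
      let l := (3%:R * x1 ^+ 2 + 2%:R * a2 * x1 + a4 - a1 * y1)
               / (2%:R * y1 + a1 * x1 + a3) in
      line_coord l (y1 - l * x1) x1 x2
    else
      let l := (y2 - y1) / (x2 - x1) in
      line_coord l (y1 - l * x1) x1 x2
  end.

Lemma on_curve_opp P : on_curve P -> on_curve (opp_coord P).
Proof.
case: P => [[x y]|] //= /eqP h; apply/eqP; rewrite -h; ring.
Qed.

(* [alpha X + beta] is the remainder of the cubic cut out by the line
   [y = l X + n] in its division by [(X - x1) (X - x2)]. *)
Let alpha l n x1 x2 :=
  let x3 := l ^+ 2 + a1 * l - a2 - x1 - x2 in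
  a4 - 2%:R * l * n - a1 * n - a3 * l - (x1 * x2 + x1 * x3 + x2 * x3).

Lemma on_curve_line l n x1 x2 :
  on_curve (Some (x1, l * x1 + n)) -> alpha l n x1 x2 = 0 ->
  on_curve (line_coord l n x1 x2).
Proof.
rewrite /line_coord /alpha => /= h1 h2.
apply: (@on_curve_opp (Some (_, _))); move: h1 h2 => /=.
set x3 := l ^+ 2 + _ - _ - _ - _ => /eqP h1 h2.
have e : x1 = l ^+ 2 + a1 * l - a2 - x3 - x2 by rewrite /x3; ring.
rewrite -subr_eq0; apply/eqP.
have h1' : (l * x1 + n) ^+ 2 + a1 * x1 * (l * x1 + n) + a3 * (l * x1 + n)
  - (x1 ^+ 3 + a2 * x1 ^+ 2 + a4 * x1 + a6) = 0 by rewrite h1 subrr.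
rewrite -[LHS]subr0 -{1}h1' -[RHS](mulr0 (x1 - x3)) -h2.
move: e; clearbody x3 => e.
have {e}-> : a2 = l ^+ 2 + a1 * l - x1 - x3 - x2 by rewrite [in RHS]e; ring.
ring.
Qed.

Lemma on_curve_add P Q : on_curve P -> on_curve Q -> on_curve (add_coord P Q).
Proof.
case: P Q => [[x1 y1]|] [[x2 y2]|] // hP hQ; rewrite [add_coord _ _]/=.
have [e|ne] := eqVneq x1 x2.
  subst x2; case: ifPn => // hy.
  have ey : y2 = y1.
    apply/esym/eqP; rewrite -subr_eq0 -(mulIr_eq0 _ (mulIf hy)); apply/eqP.
    move: hP hQ => /= /eqP hP /eqP hQ.
    rewrite -[RHS](subrr (x1 ^+ 3 + a2 * x1 ^+ 2 + a4 * x1 + a6)).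
    rewrite -[in X in _ = X - _]hP -hQ; ring.
  subst y2.
  have hd : 2%:R * y1 + a1 * x1 + a3 != 0.
    by move: hy; rewrite mulr_natl mulr2n.
  set l := _ / _; apply: on_curve_line; first by rewrite addrC subrK.
  have hl : l * (2%:R * y1 + a1 * x1 + a3) =
      3%:R * x1 ^+ 2 + 2%:R * a2 * x1 + a4 - a1 * y1 by rewrite divfK.
  rewrite /alpha -[RHS](subrr (l * (2%:R * y1 + a1 * x1 + a3))).
  rewrite [in X in _ = X - _]hl; clearbody l; ring.
have hd : x2 - x1 != 0 by rewrite subr_eq0 eq_sym.
set l := _ / _; apply: on_curve_line; first by rewrite addrC subrK.
have hl : y2 = y1 + l * (x2 - x1) by rewrite divfK // addrC subrK.
clearbody l; apply/eqP; rewrite -(mulIr_eq0 _ (mulIf hd)); apply/eqP.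
move: hP hQ => /= /eqP hP /eqP; rewrite hl => hQ.
transitivity ((x2 ^+ 3 + a2 * x2 ^+ 2 + a4 * x2 + a6)
   - (x2 ^+ 3 + a2 * x2 ^+ 2 + a4 * x2 + a6)
   - ((x1 ^+ 3 + a2 * x1 ^+ 2 + a4 * x1 + a6)
   - (x1 ^+ 3 + a2 * x1 ^+ 2 + a4 * x1 + a6))); last by rewrite !subrr.
rewrite -[in X in _ = _ - X - _]hQ -[in X in _ = _ - (_ - X)]hP /alpha; ring.
Qed.

Definition ec_point := {P : option (F * F) | on_curve P}.

Definition ec_zero : ec_point := exist on_curve None isT.

Definition ec_opp (P : ec_point) : ec_point :=
  exist on_curve _ (on_curve_opp (valP P)).

Definition ec_add (P Q : ec_point) : ec_point :=
  exist on_curve _ (on_curve_add (valP P) (valP Q)).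

Definition ec_mulz (P : ec_point) (m : int) : ec_point :=
  match m with
  | Posz n => iter n (ec_add P) ec_zero
  | Negz n => ec_opp (iter n.+1 (ec_add P) ec_zero)
  end.

Definition ec_lin_indep (r : nat) (P : 'I_r -> ec_point) : Prop :=
  forall c : 'I_r -> int,
    \big[ec_add/ec_zero]_(i < r) ec_mulz (P i) (c i) = ec_zero ->
    forall i, c i = 0.

(* The rank of the abelian group of points is the maximal size of a
   [Z]-linearly independent family.  The default value [0] is never used over
   number fields, since the group is then finitely generated. *)
Definition ec_rank : nat :=
  xget 0%N [set r : nat |
    (exists P : 'I_r -> ec_point, ec_lin_indep P) /\
    (forall s (Q : 'I_s -> ec_point), ec_lin_indep Q -> (s <= r)%N)].

End Points.

Section Places.
Context (R : realType).

Record absval (K : fieldType) := AbsVal {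
  abs_fun :> K -> R;
  abs_ge0 : forall x, 0 <= abs_fun x;
  abs_eq0 : forall x, (abs_fun x == 0) = (x == 0);
  absM : forall x y, abs_fun (x * y) = abs_fun x * abs_fun y;
  abs_leD : forall x y, abs_fun (x + y) <= abs_fun x + abs_fun y;
  abs_nontrivial : exists2 x, x != 0 & abs_fun x != 1 }.

HB.instance Definition _ K := gen_eqMixin (absval K).
HB.instance Definition _ K := gen_choiceMixin (absval K).

Lemma abs1 (K : fieldType) (a : absval K) : a 1 = 1.
Proof.
have a10 : a 1 != 0 by rewrite abs_eq0 oner_eq0.
by apply: (mulfI a10); rewrite -absM !mulr1.
Qed.

Lemma absN (K : fieldType) (a : absval K) x : a (- x) = a x.
Proof.
have sq : a (- x) ^+ 2 = a x ^+ 2 by rewrite !expr2 -!absM mulrNN.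
by apply/eqP; rewrite -(@eqrXn2 _ 2) ?abs_ge0 ?sq.
Qed.

(* The field [K] with the metric topology defined by [a]. *)
Definition valued (K : fieldType) (a : absval K) : Type := K.

Section ValuedMetric.
Context (K : fieldType) (a : absval K).

HB.instance Definition _ := Choice.on (valued a).

Let dist (x y : valued a) : R := a ((x : K) - (y : K)).

Let dist_xx x : dist x x = 0.
Proof. by apply/eqP; rewrite /dist subrr abs_eq0. Qed.

Let dist_pos x y : dist x y = 0 -> x = y.
Proof. by move/eqP; rewrite abs_eq0 subr_eq0 => /eqP. Qed.

Let dist_sym x y : dist x y = dist y x.
Proof. by rewrite /dist -absN opprB. Qed.

Let dist_triangle y x z : dist x z <= dist x y + dist y z.
Proof.
by apply: le_trans (abs_leD a _ _); rewrite addrA subrK.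
Qed.

HB.instance Definition _ :=
  @isMetric.Build R (valued a) dist dist_xx dist_pos dist_sym dist_triangle.

End ValuedMetric.

Definition abs_equiv (K : fieldType) (a b : absval K) : bool :=
  `[< exists2 s : R, 0 < s & forall x, b x = a x `^ s >].

Section Equivalence.
Context (K : fieldType).

Lemma abs_equiv_refl : reflexive (@abs_equiv K).
Proof.
by move=> a; apply/asboolP; exists 1 => // x; rewrite powRr1 ?abs_ge0.
Qed.

Lemma abs_equiv_impl (a b : absval K) : abs_equiv a b -> abs_equiv b a.
Proof.
move=> /asboolP[s s0 h]; apply/asboolP; exists s^-1; first by rewrite invr_gt0.
by move=> x; rewrite h -powRrM divff ?gt_eqF // powRr1 ?abs_ge0.
Qed.

Lemma abs_equiv_sym : symmetric (@abs_equiv K).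
Proof. by move=> a b; apply/idP/idP; exact: abs_equiv_impl. Qed.

Lemma abs_equiv_trans : transitive (@abs_equiv K).
Proof.
move=> b a c /asboolP[s s0 hs] /asboolP[t t0 ht]; apply/asboolP.
by exists (s * t); [exact: mulr_gt0|move=> x; rewrite ht hs powRrM].
Qed.

Canonical abs_equiv_rel :=
  EquivRel (@abs_equiv K) abs_equiv_refl abs_equiv_sym abs_equiv_trans.

End Equivalence.

(* A place is an equivalence class of nontrivial absolute values; for a number
   field this covers both the finite and the infinite places. *)
Definition place (K : fieldType) := {eq_quot (@abs_equiv_rel K)}.

Record localField := LocalField {
  lf_sort :> fieldType;
  lf_abs : absval lf_sort;
  lf_locally_compact : locally_compact [set: valued lf_abs] }.

(* Isomorphisms of local fields are those of topological fields: the chosen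
   absolute values need not correspond. *)
Definition lf_isomorphism (L L' : localField) (phi : {rmorphism L -> L'}) :
    Prop :=
  exists psi : L' -> L,
    [/\ cancel phi psi, cancel psi phi,
        continuous (phi : valued (lf_abs L) -> valued (lf_abs L')) &
        continuous (psi : valued (lf_abs L') -> valued (lf_abs L))].

(* [iota : K -> L] exhibits [L] as the completion of [K] at [v].  A locally
   compact [L] is automatically complete. *)
Definition is_completion (K : fieldType) (v : place K) (L : localField)
    (iota : {rmorphism K -> L}) : Prop :=
  dense (range iota : set (valued (lf_abs L))) /\
  exists2 a : absval K, \pi_(place K) a = v &
    forall x, lf_abs L (iota x) = a x.

Definition local_invariant (A : zmodType)
    (lambda : forall L : localField, ellCurve L -> A) : Prop :=
  forall (L L' : localField) (phi : {rmorphism L -> L'})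
    (E : ellCurve L) (E' : ellCurve L'),
  lf_isomorphism phi -> ec_isom (ec_map phi E) E' ->
  lambda L E = lambda L' E'.

(* Completions are only determined up to isomorphism, so the decomposition is
   required for every choice of a completion [Kv v] at each place [v]; as
   [lambda] is an invariant, the choice does not matter. *)
Definition sum_of_local_invariants (A : zmodType)
    (Lambda : forall K : fieldExtType rat, ellCurve K -> A) : Prop :=
  exists2 lambda : forall L : localField, ellCurve L -> A,
    local_invariant lambda &
    forall (K : fieldExtType rat) (E : ellCurve K)
      (Kv : place K -> localField) (iota : forall v, {rmorphism K -> Kv v}),
    (forall v, is_completion v (iota v)) ->
    finite_set [set v | lambda (Kv v) (ec_map (iota v) E) != 0] /\
    Lambda K E =
      \sum_(v \in [set: place K]) lambda (Kv v) (ec_map (iota v) E).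

End Places.

(* Main.v *)
Require Import Defs.
From HB Require Import structures.
From mathcomp Require Import all_boot all_order all_algebra all_field.
From mathcomp Require Import fingroup cyclic generic_quotient ring_quotient.
From mathcomp Require Import all_classical all_reals all_analysis.
From mathcomp Require Import ring lra zify.
Set Implicit Arguments.
Unset Strict Implicit.
Unset Printing Implicit Defensive.
Import Order.TTheory GRing.Theory Num.Theory.
Local Open Scope ring_scope.

(** The obstruction is integrality: although the rank of an elliptic curve is
    additive over quadratic twists, a sum of local terms over a family of
    twists can be forced to be divisible by [4] while the sum of the ranks
    is not.

    Let [E_n] be the congruent number curve [y^2 = x^3 - n^2 x], the quadratic
    twist of [E_1] by [n], and let [n] run over the eight divisors of
    [1419 = 3 * 11 * 43].  Over a field [L] the curves [E_n] and [E_m] are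
    isomorphic as soon as [n m] is plus or minus a square of [L].  In every
    completion [L] of the rationals the classes of [3], [11], [43] modulo
    squares and sign lie in a group of order at most [2]
    ([local_square_classes]): at infinity all three are squares; at [2] they
    are all congruent to [3] modulo [8]; at [p = 3], [11], [43] one has
    [p = 3] modulo [4], so that every unit is a square up to sign; at any other
    prime they are units, among which squares have index at most [2].  Hence
    the eight curves [E_n] fall over [L] into two groups of four isomorphic
    curves, and for every place the eight values of a local invariant add up
    to a multiple of [4] ([loc_sum_dvd4]).  If the rank were a sum of local
    invariants, the sum of the eight ranks would be divisible by [4].

    Complete 2-descent contradicts this.  A rational point [P = (x, y)] is
    mapped to the classes of [x], [x - n] and [x + n] modulo squares.  After
    translation by a point of order two these classes are represented by
    positive divisors [d1], [d2], [d3] of [n] that are congruent to [1] modulo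
    [8] and whose product is a square ([covering_mod8]); and since [-1] and
    [2] are nonresidues modulo each prime factor of [n], all three are [1] as
    soon as one of them is ([covering_trivial]).  When [n] has at most two
    prime factors one of them must be [1], so that every point is in
    [2 E_n(Q) + E_n[2]] and the rank is [0] ([rank_small]).  For [n = 1419]
    the point modulo [2 E_n(Q) + E_n[2]] is determined by [d1], which has four
    possible values; so the rank is at most [3], and it is positive because
    the point with abscissa [1419 * 27 / 16] has infinite order
    ([rank1419]).

    Two theories are developed on the way.  Passing from the finiteness of
    [E(Q) / 2 E(Q)] to a bound on the rank requires the group law, whose
    associativity rests on a single rational identity ([chord_identity]), and
    Fermat's infinite descent with the naive height of the abscissa
    ([height_descent], [infinite_descent]).  On the local side one has to know
    that completions exist: the completion of a valued field is built
    from Cauchy sequences, and is locally compact when the unit ball is totally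
    bounded ([completion_locally_compact]), which for an arbitrary absolute
    value of the rationals follows from the arguments of Ostrowski's theorem
    ([rational_totally_bounded]). *)

(** * The group law on a Weierstrass curve *)

Section GroupLaw.
Context (F : fieldType) (E : ellCurve F).
Implicit Types P Q S : option (F * F).

Local Notation a1 := (ec_a1 E).
Local Notation a2 := (ec_a2 E).
Local Notation a3 := (ec_a3 E).
Local Notation a4 := (ec_a4 E).
Local Notation a6 := (ec_a6 E).

(** The three equations compare coefficients in
    [f(X) - (l X + n)^2 - a1 X (l X + n) - a3 (l X + n) = (X - x1) (X - x2) (X - x3)],
    where [f] is the cubic of the curve.  Multiplicities are taken into
    account, so that tangents need no separate treatment; and the coefficients
    [a2], [a4], [a6] are expressed polynomially in the other quantities. *)
Definition line_meets (l n x1 x2 x3 : F) : Prop :=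
  [/\ a2 = l ^+ 2 + a1 * l - (x1 + x2 + x3),
      a4 = 2%:R * l * n + a1 * n + a3 * l + (x1 * x2 + x1 * x3 + x2 * x3) &
      a6 = n ^+ 2 + a3 * n - x1 * x2 * x3].

Definition collinear P Q S : Prop :=
  if (P, Q, S) is (Some (x1, y1), Some (x2, y2), Some (x3, y3)) then
    exists l n, line_meets l n x1 x2 x3 /\
      [/\ y1 = l * x1 + n, y2 = l * x2 + n & y3 = l * x3 + n]
  else False.

Lemma collinearC P Q S : collinear P Q S -> collinear Q P S.
Proof.
case: P Q S => [[x1 y1]|] [[x2 y2]|] [[x3 y3]|] //=.
move=> [l [n [[e2 e4 e6] [-> -> ->]]]]; exists l, n; split; split=> //.
- by rewrite e2; ring.
- by rewrite e4; ring.
- by rewrite e6; ring.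
Qed.

Lemma collinearCA P Q S : collinear P Q S -> collinear P S Q.
Proof.
case: P Q S => [[x1 y1]|] [[x2 y2]|] [[x3 y3]|] //=.
move=> [l [n [[e2 e4 e6] [-> -> ->]]]]; exists l, n; split; split=> //.
- by rewrite e2; ring.
- by rewrite e4; ring.
- by rewrite e6; ring.
Qed.

Lemma collinearN P Q S : collinear P Q S ->
  collinear (opp_coord E P) (opp_coord E Q) (opp_coord E S).
Proof.
case: P Q S => [[x1 y1]|] [[x2 y2]|] [[x3 y3]|] //=.
move=> [l [n [[e2 e4 e6] [-> -> ->]]]]; exists (- l - a1), (- n - a3).
split; split=> //; try by ring.
- by rewrite [LHS]e2; ring.
- by rewrite [LHS]e4; ring.
- by rewrite [LHS]e6; ring.
Qed.

(** Moving a singular point to the origin makes [a3], [a4] and [a6]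
    vanish, and with them the discriminant, which such a translation does not
    change. *)
Lemma nonsingular x y : on_curve E (Some (x, y)) ->
  2%:R * y + a1 * x + a3 = 0 ->
  3%:R * x ^+ 2 + 2%:R * a2 * x + a4 - a1 * y = 0 -> False.
Proof.
move=> /eqP h hy hx; case/negP: (ec_disc_neq0 E).
have -> : weierstrass_disc a1 a2 a3 a4 a6 =
  weierstrass_disc a1 (a2 + 3%:R * x) (2%:R * y + a1 * x + a3)
    (3%:R * x ^+ 2 + 2%:R * a2 * x + a4 - a1 * y)
    (x ^+ 3 + a2 * x ^+ 2 + a4 * x + a6 - (y ^+ 2 + a1 * x * y + a3 * y)).
  by rewrite /weierstrass_disc; ring.
by rewrite hy hx h subrr /weierstrass_disc; apply/eqP; ring.
Qed.

Lemma opp_coordK P : opp_coord E (opp_coord E P) = P.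
Proof. by case: P => [[x y]|] //=; congr (Some (_, _)); ring. Qed.

Lemma same_abscissa x y1 y2 :
  on_curve E (Some (x, y1)) -> on_curve E (Some (x, y2)) ->
  y1 + y2 + a1 * x + a3 != 0 -> y1 = y2.
Proof.
move=> /= /eqP h1 /eqP h2 h; apply/eqP; rewrite -subr_eq0.
rewrite -(mulIr_eq0 _ (mulIf h)); apply/eqP.
rewrite -[RHS](subrr (x ^+ 3 + a2 * x ^+ 2 + a4 * x + a6)).
rewrite -[in X in _ = X - _]h1 -h2; ring.
Qed.

(** The definition of the sum by slopes distinguishes chords
    from tangents; in terms of [collinear] it becomes symmetric in the three
    points. *)
Lemma add_collinear x1 y1 x2 y2 S :
  on_curve E (Some (x1, y1)) -> on_curve E (Some (x2, y2)) ->
  S != None ->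
  add_coord E (Some (x1, y1)) (Some (x2, y2)) = opp_coord E S <->
  collinear (Some (x1, y1)) (Some (x2, y2)) S.
Proof.
case: S => [[x3 y3]|] // h1 h2 _.
have hl l : add_coord E (Some (x1, y1)) (Some (x2, y2)) =
    line_coord E l (y1 - l * x1) x1 x2 ->
    y2 = l * x2 + (y1 - l * x1) ->
    a4 - 2%:R * l * (y1 - l * x1) - a1 * (y1 - l * x1) - a3 * l =
      x1 * x2 + (x1 + x2) * (l ^+ 2 + a1 * l - a2 - x1 - x2) ->
  (forall l' n', line_meets l' n' x1 x2 x3 -> y1 = l' * x1 + n' ->
     y2 = l' * x2 + n' -> l' = l) ->
  add_coord E (Some (x1, y1)) (Some (x2, y2)) = opp_coord E (Some (x3, y3)) <->
  collinear (Some (x1, y1)) (Some (x2, y2)) (Some (x3, y3)).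
  move=> hadd e2 e4 hl; rewrite hadd; split=> [|[l' [n' [hm [d1 d2 d3]]]]].
    move/(congr1 (opp_coord E)); rewrite /line_coord !opp_coordK => -[ex ey].
    move/eqP: e4; rewrite -subr_eq0 => /eqP e4.
    exists l, (y1 - l * x1); split; split.
    - by rewrite -ex; ring.
    - by rewrite -ex -[LHS]subr0 -e4; ring.
    - move: h1 => /=; rewrite -ex -subr_eq0 => /eqP h1.
      apply/eqP; rewrite -subr_eq0 -oppr_eq0 -h1; apply/eqP.
      rewrite -[LHS]addr0 -(mulr0 (- x1)) -e4; ring.
    - by ring.
    - by [].
    - by rewrite -ex -ey.
  have el := hl _ _ hm d1 d2; case: hm => e2' _ _.
  rewrite /line_coord -el.
  have -> : y1 - l' * x1 = n' by rewrite d1; ring.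
  have -> : l' ^+ 2 + a1 * l' - a2 - x1 - x2 = x3 by rewrite e2'; ring.
  by rewrite -d3.
have [e|ne] := eqVneq x1 x2; last first.
  have hd : x2 - x1 != 0 by rewrite subr_eq0 eq_sym.
  apply: (hl ((y2 - y1) / (x2 - x1))).
  - by rewrite /= (negPf ne).
  - by field.
  - have := on_curve_add h1 h2; rewrite [add_coord _ _ _]/= (negPf ne).
    move=> _; move: h1 h2 => /=.
    set l := _ / _; have hl' : y2 = y1 + l * (x2 - x1).
      by rewrite /l divfK // addrC subrK.
    clearbody l; rewrite hl' => /eqP h1 /eqP h2; apply/eqP.
    rewrite -subr_eq0 -(mulIr_eq0 _ (mulIf hd)); apply/eqP.
    transitivity ((x2 ^+ 3 + a2 * x2 ^+ 2 + a4 * x2 + a6)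
      - (x2 ^+ 3 + a2 * x2 ^+ 2 + a4 * x2 + a6)
      - ((x1 ^+ 3 + a2 * x1 ^+ 2 + a4 * x1 + a6)
      - (x1 ^+ 3 + a2 * x1 ^+ 2 + a4 * x1 + a6))); last by rewrite !subrr.
    by rewrite -[in X in _ = _ - X - _]h2 -[in X in _ = _ - (_ - X)]h1; ring.
  - by move=> l' n' _ -> ->; field.
subst x2; have [hy|hy] := eqVneq (y1 + y2 + a1 * x1 + a3) 0.
  rewrite /= eqxx hy eqxx; split=> // -[l [n [[e2 e4 e6] [d1 d2 d3]]]].
  have e12 : y2 = y1 by rewrite d1 d2.
  have sing : 2%:R * y1 + a1 * x1 + a3 = 0 by rewrite -hy e12; ring.
  case: (nonsingular h1 sing).
  by rewrite -[RHS](mulr0 l) -sing e4 e2 d1; ring.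
have e12 := same_abscissa h1 h2 hy; subst y2.
have hd : 2%:R * y1 + a1 * x1 + a3 != 0.
  by move: hy; rewrite mulr_natl mulr2n.
apply: (hl ((3%:R * x1 ^+ 2 + 2%:R * a2 * x1 + a4 - a1 * y1)
               / (2%:R * y1 + a1 * x1 + a3))).
- by rewrite /= eqxx (negPf hy).
- by ring.
- by field.
- move=> l' n' [e2 e4 e6] d1 _.
  apply: (mulIf hd); rewrite divfK // e2 e4 d1; ring.
Qed.

Definition sum_zero P Q S := add_coord E P Q = opp_coord E S.

Lemma add_coord0 P : add_coord E P None = P.
Proof. by case: P => [[]|]. Qed.

Lemma add_coordN P : add_coord E P (opp_coord E P) = None.
Proof.
case: P => [[x y]|] //=; rewrite eqxx ifT //.
by apply/eqP; ring.
Qed.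

Lemma add_coord_eq0 P Q : on_curve E P -> on_curve E Q ->
  add_coord E P Q = None -> Q = opp_coord E P.
Proof.
case: P Q => [[x1 y1]|] [[x2 y2]|] //= _ _.
have [->|//] := eqVneq x1 x2; case: eqP => // h _.
by congr (Some (_, _)); apply/eqP; rewrite -subr_eq0 -h; apply/eqP; ring.
Qed.

Lemma sum_zeroP P Q S : on_curve E P -> on_curve E Q ->
  P != None -> Q != None -> S != None ->
  sum_zero P Q S <-> collinear P Q S.
Proof.
by case: P Q => [[x1 y1]|] [[x2 y2]|] // hP hQ _ _; exact: add_collinear.
Qed.

Lemma add_coordC P Q : on_curve E P -> on_curve E Q ->
  add_coord E P Q = add_coord E Q P.
Proof.
move=> hP hQ; case: (eqVneq P None) => [->|P0]; first by rewrite add_coord0.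
case: (eqVneq Q None) => [->|Q0]; first by rewrite add_coord0.
case h : (add_coord E P Q) => [R|]; last first.
  by rewrite (add_coord_eq0 hP hQ h) -[X in add_coord _ _ X]opp_coordK add_coordN.
have /(sum_zeroP hP hQ) : sum_zero P Q (opp_coord E (Some R)).
  by rewrite /sum_zero opp_coordK.
have R0 : opp_coord E (Some R) != None by case: (R).
move=> /(_ P0 Q0 R0)/collinearC/(sum_zeroP hQ hP Q0 P0 R0).
by rewrite /sum_zero opp_coordK.
Qed.

Lemma sum_zeroCA P Q S : on_curve E P -> on_curve E Q -> on_curve E S ->
  sum_zero P Q S -> sum_zero P S Q.
Proof.
move=> hP hQ hS; case: (eqVneq S None) => [->|S0].
  by rewrite /sum_zero add_coord0 => /(add_coord_eq0 hP hQ) ->; rewrite opp_coordK.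
case: (eqVneq Q None) => [->|Q0].
  by rewrite /sum_zero add_coord0 => ->; rewrite (add_coordC (on_curve_opp hS)) ?add_coordN.
case: (eqVneq P None) => [->|P0].
  by rewrite /sum_zero /= => ->; rewrite opp_coordK.
by move=> /(sum_zeroP hP hQ P0 Q0 S0)/collinearCA/(sum_zeroP hP hS P0 S0 Q0).
Qed.

Lemma add_coordK P Q : on_curve E P -> on_curve E Q ->
  add_coord E (opp_coord E P) (add_coord E P Q) = Q.
Proof.
move=> hP hQ; have hR := on_curve_add hP hQ.
have : sum_zero P Q (opp_coord E (add_coord E P Q)).
  by rewrite /sum_zero opp_coordK.
move=> /(sum_zeroCA hP hQ (on_curve_opp hR)).
set R := add_coord E P Q in hR *; clearbody R.
case: (eqVneq R None) => [->|R0].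
  by rewrite /sum_zero !add_coord0 => ->; rewrite opp_coordK.
case: (eqVneq P None) => [->|P0].
  by rewrite /sum_zero /= => /(congr1 (opp_coord E)); rewrite !opp_coordK.
case: (eqVneq Q None) => [->|Q0].
  move=> /(add_coord_eq0 hP (on_curve_opp hR))/(congr1 (opp_coord E)).
  by rewrite !opp_coordK => ->; rewrite (add_coordC (on_curve_opp hP)) ?add_coordN.
have oN : forall S, S != None -> opp_coord E S != None by case=> [[]|].
move=> /(sum_zeroP hP (on_curve_opp hR) P0 (oN _ R0) Q0) /collinearN.
rewrite opp_coordK => /(sum_zeroP (on_curve_opp hP) hR (oN _ P0) R0 (oN _ Q0)).
by rewrite /sum_zero opp_coordK.
Qed.

(** Both sides are the abscissa and ordinate of
    [P1 + P2 + P4], bracketed in two ways, for [P1], [P2] on the line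
    [y = l x + n] with third intersection [P3] and [P4] at height [t] above
    that line.  In these coordinates the curve contains the four points for
    every choice of the parameters, since [c2] and [c3] are solved from the
    equations, and associativity becomes an identity of rational functions. *)
Lemma chord_identity (c1 l n x1 x2 x3 x4 t : F) :
  let y1 := l * x1 + n in let y2 := l * x2 + n in let y3 := l * x3 + n in
  let y4 := l * x4 + n + t in
  let c2 := l ^+ 2 + c1 * l - (x1 + x2 + x3) in
  let c3 := (x4 - x1) * (x4 - x2) * (x4 - x3) / t - t
            - 2%:R * (l * x4 + n) - c1 * x4 in
  let chord u v x y :=
    let m := (y - v) / (x - u) in
    let w := m ^+ 2 + c1 * m - c2 - u - x in
    (w, - (m * w + (v - m * u)) - c1 * w - c3) in
  let s := chord x2 y2 x4 y4 in
  t != 0 -> x4 - x2 != 0 -> x4 - x3 != 0 -> s.1 - x1 != 0 ->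
  chord x3 (- y3 - c1 * x3 - c3) x4 y4 = chord x1 y1 s.1 s.2.
Proof.
move=> /= t0 h2 h3 h1.
congr (_, _); field; rewrite t0 h2 h3 ?andbT /=; apply: contraNneq h1 => h;
  apply/eqP; apply: (mulIf (expf_neq0 2 h2)); rewrite mul0r -h; field;
  exact: h2.
Qed.

(** Only the three sums other than [P1 + P2] have to be
    chords; the first line may be tangent, which covers the associativity of
    [P + P + R] as well. *)
Lemma add_coordA_generic x1 y1 x2 y2 x3 y3 x4 y4 u v :
  collinear (Some (x1, y1)) (Some (x2, y2)) (Some (x3, y3)) ->
  on_curve E (Some (x4, y4)) ->
  x4 != x1 -> x4 != x2 -> x4 != x3 ->
  add_coord E (Some (x2, y2)) (Some (x4, y4)) = Some (u, v) -> u != x1 ->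
  add_coord E (opp_coord E (Some (x3, y3))) (Some (x4, y4)) =
  add_coord E (Some (x1, y1)) (Some (u, v)).
Proof.
move=> [l [n [[e2 e4 e6] [-> -> ->]]]] /= /eqP h.
rewrite -(subr_eq0 x4 x1) -(subr_eq0 x4 x2) -(subr_eq0 x4 x3) => n1 n2 n3.
(* The fourth point does not lie on the line, since a point of the curve on
   the line has one of the abscissae [x1], [x2], [x3]. *)
pose t := y4 - (l * x4 + n).
have ht : t * (t + 2%:R * (l * x4 + n) + a1 * x4 + a3) =
    (x4 - x1) * (x4 - x2) * (x4 - x3).
  move/eqP: h; rewrite -subr_eq0 => /eqP h; rewrite -[LHS]subr0 -h.
  by rewrite /t e2 e4 e6; ring.
have t0 : t != 0.
  apply: contraNneq (mulf_neq0 (mulf_neq0 n1 n2) n3) => t0.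
  by rewrite -ht t0 mul0r.
have ea3 : a3 = (x4 - x1) * (x4 - x2) * (x4 - x3) / t - t
    - 2%:R * (l * x4 + n) - a1 * x4.
  by rewrite -ht; field.
have ey : y4 = l * x4 + n + t by rewrite /t; ring.
have ident := @chord_identity a1 l n x1 x2 x3 x4 t.
rewrite /= -ea3 -e2 -ey in ident.
move: ident (ident t0 n2 n3) => _ {}ident.
rewrite ![x2 == _]eq_sym ![x3 == _]eq_sym ![x1 == _]eq_sym.
rewrite -(subr_eq0 x4 x2) -(subr_eq0 x4 x3) -(subr_eq0 u x1).
rewrite (negPf n2) (negPf n3) /line_coord /= => -[<- <-] n4.
rewrite (negPf n4).
by case: (ident n4) => -> ->.
Qed.

HB.instance Definition _ := Choice.copy (ec_point E) {P | on_curve E P}.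

Implicit Types A B C : ec_point E.

Local Notation "A ⊕ B" := (ec_add A B) (at level 50, left associativity).
Local Notation "⊖ A" := (ec_opp A) (at level 35, right associativity).
Local Notation O := (ec_zero E).

Lemma ec_addC A B : A ⊕ B = B ⊕ A.
Proof. by apply: val_inj; exact: add_coordC (valP A) (valP B). Qed.

Lemma ec_add0 A : O ⊕ A = A.
Proof. exact: val_inj. Qed.

Lemma ec_oppK A : ⊖ ⊖ A = A.
Proof. by apply: val_inj; exact: opp_coordK. Qed.

Lemma ec_addN A : ⊖ A ⊕ A = O.
Proof. by rewrite ec_addC; apply: val_inj; exact: add_coordN. Qed.

Lemma ec_addK A B : ⊖ A ⊕ (A ⊕ B) = B.
Proof. by apply: val_inj; exact: add_coordK (valP A) (valP B). Qed.

Lemma ec_addKV A B : A ⊕ (⊖ A ⊕ B) = B.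
Proof. by rewrite -{1}[A]ec_oppK ec_addK. Qed.

Lemma ec_add_rot A B C : A ⊕ B = ⊖ C -> A ⊕ C = ⊖ B.
Proof.
move=> /(congr1 val) h; apply: val_inj.
exact: sum_zeroCA (valP A) (valP B) (valP C) h.
Qed.

Lemma ec_opp_add A B : ⊖ (A ⊕ B) = ⊖ A ⊕ ⊖ B.
Proof.
have : A ⊕ ⊖ (A ⊕ B) = ⊖ B by apply: ec_add_rot; rewrite ec_oppK.
by move=> /(congr1 (ec_add (⊖ A))); rewrite ec_addK.
Qed.

Lemma ec_addI A B C : A ⊕ B = A ⊕ C -> B = C.
Proof. by move=> /(congr1 (ec_add (⊖ A))); rewrite !ec_addK. Qed.

Lemma ec_neq_abscissa x1 y1 x2 y2 (h1 : on_curve E (Some (x1, y1)))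
    (h2 : on_curve E (Some (x2, y2))) :
  (exist (on_curve E) _ h1 : ec_point E) != exist (on_curve E) _ h2 ->
  (exist (on_curve E) _ h1 : ec_point E) != ⊖ exist (on_curve E) _ h2 ->
  x1 != x2.
Proof.
move=> n1 n2; apply/eqP => e; subst x2.
have e : y1 + y2 + a1 * x1 + a3 != 0.
  apply: contraNneq n2 => h; apply/eqP/val_inj => /=; congr (Some (_, _)).
  by apply/eqP; rewrite -subr_eq0 -h; apply/eqP; ring.
case/negP: n1; apply/eqP/val_inj => /=.
by rewrite (same_abscissa h1 h2 e).
Qed.

Lemma ec_addA_generic A B C :
  A != O -> B != O -> A ⊕ B != O -> B ⊕ C != O ->
  C != O -> C != A -> C != ⊖ A -> C != B -> C != ⊖ B ->
  C != A ⊕ B -> C != ⊖ (A ⊕ B) -> B ⊕ C != A -> B ⊕ C != ⊖ A ->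
  (A ⊕ B) ⊕ C = A ⊕ (B ⊕ C).
Proof.
move=> A0 B0; have : sum_zero (val A) (val B) (val (⊖ (A ⊕ B))).
  by rewrite /sum_zero /= opp_coordK.
have : val (B ⊕ C) = add_coord E (val B) (val C) by [].
have -> : (A ⊕ B) ⊕ C = ⊖ ⊖ (A ⊕ B) ⊕ C by rewrite ec_oppK.
have -> : (C != A ⊕ B) = (C != ⊖ ⊖ (A ⊕ B)) by rewrite ec_oppK.
have <- : (⊖ (A ⊕ B) != O) = (A ⊕ B != O).
  congr (~~ _); apply/eqP/eqP => [/(congr1 (@ec_opp _ _))|->].
    by rewrite ec_oppK => ->; exact: val_inj.
  exact: val_inj.
move: (B ⊕ C) (⊖ (A ⊕ B)) => U S.
case: A A0 => -[[x1 y1]|] hA A0 //=.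
case: B B0 => -[[x2 y2]|] hB B0 //=.
case: C => -[[x4 y4]|] hC //=.
case: U => -[[u v]|] hU //=.
case: S => -[[x3 y3]|] hS //=.
move=> eU hcol _ _ _ nA nA' nB nB' nS' nS nU nU'.
have {}hcol := (@sum_zeroP _ _ (Some (x3, y3)) hA hB isT isT isT).1 hcol.
apply: val_inj; apply: (add_coordA_generic hcol hC _ _ _ (esym eU)).
- exact: ec_neq_abscissa nA nA'.
- exact: ec_neq_abscissa nB nB'.
- exact: ec_neq_abscissa nS nS'.
- exact: ec_neq_abscissa nU nU'.
Qed.

Lemma ec_addr0 A : A ⊕ O = A.
Proof. by rewrite ec_addC ec_add0. Qed.

Lemma ec_add_eq0 A B : A ⊕ B = O -> B = ⊖ A.
Proof.
by rewrite -(ec_addN A) [⊖ A ⊕ A]ec_addC => /ec_addI.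
Qed.

(** With the roles exchanged this is
    [(B + B) + A = B + (B + A)], where the tangent at [B] is allowed as first
    line of the generic case. *)
Lemma ec_addA_double_generic A B : A != B ⊕ B -> (A ⊕ B) ⊕ B = A ⊕ (B ⊕ B).
Proof.
move=> n2; have [->|B0] := eqVneq B O; first by rewrite !ec_addr0.
have [->|A0] := eqVneq A O; first by rewrite !ec_add0.
have [->|nB] := eqVneq A B; first by rewrite ec_addC.
have [->|nB'] := eqVneq A (⊖ B).
  by rewrite ec_addN ec_add0 ec_addK.
have [h|BB0] := eqVneq (B ⊕ B) O.
  have e := ec_add_eq0 h.
  by rewrite h ec_addr0 ec_addC {1}e [A ⊕ B]ec_addC ec_addK.
have [->|n2'] := eqVneq A (⊖ (B ⊕ B)).
  by rewrite ec_addN ec_opp_add [⊖ B ⊕ ⊖ B ⊕ B]ec_addC ec_addKV ec_addN.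
rewrite [A ⊕ B]ec_addC [LHS]ec_addC [RHS]ec_addC; apply/esym.
apply: ec_addA_generic => //.
- apply: contraNneq nB' => /ec_add_eq0 ->; exact/eqP.
- by apply: contraNneq A0 => h; apply/eqP/(@ec_addI B); rewrite h ec_addr0.
- apply: contraNneq n2' => h.
  have /ec_add_rot : B ⊕ A = ⊖ B by [].
  by move=> /(congr1 (@ec_opp _ _)); rewrite ec_oppK => ->.
Qed.

(** When [A = B + B] the sum [A + (B + B)] is again a
    tangent.  Subtracting [B] from both sides leads to the same statement for
    [- B] and [A], which is covered by the generic case unless
    [- B = A + A]; then [B] has order five and both sides can be computed. *)
Lemma ec_addA_double A B : (A ⊕ B) ⊕ B = A ⊕ (B ⊕ B).
Proof.
have [e|] := eqVneq A (B ⊕ B); last exact: ec_addA_double_generic.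
have hBA : ⊖ B ⊕ A = B by rewrite e ec_addK.
have [e'|ne] := eqVneq (⊖ B) (A ⊕ A).
  have hAB : A ⊕ B = ⊖ A by apply: ec_add_rot; rewrite -e'.
  rewrite -e -e' hAB {1}e ec_opp_add.
  by rewrite [⊖ B ⊕ ⊖ B ⊕ B]ec_addC ec_addKV.
have := ec_addA_double_generic ne; rewrite hBA => /(congr1 (ec_add B)).
by rewrite ec_addKV -e => <-; rewrite [RHS]ec_addC [B ⊕ A]ec_addC.
Qed.

(** When the last sum of one side is a tangent, cancelling a point
    reduces associativity to the case of two equal points. *)
Lemma ec_addA A B C : A ⊕ (B ⊕ C) = (A ⊕ B) ⊕ C.
Proof.
have [->|A0] := eqVneq A O; first by rewrite !ec_add0.
have [->|B0] := eqVneq B O; first by rewrite ec_add0 ec_addr0.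
have [->|C0] := eqVneq C O; first by rewrite !ec_addr0.
have [h|AB0] := eqVneq (A ⊕ B) O.
  by rewrite h (ec_add_eq0 h) ec_add0 ec_addKV.
have [h|BC0] := eqVneq (B ⊕ C) O.
  by rewrite h (ec_add_eq0 h) ec_addr0 [RHS]ec_addC [A ⊕ B]ec_addC ec_addK.
have [->|nA] := eqVneq C A; first by rewrite ec_addC [A ⊕ B]ec_addC.
have [->|nA'] := eqVneq C (⊖ A).
  by rewrite [RHS]ec_addC ec_addK [B ⊕ _]ec_addC ec_addKV.
have [->|nB] := eqVneq C B; first by rewrite ec_addA_double.
have [->|nB'] := eqVneq C (⊖ B).
  by rewrite [B ⊕ _]ec_addC ec_addN ec_addr0 [RHS]ec_addC [A ⊕ B]ec_addC ec_addK.
have [->|nS'] := eqVneq C (⊖ (A ⊕ B)).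
  rewrite [RHS]ec_addC ec_addN ec_opp_add [⊖ A ⊕ _]ec_addC ec_addKV.
  by rewrite ec_addC ec_addN.
have [h|nU'] := eqVneq (B ⊕ C) (⊖ A).
  by case/eqP: nS'; rewrite ec_opp_add -h [RHS]ec_addC ec_addK.
have [h|nS] := eqVneq C (A ⊕ B).
  have eB : B = ⊖ A ⊕ C by rewrite h ec_addK.
  by rewrite -h eB ec_addA_double ec_addKV.
have [h|nU] := eqVneq (B ⊕ C) A.
  have eB : B = ⊖ C ⊕ A by rewrite -h [B ⊕ C]ec_addC ec_addK.
  by rewrite h [A ⊕ B]ec_addC {1}eB ec_addA_double [RHS]ec_addC ec_addKV.
by rewrite ec_addA_generic.
Qed.

HB.instance Definition _ :=
  GRing.isZmodule.Build (ec_point E) ec_addA ec_addC ec_add0 ec_addN.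

End GroupLaw.

(** * Ranks and infinite descent in abelian groups *)

Section Descent.
Context (A : zmodType).

Definition int_comb (k : nat) (g : 'I_k -> A) (c : 'I_k -> int) : A :=
  \sum_i g i *~ c i.

(** More than [k] vectors in a space of dimension [k] over
    the rationals are dependent; clearing denominators gives an integral
    relation. *)
Lemma rank_le_generators k (g : 'I_k -> A) s (Q : 'I_s -> A) :
  (forall x, exists2 N, (0 < N)%N & exists c, x *+ N = int_comb g c) ->
  (forall c, int_comb Q c = 0 -> forall i, c i = 0) ->
  (s <= k)%N.
Proof.
move=> hg hQ; rewrite leqNgt; apply/negP => ltks.
have /choice[N hN] : forall i, exists N, (0 < N)%N /\ exists c, Q i *+ N = int_comb g c.
  by move=> i; have [N N0 hc] := hg (Q i); exists N.
have /choice[c hc] : forall i, exists c, Q i *+ N i = int_comb g c.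
  by move=> i; case: (hN i).
pose M : 'M[rat]_(s, k) := \matrix_(i, j) (c i j)%:~R.
have : (kermx M != 0).
  rewrite -mxrank_eq0 mxrank_ker subn_eq0 -ltnNge.
  exact: leq_ltn_trans (rank_leq_col M) ltks.
case/rowV0Pn=> v /sub_kermxP vM v0.
pose d := \prod_i denq (v 0 i).
have d0 : d != 0 by apply/prodf_neq0 => i _; exact: denq_neq0.
have /choice[w hw] : forall i, exists w : int, v 0 i * d%:~R = w%:~R.
  move=> i; exists (numq (v 0 i) * \prod_(j | j != i) denq (v 0 j)).
  rewrite /d (bigD1 i) //= !rmorphM /= mulrA; congr (_ * _).
  by rewrite -{1}[v 0 i]divq_num_den divfK // intr_eq0 denq_neq0.
have hwM j : \sum_i w i * c i j = 0.
  apply: (@intr_inj rat); rewrite rmorph_sum /=.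
  transitivity (\sum_i d%:~R * (v 0 i * M i j)).
    by apply: eq_bigr => i _; rewrite rmorphM /= -hw mxE mulrA [v 0 i * _]mulrC.
  rewrite -mulr_sumr; have := congr1 (fun u : 'rV_k => u 0 j) vM.
  by rewrite !mxE => ->; rewrite mulr0.
have rel : int_comb Q (fun i => w i * (N i)%:Z) = 0.
  transitivity (\sum_i (\sum_j g j *~ c i j) *~ w i).
    by apply: eq_bigr => i _; rewrite mulrC mulrzA -pmulrn hc.
  transitivity (\sum_i \sum_j g j *~ (w i * c i j)).
    apply: eq_bigr => i _; rewrite mulrz_suml; apply: eq_bigr => j _.
    by rewrite mulrC mulrzA.
  rewrite exchange_big big1 //= => j _.
  by rewrite -mulrz_sumr hwM mulr0z.
case/negP: v0; apply/eqP/rowP => i; rewrite mxE.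
have := hQ _ rel i; move/eqP; rewrite mulf_eq0 orbC.
have -> /= : ((N i)%:Z == 0) = false by apply/negbTE; rewrite -lt0n; case: (hN i).
move=> /eqP wi; have := hw i; rewrite wi => /eqP.
by rewrite mulf_eq0 intr_eq0 (negPf d0) orbF => /eqP.
Qed.

Context (U : eqType) (X : A -> U) (H : A -> nat).
Hypothesis X_sign : forall a b, X a = X b -> a = b \/ a = - b.
Hypothesis H_finite :
  forall B, exists l : seq U, forall a, (H a <= B)%N -> X a \in l.

(** Writing [x = s + t + 2 y] and repeating the step with
    [y] gives a sequence of bounded height, because the height of [y] grows at
    most like the square root of that of [x].  Two of its members agree up to
    sign, say the [i]-th and the [(i + d)]-th, so that [2^d - 1] or [2^d + 1]
    times that member is a combination of the [g i] modulo 2-torsion; hence so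
    is a multiple of [x]. *)
Lemma infinite_descent k (g : 'I_k -> A) B :
  (forall x, exists s t y, [/\ x = s + t + y *+ 2, t *+ 2 = 0,
     s = 0 \/ (exists i, s = g i) & ((H y) ^ 2 <= B * H x)%N]) ->
  forall x, exists2 N, (0 < N)%N & exists c, x *+ N = int_comb g c.
Proof.
move=> step x0.
pose G x := exists c, x *+ 2 = int_comb g c.
have G0 : G 0.
  by exists (fun=> 0); rewrite mul0rn /int_comb big1 // => i _; rewrite mulr0z.
have GB a b : G a -> G b -> G (a - b).
  move=> [c hc] [c' hc']; exists (fun i => c i - c' i).
  by rewrite mulrnBl hc hc' -sumrB; apply: eq_bigr => i _; rewrite mulrzBr.
have GN a : G a -> G (- a) by move=> ha; rewrite -sub0r; exact: GB.
have GD a b : G a -> G b -> G (a + b).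
  by move=> ha hb; rewrite -[b]opprK; apply: GB => //; exact: GN.
have GM a m : G a -> G (a *+ m).
  by move=> ha; elim: m => [|m IH]; rewrite ?mulr0n // mulrS; exact: GD.
have Gt t : t *+ 2 = 0 -> G t.
  by move=> ht; case: G0 => c hc; exists c; rewrite -hc ht mul0rn.
have Gg i : G (g i).
  exists (fun j => if j == i then 2 else 0).
  rewrite /int_comb (bigD1 i) //= eqxx big1 ?addr0 // => j /negPf ->.
  by rewrite mulr0z.
have /choice[f hf] : forall x, exists y, G (x - y *+ 2) /\ ((H y) ^ 2 <= B * H x)%N.
  move=> x; have [s [t [y [-> ht hs hy]]]] := step x; exists y; split=> //.
  rewrite addrK; apply: GD (Gt _ ht).
  by case: hs => [->//|[i ->]]; exact: Gg.
pose u n := iter n f x0.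
have uS i n : G (u i - u (i + n)%N *+ (2 ^ n)).
  elim: n => [|n IH]; first by rewrite addn0 expn0 mulr1n subrr.
  rewrite addnS expnS mulrnA.
  rewrite -[u i](subrK (u (i + n)%N *+ 2 ^ n)) -addrA; apply: GD IH _.
  by rewrite -mulrnBl; apply: GM; case: (hf (u (i + n)%N)).
(* The square of the next height is at most [B] times the present one, so
   the bound [maxn B (H x0)] is inherited. *)
have uB n : (H (u n) <= maxn B (H x0))%N.
  elim: n => [|n IH]; first exact: leq_maxr.
  rewrite -leq_sqr; case: (hf (u n)) => _ /leq_trans; apply.
  by rewrite -mulnn leq_mul // leq_maxl.
have [l hl] := H_finite (maxn B (H x0)).
have : ~~ uniq [seq X (u i) | i <- iota 0 (size l).+1].
  apply/negP => hu; have := @uniq_leq_size _ _ l hu; rewrite size_map size_iota ltnn.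
  suff sub : {subset [seq X (u i) | i <- iota 0 (size l).+1] <= l}.
    by move=> /(_ sub).
  by move=> _ /mapP[i _ ->]; apply: hl.
move/(uniqPn (X x0)) => [i [j [ltij]]]; rewrite size_map size_iota => ltj.
have lti := ltn_trans ltij ltj.
rewrite !(nth_map 0%N) ?size_iota // !nth_iota // !add0n => /X_sign eij.
have [d d0 ej] : exists2 d, (0 < d)%N & j = (i + d)%N.
  by exists (j - i)%N; rewrite ?subn_gt0 // subnKC // ltnW.
have p2 : (1 < 2 ^ d)%N by rewrite -{1}(expn0 2) ltn_exp2l.
have [N N0 hN] : exists2 N, (0 < N)%N & G (u i *+ N).
  have := uS i d; rewrite -ej; case: eij => [->|->] h.
    exists (2 ^ d - 1)%N; first by rewrite subn_gt0.
    by rewrite mulrnBr ?(ltnW p2) // mulr1n -opprB; exact: GN.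
  exists (2 ^ d + 1)%N; first by rewrite addn1.
  by rewrite mulNrn mulrnDr mulr1n opprD addrC.
have := GM _ N (uS 0%N i); rewrite add0n mulrnBl -!mulrnA mulnC mulrnA => hx.
have := GD _ _ hx (GM _ (2 ^ i)%N hN); rewrite -!mulrnA mulnC subrK => -[c hc].
exists (N * 2)%N; first by rewrite muln_gt0 N0.
by exists c; rewrite mulrnA.
Qed.

End Descent.

(** * The descent map attached to a point of order two *)

Section TwoDescent.
Context (F : fieldType) (E : ellCurve F).
Hypotheses (a1_0 : ec_a1 E = 0) (a3_0 : ec_a3 E = 0).
Implicit Types P Q : ec_point E.

Definition is_sq (z : F) := exists r, z = r ^+ 2.

Definition deriv_cubic (e : F) := 3%:R * e ^+ 2 + 2%:R * ec_a2 E * e + ec_a4 E.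

(** The class of [x - e] modulo squares; at the point of order
    two with abscissa [e] it is replaced by the product of the classes for the
    two other roots, that is by the derivative of the cubic. *)
Definition delta_coord (e : F) (P : option (F * F)) : F :=
  if P is Some (x, _) then if x == e then deriv_cubic e else x - e else 1.

Definition delta e P := delta_coord e (val P).

Definition cubic_root (e : F) := on_curve E (Some (e, 0)).

Section Root.
Context (e : F).
Hypothesis e_root : cubic_root e.

Lemma deriv_cubic_neq0 : deriv_cubic e != 0.
Proof.
apply/eqP => h; apply: (nonsingular e_root); rewrite a1_0 ?a3_0; first by ring.
by rewrite -[RHS]h /deriv_cubic; ring.
Qed.

Lemma delta_neq0 P : delta e P != 0.
Proof.
case: P => -[[x y]|] h /=; rewrite /delta /= ?oner_eq0 //.
by case: (eqVneq x e) => [_|]; rewrite ?deriv_cubic_neq0 // subr_eq0.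
Qed.

(** If the line is [y = l x + n], then
    [(x1 - e) (x2 - e) (x3 - e) = (l e + n)^2].  When one of the points is the
    point of order two itself, both sides vanish, and the derivative of the
    equation of the line section at [e] takes over. *)
Lemma delta_collinear (P Q S : option (F * F)) : collinear E P Q S ->
  is_sq (delta_coord e P * delta_coord e Q * delta_coord e S).
Proof.
wlog ne : P Q S / [|| if P is Some (x, _) then x == e else false
    | [&& if P is Some (x, _) then x != e else true,
          if Q is Some (x, _) then x != e else true
        & if S is Some (x, _) then x != e else true]].
  move=> wl h.
  case p : (if P is Some (x, _) then x == e else false).
    by apply: wl => //; rewrite p.
  case q : (if Q is Some (x, _) then x == e else false).
    rewrite [X in is_sq (X * _)]mulrC; apply: wl (collinearC h).
    by rewrite q.
  case s : (if S is Some (x, _) then x == e else false).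
    rewrite mulrC mulrA; apply: wl (collinearC (collinearCA h)).
    by rewrite s.
  apply: wl => //; apply/orP; right.
  case: (P) p => [[x1 y1]|] /= p; case: (Q) q => [[x2 y2]|] /= q;
  by case: (S) s => [[x3 y3]|] /= s; rewrite ?p ?q ?s.
case: P Q S ne => [[x1 y1]|] [[x2 y2]|] [[x3 y3]|] //= ne.
move=> [l [n [[e2 e4 e6] _]]].
rewrite ?(a1_0, a3_0) in e2 e4 e6.
have hprod : (x1 - e) * (x2 - e) * (x3 - e) = (l * e + n) ^+ 2.
  move: e_root => /eqP; rewrite a1_0 a3_0 e2 e4 e6 => h; apply/eqP.
  rewrite -subr_eq0; move/eqP: h; rewrite -subr_eq0 => /eqP h.
  by rewrite -h; apply/eqP; ring.
case/orP: ne => [/eqP ex1|/and3P[/negPf -> /negPf -> /negPf ->]]; last first.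
  by exists (l * e + n).
subst x1; rewrite eqxx.
have /eqP : (l * e + n) ^+ 2 = 0 by rewrite -hprod subrr !mul0r.
rewrite expf_eq0 /= => /eqP hl.
have d : deriv_cubic e = (x2 - e) * (x3 - e).
  rewrite -[RHS]addr0 -[X in _ = _ + X](mulr0 (2%:R * l)) -hl /deriv_cubic e2 e4.
  by ring.
have := deriv_cubic_neq0; rewrite {1}d mulf_eq0 negb_or !subr_eq0.
move=> /andP[/negPf -> /negPf ->]; exists (deriv_cubic e).
by rewrite -mulrA -d.
Qed.

Lemma delta_opp P : delta e (- P) = delta e P.
Proof. by case: P => -[[x y]|]. Qed.

Lemma delta_add P Q : is_sq (delta e P * delta e Q * delta e (P + Q)).
Proof.
have [->|P0] := eqVneq P 0.
  by rewrite add0r /delta /= mul1r; exists (delta e Q); rewrite expr2.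
have [->|Q0] := eqVneq Q 0.
  by rewrite addr0 /delta /= mulr1; exists (delta e P); rewrite expr2.
have [/eqP|S0] := eqVneq (P + Q) 0.
  rewrite addr_eq0 => /eqP ->; rewrite addNr delta_opp mulr1.
  by exists (delta e Q); rewrite expr2.
rewrite -(delta_opp (P + Q)); apply: delta_collinear.
apply/(sum_zeroP (valP P) (valP Q)).
- by apply: contra_neq P0 => h; exact: val_inj.
- by apply: contra_neq Q0 => h; exact: val_inj.
- rewrite -oppr_eq0 in S0.
  by apply: contra_neq S0 => h; exact: val_inj.
- by rewrite /sum_zero /= opp_coordK.
Qed.

End Root.

(** If [x - e_i = r_i^2] for the three roots, with the sign of
    [r_1] chosen such that [y = r_1 r_2 r_3], then half of the point has
    abscissa [x + r_1 r_2 + r_1 r_3 + r_2 r_3], and the tangent there has slope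
    [r_1 + r_2 + r_3]. *)
Lemma halve_point (e1 e2 e3 : F) P : 2%:R != 0 :> F ->
  ec_a2 E = - (e1 + e2 + e3) -> ec_a4 E = e1 * e2 + e1 * e3 + e2 * e3 ->
  ec_a6 E = - (e1 * e2 * e3) ->
  is_sq (delta e1 P) -> is_sq (delta e2 P) -> is_sq (delta e3 P) ->
  exists Q, P = Q *+ 2.
Proof.
move=> two h2 h4 h6; case: P => -[[x y]|] hP; last first.
  by exists 0; rewrite mul0rn; exact: val_inj.
have sq e : is_sq (delta e (exist (on_curve E) (Some (x, y)) hP)) -> exists r, x - e = r ^+ 2.
  rewrite /delta /=; case: eqVneq => [->|//] _.
  by exists 0; rewrite subrr expr0n.
move=> /sq[r1 d1] /sq[r2 d2] /sq[r3 d3] {sq}.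
have [s1 [{}d1 dy]] : exists s1, x - e1 = s1 ^+ 2 /\ y = s1 * r2 * r3.
  have : y ^+ 2 = (r1 * r2 * r3) ^+ 2.
    rewrite !exprMn -d1 -d2 -d3.
    move: (hP) => /= /eqP; rewrite a1_0 a3_0 h2 h4 h6 => h.
    have -> : y ^+ 2 = y ^+ 2 + 0 * x * y + 0 * y by ring.
    by rewrite h; ring.
  move/eqP; rewrite eqf_sqr => /orP[] /eqP ->; first by exists r1.
  by exists (- r1); rewrite sqrrN; split=> //; ring.
have {h2}h2 : ec_a2 E = s1 ^+ 2 + r2 ^+ 2 + r3 ^+ 2 - 3%:R * x.
  by rewrite h2 -d1 -d2 -d3; ring.
have {h4}h4 : ec_a4 E = (x - s1 ^+ 2) * (x - r2 ^+ 2) + (x - s1 ^+ 2) * (x - r3 ^+ 2)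
   + (x - r2 ^+ 2) * (x - r3 ^+ 2).
  by rewrite h4 -d1 -d2 -d3; ring.
have {h6}h6 : ec_a6 E = - ((x - s1 ^+ 2) * (x - r2 ^+ 2) * (x - r3 ^+ 2)).
  by rewrite h6 -d1 -d2 -d3; ring.
pose u := x + s1 * r2 + s1 * r3 + r2 * r3.
(* The ordinate is the product of the sums, because [x' - e_i] is the product
   of the two sums that contain [r_i], for the abscissa [x'] of the half. *)
pose v := (s1 + r2) * (s1 + r3) * (r2 + r3).
have hQ : on_curve E (Some (u, v)).
  by apply/eqP; rewrite a1_0 a3_0 h2 h4 h6 /u /v; ring.
exists (exist (on_curve E) (Some (u, v)) hQ); rewrite mulr2n.
apply: val_inj; rewrite /= -[LHS]/(Some (x, y)).
have -> : Some (x, y) = opp_coord E (Some (x, - y)).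
  by rewrite /= a1_0 a3_0; congr (Some (_, _)); ring.
apply/esym/add_collinear => //; exists (s1 + r2 + r3).
exists (v - (s1 + r2 + r3) * u); split; split; rewrite ?(a1_0, a3_0).
- by rewrite h2 /u; ring.
- by rewrite h4 /u /v; ring.
- by rewrite h6 /u /v; ring.
- by ring.
- by ring.
- by rewrite dy /u /v; ring.
Qed.

End TwoDescent.

(** * Square-free integers *)

Section SquarefreeParts.
Local Open Scope nat_scope.

Definition sqfree (d : nat) := forall p, prime p -> ~~ (p ^ 2 %| d).

Lemma sqfree_decomp a : 0 < a ->
  exists d b, [/\ a = d * b ^ 2, sqfree d, 0 < d & 0 < b].
Proof.
elim/ltn_ind: a => a IH a0; have [h|] := pselect (sqfree a).
  by exists a, 1; rewrite exp1n muln1.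
move=> /existsNP[p /not_implyP[pp /negP]]; rewrite negbK => /dvdnP[c ec].
have c0 : 0 < c by move: a0; rewrite ec muln_gt0 => /andP[].
have [|//|d [b [ed hd d0 b0]]] := IH c.
  by rewrite ec -{1}[c]muln1 ltn_pmul2l // -(exp1n 2) ltn_exp2r ?prime_gt1.
exists d, (b * p); split => //; last by rewrite muln_gt0 b0 prime_gt0.
by rewrite ec ed expnMn mulnA.
Qed.

Lemma sqfree_logn d p : 0 < d -> sqfree d -> prime p -> logn p d = (p %| d).
Proof.
move=> d0 hd pp; have [pd|npd] := boolP (p %| d).
  apply/eqP; rewrite eqn_leq -(pfactor_dvdn 1 pp d0) expn1 pd andbT.
  by have := hd p pp; rewrite (pfactor_dvdn 2 pp d0) -ltnNge.
by apply/eqP; rewrite -leqn0 leqNgt -(pfactor_dvdn 1 pp d0) expn1.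
Qed.

Lemma sqfree_dvd d n : sqfree n -> d %| n -> sqfree d.
Proof. by move=> hn dn p /hn; apply: contra => /dvdn_trans; apply. Qed.

(** The exponent of [p] in [d] is one, hence odd, so it
    must be odd in [c] too. *)
Lemma sqfree_dvd_cofactor d b c z p : 0 < d -> 0 < b -> 0 < c ->
  sqfree d -> d * b ^ 2 * c = z ^ 2 -> prime p -> p %| d -> p %| c.
Proof.
move=> d0 b0 c0 hd e pp pd.
have z0 : 0 < z by rewrite -sqrn_gt0 -e !muln_gt0 d0 b0.
move/(congr1 (logn p)): e.
rewrite !lognM ?muln_gt0 ?d0 ?b0 // sqfree_logn // pd => h.
suff : 0 < logn p c by rewrite logn_gt0 mem_primes => /and3P[].
by rewrite lt0n; apply/eqP => h0; move: h; rewrite h0; lia.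
Qed.

Lemma sqfree_unique d d' u v : 0 < d -> 0 < d' -> 0 < u -> 0 < v ->
  sqfree d -> sqfree d' -> d * u ^ 2 = d' * v ^ 2 -> d = d'.
Proof.
move=> d0 d'0 u0 v0 hd hd' e; apply: eqn_from_log => // p.
have [pp|npp] := boolP (prime p); last by rewrite lognE [RHS]lognE (negPf npp).
have := congr1 (logn p) e.
rewrite !lognM ?muln_gt0 ?u0 ?v0 //.
rewrite (sqfree_logn d0 hd pp) (sqfree_logn d'0 hd' pp).
by case: (p %| d); case: (p %| d') => //=; lia.
Qed.

Lemma sqfree_eq_of_mul d d' z : 0 < d -> 0 < d' -> sqfree d -> sqfree d' ->
  d * d' = z ^ 2 -> d = d'.
Proof.
move=> d0 d'0 hd hd' e.
have z0 : 0 < z by rewrite -sqrn_gt0 -e muln_gt0 d0.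
apply: (@sqfree_unique d d' d' z) => //.
by rewrite -e; ring.
Qed.

Lemma sqfree_dvd_sqfree d n : 0 < d -> 0 < n -> sqfree d ->
  (forall p, prime p -> p %| d -> p %| n) -> d %| n.
Proof.
move=> d0 n0 hd h; apply/(dvdn_partP n d0) => p pd.
have /and3P[pp _ _] : [&& prime p, 0 < d & p %| d] by rewrite -mem_primes.
rewrite p_part (sqfree_logn d0 hd pp).
by case: (boolP (p %| d)) => [/(h _ pp)|_]; rewrite ?expn1 ?expn0 ?dvd1n.
Qed.

End SquarefreeParts.

Section DescentArithmetic.
Local Open Scope nat_scope.

(** The two last conditions say that [-1] and [2] are
    quadratic nonresidues.  They hold for every prime congruent to [3] modulo
    [8] by the supplementary laws of quadratic reciprocity; stating them
    directly leaves a finite verification for each given prime. *)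
Definition descent_prime (p : nat) : Prop :=
  [/\ prime p, p %% 8 = 3,
      forall u v, p %| u ^ 2 + v ^ 2 -> p %| u &
      forall u v, u ^ 2 = 2 * v ^ 2 %[mod p] -> p %| u].

Definition descent_number (n : nat) : Prop :=
  [/\ 0 < n, sqfree n & forall p, prime p -> p %| n -> descent_prime p].

Lemma descent_number_dvd d n : descent_number n -> d %| n -> descent_number d.
Proof.
move=> [n0 hn hp] dn; split; first exact: dvdn_gt0 n0 dn.
  exact: sqfree_dvd hn dn.
by move=> p pp pd; apply: hp => //; exact: dvdn_trans dn.
Qed.

Lemma descent_number_mod8 n : descent_number n -> n %% 8 = 1 \/ n %% 8 = 3.
Proof.
elim/ltn_ind: n => n IH hn; have [n0 hs hp] := hn.
have [n1|n1] := leqP n 1; first by left; have -> : n = 1 by lia.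
have pp := pdiv_prime n1; have [m em] := dvdnP (pdiv_dvd n).
have [_ p8 _ _] := hp _ pp (pdiv_dvd n).
have mn : m < n.
  rewrite [ltnRHS]em -{1}[m]muln1 ltn_pmul2l ?prime_gt1 //.
  by move: n0; rewrite em muln_gt0 => /andP[].
have /(IH _ mn) : descent_number m.
  by apply: descent_number_dvd hn _; rewrite [X in _ %| X]em dvdn_mulr.
by rewrite em -modnMm p8 => -[] ->; [right|left].
Qed.

(** The 2-covering of [y^2 = x^3 - n^2 x] that belongs to the
    classes [d1], [d2], [d3], for a point with abscissa [m / D], where
    [B = m - n D]. *)
Record covering (n m D B d1 d2 d3 a b c e : nat) : Prop := Covering {
  cov_D : D = e ^ 2; cov_A : m = d1 * a ^ 2; cov_B : B = d2 * b ^ 2;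
  cov_C : m + n * D = d3 * c ^ 2;
  cov_sf1 : sqfree d1; cov_sf2 : sqfree d2; cov_sf3 : sqfree d3;
  cov_gt0 : [&& 0 < d1, 0 < d2, 0 < d3, 0 < a, 0 < b, 0 < c & 0 < e];
  cov_sq : exists w, d1 * d2 * d3 = w ^ 2 }.

Lemma sq_of_mul_sq k x y : 0 < x -> k * x ^ 2 = y ^ 2 -> exists w, k = w ^ 2.
Proof.
move=> x0 h; have : x ^ 2 %| y ^ 2 by rewrite -h dvdn_mull.
rewrite dvdn_pexp2r // => /dvdnP[w ew]; exists w.
by apply/eqP; rewrite -(eqn_pmul2r (m := x ^ 2)) ?expn_gt0 ?x0 // h ew expnMn.
Qed.

(** The factors [m], [m - n D], [m + n D], [D] of a perfect
    square have pairwise common divisors dividing [2 n], and [D] is prime to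
    the three others; so [D] is a square, and the square-free part of each
    factor divides [2 n]. *)
Lemma covering_exists n m D B z : descent_number n -> coprime m D ->
  0 < D -> 0 < B -> m = B + n * D -> m * B * (m + n * D) * D = z ^ 2 ->
  exists d1 d2 d3 a b c e, [/\ covering n m D B d1 d2 d3 a b c e,
    d1 %| n, d2 %| 2 * n & d3 %| 2 * n].
Proof.
move=> [n0 hn hp] co D0 B0 em ez.
have m0 : 0 < m by rewrite em addn_gt0 B0.
have C0 : 0 < m + n * D by rewrite addn_gt0 m0.
have [d0 [e [eD s0 d00 e0]]] := sqfree_decomp D0.
have [d1 [a [ea s1 d10 a0]]] := sqfree_decomp m0.
have [d2 [b [eb s2 d20 b0]]] := sqfree_decomp B0.
have [d3 [c [ec s3 d30 c0]]] := sqfree_decomp C0.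
have coD p : prime p -> p %| D -> p %| m -> False.
  move=> pp pD pm; have : p %| gcdn m D by rewrite dvdn_gcd pm.
  by rewrite (eqP co) dvdn1 => /eqP p1; rewrite p1 in pp.
have ed0 : d0 = 1.
  apply/eqP; rewrite eqn_leq d00 andbT leqNgt; apply/negP => h.
  have pp := pdiv_prime h; set p := pdiv d0 in pp.
  have pd : p %| d0 := pdiv_dvd d0.
  have pD : p %| D by rewrite eD dvdn_mulr.
  have := @sqfree_dvd_cofactor d0 e (m * B * (m + n * D)) z p.
  rewrite -eD !muln_gt0 m0 B0 C0 => /(_ d00 e0 isT s0); rewrite mulnC.
  move=> /(_ ez pp pd); rewrite !Euclid_dvdM // => /orP[/orP[]|].
  - exact: coD.
  - by move=> h'; apply: (coD p) => //; rewrite em dvdn_add // dvdn_mull.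
  - by rewrite dvdn_addl ?dvdn_mull //; exact: coD.
have eD' : D = e ^ 2 by rewrite eD ed0 mul1n.
exists d1, d2, d3, a, b, c, e; split.
- split=> //; first by apply/and5P; split=> //; apply/and3P.
  apply: (@sq_of_mul_sq _ (a * b * c * e) z).
    by rewrite !muln_gt0 a0 b0 c0.
  transitivity ((d1 * a ^ 2) * (d2 * b ^ 2) * (d3 * c ^ 2) * e ^ 2).
    by ring.
  by rewrite -ea -eb -ec -eD'.
- apply: sqfree_dvd_sqfree => // p pp pd.
  have := @sqfree_dvd_cofactor d1 a (B * (m + n * D) * D) z p.
  rewrite -ea !muln_gt0 D0 B0 C0 !mulnA => /(_ d10 a0 isT s1 ez pp pd).
  have pm : p %| m by rewrite ea dvdn_mulr.
  have nD : p %| n * D -> p %| n.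
    by rewrite Euclid_dvdM // => /orP[//|/coD]; case.
  rewrite !Euclid_dvdM // => /orP[/orP[]|].
  - by move=> pB; apply: nD; rewrite -(dvdn_addr _ pB) -em.
  - by rewrite dvdn_addr.
  - by move=> /coD; case.
- apply: sqfree_dvd_sqfree => //; first by rewrite muln_gt0.
  move=> p pp pd.
  have := @sqfree_dvd_cofactor d2 b (m * (m + n * D) * D) z p.
  rewrite -eb !muln_gt0 D0 m0 C0 => /(_ d20 b0 isT s2) h.
  have {h} : p %| m * (m + n * D) * D by apply: h => //; rewrite -ez; ring.
  have pB : p %| B by rewrite eb dvdn_mulr.
  have mnD : (p %| m) = (p %| n * D) by rewrite em dvdn_addr.
  have key : p %| 2 * (n * D) -> p %| 2 * n.
    rewrite mulnA Euclid_dvdM // => /orP[//|pD].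
    by case: (coD p) => //; rewrite mnD dvdn_mull.
  rewrite !Euclid_dvdM // => /orP[/orP[]|].
  - by rewrite mnD => h; rewrite -Euclid_dvdM //; apply: key; rewrite dvdn_mull.
  - rewrite {1}em -addnA dvdn_addr // addnn -mul2n.
    by rewrite -Euclid_dvdM //; exact: key.
  - by move=> pD; case: (coD p) => //; rewrite mnD dvdn_mull.
- apply: sqfree_dvd_sqfree => //; first by rewrite muln_gt0.
  move=> p pp pd.
  have := @sqfree_dvd_cofactor d3 c (m * B * D) z p.
  rewrite -ec !muln_gt0 D0 m0 B0 => /(_ d30 c0 isT s3) h.
  have {h} : p %| m * B * D by apply: h => //; rewrite -ez; ring.
  have pC : p %| m + n * D by rewrite ec dvdn_mulr.
  have key : p %| n * D -> p %| n.
    rewrite Euclid_dvdM // => /orP[//|pD].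
    by case: (coD p) => //; rewrite -(dvdn_addl _ (dvdn_mull n pD)).
  rewrite !Euclid_dvdM // => /orP[/orP[]|].
  - by move=> pm; rewrite -Euclid_dvdM // dvdn_mull // key // -(dvdn_addr _ pm).
  - move=> pB; move: pC; rewrite {1}em -addnA dvdn_addr // addnn -mul2n.
    rewrite mulnA Euclid_dvdM // => /orP[|pD]; first by rewrite Euclid_dvdM.
    by case: (coD p) => //; rewrite em dvdn_add // dvdn_mull.
  - move=> pD; case: (coD p) => //.
    by rewrite -(dvdn_addl _ (dvdn_mull n pD)).
Qed.

End DescentArithmetic.

Section DescentArithmetic2.
Local Open Scope nat_scope.

Lemma sqr_mod8 x : x ^ 2 %% 8 \in [:: 0; 1; 4].
Proof.
rewrite -modnXm; have : x %% 8 < 8 by rewrite ltn_mod.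
by case: (x %% 8) => [|[|[|[|[|[|[|[|]]]]]]]].
Qed.

Lemma odd_sqr_mod8 x : odd x = (x ^ 2 %% 8 == 1).
Proof.
rewrite -modnXm -[in LHS](odd_mod x (d := 8)) //.
have : x %% 8 < 8 by rewrite ltn_mod.
by case: (x %% 8) => [|[|[|[|[|[|[|[|]]]]]]]].
Qed.

(** Here [a], [b], [c], [e] stand for the residues of squares
    modulo [8]. *)
Lemma mod8_check : all (fun n => all (fun d1 => all (fun d2 => all (fun d3 =>
  all (fun a => all (fun b => all (fun c => all (fun e =>
    [==> (d1 * a) %% 8 == (d2 * b + n * e) %% 8,
         (d3 * c) %% 8 == (d1 * a + n * e) %% 8,
         (a == 1) || (e == 1) => (d1 == d2) && (d1 == d3)])
  [:: 0; 1; 4]) [:: 0; 1; 4]) [:: 0; 1; 4]) [:: 0; 1; 4])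
  [:: 1; 3]) [:: 1; 3]) [:: 1; 3]) [:: 1; 3].
Proof. by vm_compute. Qed.

Lemma sqfree_odd_cofactor d k w : 0 < d -> 0 < k -> sqfree d ->
  d * k = w ^ 2 -> odd k -> odd d.
Proof.
move=> d0 k0 hd e ok; apply/negPn/negP; rewrite -dvdn2 => d2.
have : 2 %| k.
  by apply: (@sqfree_dvd_cofactor d 1 k w) => //; rewrite exp1n muln1.
by rewrite dvdn2 ok.
Qed.

Section Covering.
Context (n m D B d1 d2 d3 a b c e : nat).
Hypotheses (hn : descent_number n) (co : coprime m D) (em : m = B + n * D).
Hypothesis cov : covering n m D B d1 d2 d3 a b c e.
Hypotheses (dv1 : d1 %| n) (dv2 : d2 %| 2 * n) (dv3 : d3 %| 2 * n).
Hypothesis odd_d2 : odd d2.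

Let pos : [/\ 0 < d1, 0 < d2 & 0 < d3].
Proof. by case/and5P: (cov_gt0 cov). Qed.

Let odd_dvd d : descent_number d -> odd d.
Proof.
move=> /descent_number_mod8; rewrite -[odd d](odd_mod d (d := 8)) //.
by case=> ->.
Qed.

Let odd_d1 : odd d1.
Proof. by apply: odd_dvd; exact: descent_number_dvd hn dv1. Qed.

Let odd_d3 : odd d3.
Proof.
have [d10 d20 d30] := pos; have [w ew] := cov_sq cov.
apply: (@sqfree_odd_cofactor d3 (d1 * d2) w) => //.
- by rewrite muln_gt0 d10.
- exact: cov_sf3 cov.
- by rewrite mulnC.
- by rewrite oddM odd_d1.
Qed.

Lemma covering_dvd : [/\ d1 %| n, d2 %| n & d3 %| n].
Proof.
split=> //.
  by rewrite -(Gauss_dvdr _ (_ : coprime d2 2)) // coprimen2.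
by rewrite -(Gauss_dvdr _ (_ : coprime d3 2)) // coprimen2.
Qed.

Lemma covering_eqs :
  d1 * a ^ 2 = d2 * b ^ 2 + n * e ^ 2 /\ d3 * c ^ 2 = d1 * a ^ 2 + n * e ^ 2.
Proof.
case: cov => eD eA eB eC _ _ _ _ _; split.
  by rewrite -eA em eB eD.
by rewrite -eC eA eD.
Qed.

(** Not both [a] and [e] are even.  Inspecting residues modulo
    [8] shows that [d1], [d2], [d3] are congruent; as their product is a
    square, the common residue is [1]. *)
Lemma covering_mod8 : [/\ d1 %% 8 = 1, d2 %% 8 = 1 & d3 %% 8 = 1].
Proof.
have [v1 v2 v3] := covering_dvd; have [q1 q2] := covering_eqs.
have res d : d %| n -> d %% 8 \in [:: 1; 3].
  by move=> /(descent_number_dvd hn)/descent_number_mod8[] ->.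
have := mod8_check.
move=> /allP/(_ _ (res n (dvdnn n)))/allP/(_ _ (res _ v1)).
move=> /allP/(_ _ (res _ v2))/allP/(_ _ (res _ v3)).
move=> /allP/(_ _ (sqr_mod8 a))/allP/(_ _ (sqr_mod8 b)).
move=> /allP/(_ _ (sqr_mod8 c))/allP/(_ _ (sqr_mod8 e)).
have -> : (d1 %% 8 * (a ^ 2 %% 8)) %% 8 ==
    (d2 %% 8 * (b ^ 2 %% 8) + n %% 8 * (e ^ 2 %% 8)) %% 8.
  by rewrite -modnDm !modnMm modnDm q1.
have -> : (d3 %% 8 * (c ^ 2 %% 8)) %% 8 ==
    (d1 %% 8 * (a ^ 2 %% 8) + n %% 8 * (e ^ 2 %% 8)) %% 8.
  by rewrite -modnDm !modnMm modnDm q2.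
rewrite -!odd_sqr_mod8 /=.
have -> : odd a || odd e.
  apply: contraTT (co); rewrite negb_or => /andP[na ne].
  have ha : 2 %| m by rewrite (cov_A cov) dvdn_mull // dvdn2 oddX (negPf na).
  have he : 2 %| D by rewrite (cov_D cov) dvdn2 oddX (negPf ne).
  apply/negP => /eqP g; have : 2 %| gcdn m D by rewrite dvdn_gcd ha.
  by rewrite g.
move=> /andP[/eqP e12 /eqP e13].
have [w ew] := cov_sq cov.
have : (d1 %% 8) ^ 3 %% 8 \in [:: 0; 1; 4].
  have -> : (d1 %% 8) ^ 3 %% 8 = (d1 * d2 * d3) %% 8.
    rewrite -(modnMm (d1 * d2)) -(modnMm d1) -e12 -e13 modnMml.
    by congr (_ %% _); rewrite !expnS expn0 muln1 mulnA.
  by rewrite ew; exact: sqr_mod8.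
have := res _ v1; rewrite -e12 -e13 !inE => /orP[/eqP ->|/eqP ->] //.
Qed.

Let not_both p : prime p -> p %| m -> p %| e -> False.
Proof.
move=> pp pm pe; have : p %| gcdn m D.
  by rewrite dvdn_gcd pm (cov_D cov) Euclid_dvdX // pe.
by rewrite (eqP co) dvdn1 => /eqP p1; rewrite p1 in pp.
Qed.

Let split_prime p d : prime p -> d %| n -> p %| d ->
  exists d' n', [/\ d = p * d', n = p * n', ~~ (p %| d') & ~~ (p %| n')].
Proof.
move=> pp dn pd; have [n0 hs _] := hn.
have [n' en] := dvdnP (dvdn_trans pd dn); have [d' ed] := dvdnP pd.
exists d', n'; split; rewrite 1?mulnC //.
  apply: contra (sqfree_dvd hs dn pp) => h.
  by rewrite ed expnS expn1 dvdn_mul.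
by apply: contra (hs p pp) => h; rewrite en expnS expn1 dvdn_mul.
Qed.

Let one_of_dvd d : 0 < d -> (forall p, prime p -> p %| d -> False) -> d = 1.
Proof.
move=> d0 h; apply/eqP; rewrite eqn_leq d0 andbT leqNgt; apply/negP => h1.
exact: h (pdiv_prime h1) (pdiv_dvd d).
Qed.

Let Euclid_sq p x y : prime p -> ~~ (p %| x) -> p %| x * y ^ 2 -> p %| y.
Proof.
by move=> pp px; rewrite Euclid_dvdM // (negPf px) Euclid_dvdX //= andbT.
Qed.

Let not_dvd2 p : descent_prime p -> ~~ (p %| 2).
Proof.
move=> [pp p8 _ _]; apply/negP; rewrite dvdn_prime2 // => /eqP ep.
by rewrite ep in p8.
Qed.

Let nonres2 p x y : descent_prime p -> ~~ (p %| x) ->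
  (exists k, x * y.1 ^ 2 + p * k = 2 * (x * y.2 ^ 2)) -> p %| y.1 /\ p %| y.2.
Proof.
move=> hp px [k ek]; have [pp p8 _ h2] := hp; have np2 := not_dvd2 hp.
have py1 : p %| y.1.
  apply: (h2 _ y.2); apply/eqP.
  have exy : x * (2 * y.2 ^ 2) = x * y.1 ^ 2 + p * k by rewrite ek mulnCA.
  have x0 : 0 < x by rewrite lt0n; apply: contraNneq px => ->.
  have le : y.1 ^ 2 <= 2 * y.2 ^ 2 by rewrite -(leq_pmul2l x0) exy leq_addr.
  rewrite eq_sym eqn_mod_dvd // -(@Gauss_dvdr p x) ?prime_coprime //.
  by rewrite mulnBr exy addKn dvdn_mulr.
split=> //; apply: (@Euclid_sq p (2 * x)) => //.
  by rewrite Euclid_dvdM // negb_or np2.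
rewrite -mulnA -ek dvdn_addl; last exact: dvdn_mulr.
rewrite dvdn_mull //.
by rewrite Euclid_dvdX // py1.
Qed.

(** If [d1 = 1], then [d2 = d3].  A common prime factor [p]
    divides [a], and the equations reduce modulo [p] to [b^2 + c^2 = 0]; since
    [-1] is a nonresidue, [p] divides [b], [c] and then [e], although [m] and
    [D] are coprime.  In the two other cases the reduction is [c^2 = 2 a^2] or
    [b^2 = 2 a^2], and [2] is a nonresidue. *)
Lemma covering_trivial : d1 = 1 \/ d2 = 1 \/ d3 = 1 ->
  [/\ d1 = 1, d2 = 1 & d3 = 1].
Proof.
have [v1 v2 v3] := covering_dvd; have [q1 q2] := covering_eqs.
have [d10 d20 d30] := pos; have [w ew] := cov_sq cov.
have [_ _ hp] := hn; have eA := cov_A cov.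
case: cov => _ _ _ _ s1 s2 s3 _ _.
case=> [e1|[e2|e3]].
- have e23 : d2 = d3 by apply: (@sqfree_eq_of_mul _ _ w) => //; rewrite -ew e1 mul1n.
  suff e2 : d2 = 1 by split=> //; rewrite -e23.
  apply: one_of_dvd => // p pp pd; have pn := dvdn_trans pd v2.
  have [d [n' [ed en npd npn]]] := split_prime pp v2 pd.
  have [_ _ hq _] := hp p pp pn.
  rewrite -e23 e1 ed en in q1 q2; rewrite e1 mul1n in eA.
  have pa : p %| a.
    have : p %| a ^ 2 by rewrite -[a ^ 2]mul1n q1 -!mulnA dvdn_add ?dvdn_mulr.
    by rewrite Euclid_dvdX // andbT.
  have [a' ea] := dvdnP pa.
  have p0 := prime_gt0 pp.
  have r1 : p * a' ^ 2 = d * b ^ 2 + n' * e ^ 2.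
    apply/eqP; rewrite -(eqn_pmul2l p0); apply/eqP.
    by transitivity (1 * a ^ 2); [rewrite ea|rewrite q1]; ring.
  have r2 : d * c ^ 2 = p * a' ^ 2 + n' * e ^ 2.
    apply/eqP; rewrite -(eqn_pmul2l p0); apply/eqP.
    by transitivity (p * d * c ^ 2); [|rewrite q2 ea]; ring.
  have pbc : p %| b ^ 2 + c ^ 2.
    have : p %| d * (b ^ 2 + c ^ 2).
      have -> : d * (b ^ 2 + c ^ 2) = 2 * p * a' ^ 2.
        by rewrite mulnDr r2 addnCA -r1; ring.
      by rewrite mulnAC dvdn_mull.
    by rewrite Euclid_dvdM // (negPf npd).
  have pb := hq _ _ pbc.
  apply: (not_both pp); first by rewrite eA Euclid_dvdX // pa.
  apply: (Euclid_sq pp npn).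
  have : p %| d * b ^ 2 + n' * e ^ 2 by rewrite -r1 dvdn_mulr.
  by rewrite dvdn_addr // dvdn_mull // Euclid_dvdX // pb.
- have e13 : d1 = d3 by apply: (@sqfree_eq_of_mul _ _ w) => //; rewrite -ew e2 muln1.
  suff e1 : d1 = 1 by split=> //; rewrite -e13.
  apply: one_of_dvd => // p pp pd; have pn := dvdn_trans pd v1.
  have [d [n' [ed en npd npn]]] := split_prime pp v1 pd.
  have hq := hp p pp pn.
  rewrite -e13 e2 mul1n ed en in q1 q2.
  have p0 := prime_gt0 pp.
  have pb : p %| b.
    have : p %| b ^ 2 + p * n' * e ^ 2 by rewrite -q1 -mulnA dvdn_mulr.
    by rewrite dvdn_addl ?Euclid_dvdX ?andbT // -mulnA dvdn_mulr.
  have [b' eb] := dvdnP pb.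
  have r1 : d * a ^ 2 = p * b' ^ 2 + n' * e ^ 2.
    apply/eqP; rewrite -(eqn_pmul2l p0); apply/eqP.
    by transitivity (p * d * a ^ 2); [|rewrite q1 eb]; ring.
  have r2 : d * c ^ 2 = d * a ^ 2 + n' * e ^ 2.
    apply/eqP; rewrite -(eqn_pmul2l p0); apply/eqP.
    by transitivity (p * d * c ^ 2); [|rewrite q2]; ring.
  have [pc pa] : p %| c /\ p %| a.
    apply: (@nonres2 p d (c, a)) => //=; exists (b' ^ 2).
    by rewrite r2 r1; ring.
  apply: (not_both pp); first by rewrite eA ed -mulnA dvdn_mulr.
  apply: (Euclid_sq pp npn).
  have : p %| d * c ^ 2 by rewrite dvdn_mull // Euclid_dvdX // pc.
  by rewrite r2 dvdn_addr // dvdn_mull // Euclid_dvdX // pa.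
- have e12 : d1 = d2 by apply: (@sqfree_eq_of_mul _ _ w) => //; rewrite -ew e3 muln1.
  suff e1 : d1 = 1 by split=> //; rewrite -e12.
  apply: one_of_dvd => // p pp pd; have pn := dvdn_trans pd v1.
  have [d [n' [ed en npd npn]]] := split_prime pp v1 pd.
  have hq := hp p pp pn.
  rewrite -e12 ed en in q1; rewrite e3 mul1n ed en in q2.
  have p0 := prime_gt0 pp.
  have pc : p %| c.
    have : p %| c ^ 2 by rewrite q2 -!mulnA dvdn_add ?dvdn_mulr.
    by rewrite Euclid_dvdX // andbT.
  have [c' ec] := dvdnP pc.
  have r1 : d * a ^ 2 = d * b ^ 2 + n' * e ^ 2.
    apply/eqP; rewrite -(eqn_pmul2l p0); apply/eqP.
    by transitivity (p * d * a ^ 2); [|rewrite q1]; ring.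
  have r2 : p * c' ^ 2 = d * a ^ 2 + n' * e ^ 2.
    apply/eqP; rewrite -(eqn_pmul2l p0); apply/eqP.
    by transitivity (c ^ 2); [rewrite ec|rewrite q2]; ring.
  have [pb pa] : p %| b /\ p %| a.
    apply: (@nonres2 p d (b, a)) => //=; exists (c' ^ 2).
    by rewrite r2 r1; ring.
  apply: (not_both pp); first by rewrite eA ed -mulnA dvdn_mulr.
  apply: (Euclid_sq pp npn).
  have : p %| d * a ^ 2 by rewrite dvdn_mull // Euclid_dvdX // pa.
  by rewrite r1 dvdn_addr // dvdn_mull // Euclid_dvdX // pb.
Qed.

End Covering.
End DescentArithmetic2.

(** * Classes of rational points on congruent number curves *)

Section Twists.
Context (F : fieldType).

Lemma twist_disc (w : F) : 2%:R * w != 0 ->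
  weierstrass_disc 0 0 0 (- w ^+ 2) 0 != 0.
Proof.
move=> h; have -> : weierstrass_disc 0 0 0 (- w ^+ 2) 0 = (2%:R * w) ^+ 6.
  by rewrite /weierstrass_disc; ring.
by rewrite expf_neq0.
Qed.

Definition twist (w : F) (w0 : 2%:R * w != 0) : ellCurve F :=
  EllCurve (twist_disc w0).

End Twists.

Lemma natr_twist (n : nat) : (0 < n)%N -> 2%:R * (n%:R : rat) != 0.
Proof. by move=> n0; rewrite mulf_neq0 // pnatr_eq0 -lt0n. Qed.

Section RationalSquares.

Lemma rat_natE (x : rat) : 0 < x ->
  exists m D : nat, [/\ (0 < m)%N, (0 < D)%N, coprime m D & x = m%:R / D%:R].
Proof.
move=> x0; exists `|numq x|%N, `|denq x|%N.
rewrite !absz_gt0 numq_eq0 denq_neq0 gt_eqF //.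
split=> //; first exact: coprime_num_den.
rewrite -[LHS]divq_num_den; congr (_ / _).
  by rewrite -[RHS]/((`|numq x|%N%:Z)%:~R) gez0_abs // numq_ge0 ltW.
by rewrite -[RHS]/((`|denq x|%N%:Z)%:~R) absz_denq.
Qed.

Lemma rat_sq_int (q : rat) (k : int) : q ^+ 2 = k%:~R -> exists z : int, q = z%:~R.
Proof.
move=> h; exists (numq q); rewrite -[LHS]divq_num_den.
suff -> : denq q = 1 by rewrite divr1.
have e : (numq q) ^+ 2 = k * (denq q) ^+ 2.
  apply: (@intr_inj rat); rewrite !(rmorphM, rmorphXn) /= -h.
  by rewrite -[X in X ^+ 2 * _]divq_num_den expr_div_n divfK // expf_neq0 // intr_eq0 denq_neq0.
have : (`|denq q| ^ 2 %| `|numq q| ^ 2)%N.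
  by rewrite -!abszX e abszM dvdn_mull.
rewrite dvdn_pexp2r // => dv.
have := coprime_num_den q; rewrite /coprime (gcdn_idPr dv) => /eqP d1.
by rewrite -[LHS]absz_denq d1.
Qed.

Lemma nat_of_rat_sq (k : nat) (q : rat) : q ^+ 2 = k%:R ->
  exists z : nat, (k = z ^ 2)%N.
Proof.
move=> h; have [z ez] := @rat_sq_int q k%:Z h; exists `|z|%N.
apply/eqP; rewrite -abszX -eqz_nat; apply/eqP.
rewrite gez0_abs ?sqr_ge0 //; apply: (@intr_inj rat).
by rewrite rmorphXn /= -ez h.
Qed.

Lemma sqfree_unique_rat (d d' : nat) (r : rat) : (0 < d)%N -> (0 < d')%N ->
  sqfree d -> sqfree d' -> d%:R = d'%:R * r ^+ 2 -> d = d'.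
Proof.
move=> d0 d'0 s s' h; have : (r * d'%:R) ^+ 2 = (d * d')%N%:R.
  by rewrite natrM h; ring.
move=> /nat_of_rat_sq[z ez]; exact: sqfree_eq_of_mul ez.
Qed.

Lemma sqfree_odd_rat (d k : nat) (r : rat) : (0 < d)%N -> odd k ->
  sqfree d -> d%:R = k%:R * r ^+ 2 -> odd d.
Proof.
move=> d0 ok s h; have k0 : (0 < k)%N by case: (k) ok.
have : (r * k%:R) ^+ 2 = (d * k)%N%:R by rewrite natrM h; ring.
move=> /nat_of_rat_sq[z ez]; exact: sqfree_odd_cofactor ez ok.
Qed.

End RationalSquares.

Section CongruentCurve.
Context (n : nat) (n_gt0 : (0 < n)%N).

Local Notation N := (n%:R : rat).
Local Notation E := (twist (natr_twist n_gt0)).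
Implicit Types P Q : ec_point E.

Let a1_0 : ec_a1 E = 0. Proof. by []. Qed.
Let a3_0 : ec_a3 E = 0. Proof. by []. Qed.
Let N_gt0 : 0 < N. Proof. by rewrite ltr0n. Qed.

Lemma on_twist x y : on_curve E (Some (x, y)) = (y ^+ 2 == x * (x - N) * (x + N)).
Proof. by rewrite /=; congr (_ == _); ring. Qed.

Lemma twist_roots :
  [/\ cubic_root E 0, cubic_root E N & cubic_root E (- N)].
Proof. by split; rewrite /cubic_root on_twist; apply/eqP; ring. Qed.

Definition torsion_point (e : rat) (he : cubic_root E e) : ec_point E :=
  exist (on_curve E) (Some (e, 0)) he.

Definition T0 := let: And3 h _ _ := twist_roots in torsion_point h.
Definition TN := let: And3 _ h _ := twist_roots in torsion_point h.
Definition TM := let: And3 _ _ h := twist_roots in torsion_point h.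

Lemma torsion_double e (he : cubic_root E e) : torsion_point he *+ 2 = 0.
Proof.
rewrite mulr2n -[X in X + _]opprK; apply/eqP; rewrite addr_eq0 opprK; apply/eqP.
by apply: val_inj => /=; congr (Some (_, _)); ring.
Qed.

Lemma two_torsion P : P *+ 2 = 0 -> P \in [:: 0; T0; TN; TM].
Proof.
move/eqP; rewrite mulr2n addr_eq0 => /eqP.
case: P => -[[x y]|] hP; last first.
  by move=> _; rewrite inE; apply/orP; left; apply/eqP; exact: val_inj.
move=> /(congr1 val) /= -[] ey.
have y0 : y = 0 by lra.
have : x * (x - N) * (x + N) == 0 by rewrite -(eqP (etrans (esym (on_twist _ _)) hP)) y0.
rewrite !mulf_eq0 subr_eq0 addr_eq0 !inE => /orP[/orP[]|] /eqP ex; apply/orP; right.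
- apply/orP; left; apply/eqP; apply: val_inj; rewrite /T0.
  by case: twist_roots => h1 h2 h3 /=; rewrite ex y0.
- apply/orP; right; apply/orP; left; apply/eqP; apply: val_inj; rewrite /TN.
  by case: twist_roots => h1 h2 h3 /=; rewrite ex y0.
- apply/orP; right; apply/orP; right; apply/eqP; apply: val_inj; rewrite /TM.
  by case: twist_roots => h1 h2 h3 /=; rewrite ex y0.
Qed.

Local Notation d0 := (delta (E := E) 0).
Local Notation dN := (delta (E := E) N).
Local Notation dM := (delta (E := E) (- N)).

Lemma delta_addE e P Q : cubic_root E e ->
  exists2 r, r != 0 & delta e (P + Q) = delta e P * delta e Q * r ^+ 2.
Proof.
move=> he; have [s hs] := delta_add a1_0 a3_0 he P Q.
have nz X := delta_neq0 a1_0 a3_0 he X.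
have s0 : s != 0.
  have : s ^+ 2 != 0 by rewrite -hs !mulf_neq0.
  by rewrite expf_eq0.
exists (s / (delta e P * delta e Q)).
  by rewrite mulf_neq0 // invr_eq0 mulf_neq0.
rewrite exprMn -hs; field.
by rewrite !nz.
Qed.

Lemma delta_torsion e e' (he : cubic_root E e) :
  delta e' (torsion_point he) = if e == e' then 3%:R * e' ^+ 2 - N ^+ 2 else e - e'.
Proof.
rewrite -[LHS]/(if e == e' then deriv_cubic E e' else e - e').
by case: ifP => // _; rewrite -[LHS]/(3%:R * e' ^+ 2 + 2%:R * 0 * e' - N ^+ 2); ring.
Qed.

Lemma delta_T0 : d0 T0 = - N ^+ 2 /\ dN T0 = - N.
Proof.
rewrite /T0; case: twist_roots => h1 h2 h3; rewrite !delta_torsion.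
by rewrite eqxx eq_sym gt_eqF //; split; ring.
Qed.

Lemma delta_TN : d0 TN = N /\ dN TN = 2%:R * N ^+ 2.
Proof.
rewrite /TN; case: twist_roots => h1 h2 h3; rewrite !delta_torsion.
by rewrite eqxx gt_eqF //; split; ring.
Qed.

Lemma T0_double : T0 *+ 2 = 0.
Proof. by rewrite /T0; case: twist_roots => h1 h2 h3; exact: torsion_double. Qed.

Lemma TN_double : TN *+ 2 = 0.
Proof. by rewrite /TN; case: twist_roots => h1 h2 h3; exact: torsion_double. Qed.

Definition has_class P (d1 d2 d3 : nat) : Prop :=
  [/\ exists2 r, r != 0 & d0 P = d1%:R * r ^+ 2,
      exists2 r, r != 0 & dN P = d2%:R * r ^+ 2 &
      exists2 r, r != 0 & dM P = d3%:R * r ^+ 2].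

(** The local conditions satisfied by the class of a point
    after translation by a suitable point of order two. *)
Definition normal_triple (d1 d2 d3 : nat) : Prop :=
  [/\ [/\ d1 %| n, d2 %| n & d3 %| n]%N,
      [/\ d1 %% 8 = 1, d2 %% 8 = 1 & d3 %% 8 = 1]%N,
      exists w, (d1 * d2 * d3 = w ^ 2)%N &
      (d1 = 1 \/ d2 = 1 \/ d3 = 1 -> [/\ d1 = 1, d2 = 1 & d3 = 1])%N].

Hypothesis hn : descent_number n.

Lemma not_two_torsion P : P *+ 2 != 0 ->
  exists x y, [/\ on_curve E (Some (x, y)), d0 P = x, dN P = x - N &
    dM P = x + N].
Proof.
case: P => -[[x y]|] hP; last first.
  by move=> /eqP[]; apply: etrans (mul0rn _ 2); congr (_ *+ 2); exact: val_inj.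
move=> h2; exists x, y.
have y0 : y != 0.
  apply: contraNneq h2 => y0; rewrite mulr2n addr_eq0; apply/eqP/val_inj.
  by rewrite /= y0; congr (Some (_, _)); ring.
have : x * (x - N) * (x + N) != 0.
  by rewrite -(eqP (etrans (esym (on_twist _ _)) hP)) expf_neq0.
rewrite !mulf_eq0 !negb_or => /andP[/andP[x0 xN] xM].
split=> //.
- by rewrite -[LHS]/(if x == 0 then _ else x - 0) (negPf x0) subr0.
- by rewrite -[LHS]/(if x == N then _ else x - N) -subr_eq0 (negPf xN).
- rewrite -[LHS]/(if x == - N then _ else x - - N).
  by rewrite -subr_eq0 opprK (negPf xM).
Qed.

(** Two positive values of the descent map mean that
    [x > n]. *)
Lemma positive_class P : P *+ 2 != 0 -> 0 < d0 P -> 0 < dN P ->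
  exists d1 d2 d3, [/\ has_class P d1 d2 d3, sqfree d1, sqfree d2,
    [&& 0 < d1, 0 < d2 & 0 < d3]%N & (odd d2 -> normal_triple d1 d2 d3)].
Proof.
move=> /not_two_torsion[x [y [hP ex0 exN exM]]].
rewrite /has_class ex0 exN exM => x0 xN.
have [m [D [m0 D0 co ex]]] := rat_natE x0.
have DR : D%:R != 0 :> rat by rewrite pnatr_eq0 -lt0n.
have ltB : (n * D < m)%N.
  by rewrite -(ltr_nat rat) natrM -ltr_pdivlMr ?ltr0n // -ex -subr_gt0.
have em : (m = (m - n * D) + n * D)%N by rewrite subnK // ltnW.
have [z ez] : exists z, (m * (m - n * D) * (m + n * D) * D = z ^ 2)%N.
  apply: (@nat_of_rat_sq _ (y * D%:R ^+ 2)).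
  rewrite exprMn (eqP (etrans (esym (on_twist _ _)) hP)) !natrM natrB ?(ltnW ltB) //.
  by rewrite natrD natrM ex; field.
have B0 : (0 < m - n * D)%N by rewrite subn_gt0.
have [d1 [d2 [d3 [a [b [c [e [cov v1 v2 v3]]]]]]]] :=
  covering_exists hn co D0 B0 em ez.
have /and5P[d10 d20 d30 a0 /and3P[b0 c0 e0]] := cov_gt0 cov.
have eR : e%:R != 0 :> rat by rewrite pnatr_eq0 -lt0n.
have eD : D%:R = e%:R ^+ 2 :> rat by rewrite (cov_D cov) natrX.
exists d1, d2, d3; split.
- split.
  + exists (a%:R / e%:R); first by rewrite mulf_neq0 ?invr_eq0 // pnatr_eq0 -lt0n.
    by rewrite ex eD (cov_A cov) natrM natrX; field.
  + exists (b%:R / e%:R); first by rewrite mulf_neq0 ?invr_eq0 // pnatr_eq0 -lt0n.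
    have : (m - n * D)%N%:R = d2%:R * b%:R ^+ 2 :> rat.
      by rewrite (cov_B cov) natrM natrX.
    rewrite natrB ?(ltnW ltB) // natrM ex eD => h.
    rewrite expr_div_n mulrA -h; field.
    exact: eR.
  + exists (c%:R / e%:R); first by rewrite mulf_neq0 ?invr_eq0 // pnatr_eq0 -lt0n.
    have : (m + n * D)%N%:R = d3%:R * c%:R ^+ 2 :> rat.
      by rewrite (cov_C cov) natrM natrX.
    rewrite natrD natrM ex eD => h.
    rewrite expr_div_n mulrA -h; field.
    exact: eR.
- exact: cov_sf1 cov.
- exact: cov_sf2 cov.
- by rewrite d10 d20.
- move=> o2; split.
  + exact: covering_dvd cov v1 v2 v3 o2.
  + exact: covering_mod8 cov v1 v2 v3 o2.
  + exact: cov_sq cov.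
  + exact: covering_trivial cov v1 v2 v3 o2.
Qed.

End CongruentCurve.

Section DescentClasses.
Context (n : nat) (n_gt0 : (0 < n)%N) (hn : descent_number n).

Local Notation N := (n%:R : rat).
Local Notation E := (twist (natr_twist n_gt0)).
Local Notation d0 := (delta (E := E) 0).
Local Notation dN := (delta (E := E) N).
Local Notation dM := (delta (E := E) (- N)).
Implicit Types P Q : ec_point E.

Let a1_0 : ec_a1 E = 0. Proof. by []. Qed.
Let a3_0 : ec_a3 E = 0. Proof. by []. Qed.
Let N_gt0 : 0 < N. Proof. by rewrite ltr0n. Qed.

Definition normal P d1 d2 d3 := has_class P d1 d2 d3 /\ normal_triple n d1 d2 d3.

Lemma pmulr_sq_gt0 (x r : rat) : r != 0 -> (0 < x * r ^+ 2) = (0 < x).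
Proof. by move=> r0; rewrite pmulr_lgt0 // exprn_even_gt0. Qed.

Lemma normal_of_odd P d2 d1 d3 : has_class P d1 d2 d3 ->
  (odd d2 -> normal_triple n d1 d2 d3) -> odd d2 -> normal P d1 d2 d3.
Proof. by move=> hc h /h. Qed.

Lemma normal0 : normal 0 1 1 1.
Proof.
split; first by split; exists 1; rewrite ?oner_eq0 // expr1n mulr1.
by split; [rewrite !dvd1n | | exists 1%N | ].
Qed.

(** Translation by [(0, 0)] changes the sign of [x], and translation
    by [(n, 0)] the parity of the second class [d2]. *)
Lemma normalize P : exists t, t *+ 2 = 0 /\
  exists d1 d2 d3, normal (P + t) d1 d2 d3.
Proof.
have [r0 rN _] := twist_roots n_gt0.
have [P2|P2] := eqVneq (P *+ 2) 0.
  exists (- P); split; first by rewrite mulNrn P2 oppr0.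
  by exists 1%N, 1%N, 1%N; rewrite subrr; exact: normal0.
have [t [t2 pos0 posN]] : exists t, [/\ t *+ 2 = 0, 0 < d0 (P + t) & 0 < dN (P + t)].
  have [x [y [hP e0 eN eM]]] := not_two_torsion P2.
  have := delta_neq0 a1_0 a3_0 r0 P.
  have := delta_neq0 a1_0 a3_0 rN P.
  rewrite e0 eN; have := sqr_ge0 y.
  have -> : y ^+ 2 = x * (x - N) * (x + N).
    by move: hP; rewrite on_twist => /eqP.
  move=> hy xN x0; have [x_lt0|x_gt0|xe] := ltgtP x 0; last by case/eqP: x0.
    exists (T0 n_gt0); split; first exact: T0_double.
      have [r rnz ->] := delta_addE P (T0 n_gt0) r0.
      by rewrite pmulr_sq_gt0 // e0 (delta_T0 n_gt0).1 -mulrNN opprK mulr_gt0 ?oppr_gt0 ?exprn_gt0.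
    have [r rnz ->] := delta_addE P (T0 n_gt0) rN.
    rewrite pmulr_sq_gt0 // eN (delta_T0 n_gt0).2 -mulrNN opprK mulr_gt0 //.
    by have := N_gt0; lra.
  exists 0; rewrite addr0 e0 eN mul0rn; split=> //.
  rewrite lt_neqAle eq_sym xN /=.
  by move: hy; rewrite mulrAC pmulr_rge0 // mulr_gt0 // addr_gt0.
set P1 := P + t in pos0 posN.
have P12 : P1 *+ 2 != 0 by rewrite mulrnDl t2 addr0.
have [d1 [d2 [d3 [hc s1 s2 /and3P[d10 d20 d30] h]]]] :=
  positive_class hn P12 pos0 posN.
have [d2_odd|d2_even] := boolP (odd d2).
  by exists t; split=> //; exists d1, d2, d3; exact: normal_of_odd h d2_odd.
have [q0 q0nz eq0] := delta_addE P1 (TN n_gt0) r0.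
have [qN qNnz eqN] := delta_addE P1 (TN n_gt0) rN.
rewrite (delta_TN n_gt0).1 in eq0; rewrite (delta_TN n_gt0).2 in eqN.
have [] := @positive_class _ n_gt0 hn (P1 + TN n_gt0).
- by rewrite mulrnDl TN_double addr0.
- by rewrite eq0 pmulr_sq_gt0 // mulr_gt0.
- by rewrite eqN pmulr_sq_gt0 // !mulr_gt0 // exprn_gt0.
move=> d1' [d2' [d3' [hc' s1' s2' /and3P[_ d20' _] h']]].
have o2' : odd d2'.
  have [k ek] : exists k, d2 = (2 * k)%N.
    by exists d2./2; rewrite mul2n even_halfK.
  have k0 : (0 < k)%N by move: d20; rewrite ek muln_gt0.
  have ok : odd k.
    apply/negPn/negP; rewrite -dvdn2 => /dvdnP[j ej].
    by have /negP[] := s2 2%N isT; rewrite ek ej mulnC -mulnA dvdn_mull.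
  have [_ [ra ra0 ea] _] := hc; have [_ [rb rb0 eb] _] := hc'.
  apply: (@sqfree_odd_rat _ k (2%:R * ra * N * qN / rb)) => //.
  apply: (mulIf (expf_neq0 2 rb0)); rewrite -eb eqN ea ek natrM; field.
  exact: rb0.
exists (t + TN n_gt0); rewrite addrA mulrnDl t2 TN_double addr0; split=> //.
by exists d1', d2', d3'; exact: normal_of_odd h' o2'.
Qed.

Lemma normal_pos P d1 d2 d3 : normal P d1 d2 d3 ->
  [/\ (0 < d1)%N, (0 < d2)%N & (0 < d3)%N].
Proof.
by move=> [_ [[h1 h2 h3] _ _ _]]; split; exact: dvdn_gt0 n_gt0 _.
Qed.

Lemma normal1 P d2 d3 : normal P 1 d2 d3 -> exists y, P = y *+ 2.
Proof.
move=> [hc [_ _ _ h]]; have [_ e2 e3] := h (or_introl erefl).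
rewrite e2 e3 in hc; have [[r1 _ h1] [r2 _ h2] [r3 _ h3]] := hc.
apply: (@halve_point _ E a1_0 a3_0 0 N (- N)) => //=.
- by ring.
- by ring.
- by ring.
- by exists r1; rewrite h1 mul1r.
- by exists r2; rewrite h2 mul1r.
- by exists r3; rewrite h3 mul1r.
Qed.

(** The class of the difference of the two points begins with a
    square, hence all its components are squares by [covering_trivial]. *)
Lemma normal_inj P P' d1 d2 d3 d2' d3' :
  normal P d1 d2 d3 -> normal P' d1 d2' d3' ->
  exists t y, t *+ 2 = 0 /\ P = P' + t + y *+ 2.
Proof.
move=> nP nP'; have [d10 d20 d30] := normal_pos nP.
have [_ d20' d30'] := normal_pos nP'.
have [r0 rN _] := twist_roots n_gt0.
have [R2|R2] := eqVneq ((P - P') *+ 2) 0.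
  by exists (P - P'), 0; split=> //; rewrite mul0rn addr0 addrC subrK.
have [q0 q0nz eq0] := delta_addE P (- P') r0.
have [qN qNnz eqN] := delta_addE P (- P') rN.
have [[[u1 u10 eu1] [u2 u20 eu2] _] [_ [_ m2 _] _ _]] := nP.
have [[[v1 v10 ev1] [v2 v20 ev2] _] [_ [_ m2' _] _ _]] := nP'.
have [| |] := positive_class hn R2.
- rewrite eq0 delta_opp // eu1 ev1 pmulr_sq_gt0 // mulr_gt0 //.
    by rewrite pmulr_sq_gt0 // ltr0n.
  by rewrite pmulr_sq_gt0 // ltr0n.
- rewrite eqN delta_opp // eu2 ev2 pmulr_sq_gt0 // mulr_gt0 //.
    by rewrite pmulr_sq_gt0 // ltr0n.
  by rewrite pmulr_sq_gt0 // ltr0n.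
move=> c1 [c2 [c3 [hc s1 s2 /and3P[c10 c20 _] h]]].
have [[w1 w10 ew1] [w2 w20 ew2] _] := hc.
have ec1 : c1 = 1%N.
  apply: (@sqfree_unique_rat _ _ (d1%:R * u1 * v1 * q0 / w1)) => //.
    by move=> p pp; rewrite dvdn1 -(exp1n 2) eqn_exp2r // neq_ltn prime_gt1 // orbT.
  apply: (mulIf (expf_neq0 2 w10)); rewrite -ew1 eq0 delta_opp // eu1 ev1; field.
  exact: w10.
have oc2 : odd c2.
  apply: (@sqfree_odd_rat _ (d2 * d2')%N (u2 * v2 * qN / w2)) => //.
    by rewrite oddM -(odd_mod d2 (d := 8)) // m2 -(odd_mod d2' (d := 8)) // m2'.
  apply: (mulIf (expf_neq0 2 w20)); rewrite -ew2 eqN delta_opp // eu2 ev2 natrM; field.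
  exact: w20.
have [y ey] : exists y, P - P' = y *+ 2.
  by apply: (@normal1 _ c2 c3); rewrite -ec1; exact: normal_of_odd h oc2.
by exists 0, y; rewrite mul0rn addr0 -ey addrC subrK.
Qed.

(** The class [d1] determines a point modulo
    [2 E(Q) + E(Q)[2]], so one point for each possible value of [d1] other than
    [1] suffices as a set of representatives. *)
Lemma descent_step k (ds : 'I_k -> nat) :
  (forall P d1 d2 d3, normal P d1 d2 d3 -> d1 = 1%N \/ exists i, d1 = ds i) ->
  exists g : 'I_k -> ec_point E, forall P, exists s t y,
    [/\ P = s + t + y *+ 2, t *+ 2 = 0 & s = 0 \/ exists i, s = g i].
Proof.
move=> hds.
have /choice[g hg] : forall i, exists P', (exists P d2 d3, normal P (ds i) d2 d3) ->
    exists d2 d3, normal P' (ds i) d2 d3.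
  move=> i; have [[P [d2 [d3 h]]]|h] := pselect (exists P d2 d3, normal P (ds i) d2 d3).
    by exists P => _; exists d2, d3.
  by exists 0.
exists g => P; have [t [t2 [d1 [d2 [d3 h]]]]] := normalize P.
have nt2 : (- t) *+ 2 = 0 by rewrite mulNrn t2 oppr0.
have [e1|[i ei]] := hds _ _ _ _ h.
  rewrite e1 in h; have [y ey] := normal1 h.
  by exists 0, (- t), y; rewrite add0r -ey addrC addrK; split=> //; left.
have [d2' [d3' h']] : exists d2 d3, normal (g i) (ds i) d2 d3.
  by apply: hg; exists (P + t), d2, d3; rewrite -ei.
rewrite -ei in h'; have [t' [y [t2' e]]] := normal_inj h h'.
exists (g i), (t' - t), y; split; last by right; exists i.
  apply: (addIr t); rewrite e [RHS]addrAC; congr (_ + _).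
  by rewrite -addrA subrK.
by rewrite mulrnBl t2 t2' subrr.
Qed.

End DescentClasses.

(** * Heights on congruent number curves *)

Section RationalHeight.

Definition height_rat (x : rat) : nat := maxn `|numq x| `|denq x|.

Lemma height_rat_gt0 x : (0 < height_rat x)%N.
Proof. by rewrite /height_rat leq_max !absz_gt0 denq_neq0 orbT. Qed.

Lemma height_rat_frac (a b : int) : b != 0 -> exists k,
  [/\ k != 0, a = k * numq (a%:~R / b%:~R) & b = k * denq (a%:~R / b%:~R)].
Proof.
by move=> b0; case: (divqP a b) b0 => [_|k x k0 _]; [rewrite eqxx|exists k].
Qed.

Lemma height_rat_le (a b : int) : b != 0 ->
  (height_rat (a%:~R / b%:~R) <= maxn `|a| `|b|)%N.
Proof.
move=> b0; have [k [k0 ea eb]] := height_rat_frac a b0.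
rewrite -absz_gt0 in k0; move: ea eb; move: (a%:~R / b%:~R : rat) => x -> ->.
rewrite /height_rat !abszM geq_max; apply/andP; split.
  apply: leq_trans (leq_pmull _ k0) _. exact: leq_maxl.
by apply: leq_trans (leq_pmull _ k0) _; exact: leq_maxr.
Qed.

Lemma height_rat_ge (a b : int) c : b != 0 -> (0 < c)%N ->
  (forall g : int, (g %| a)%Z -> (g %| b)%Z -> (g %| c%:Z)%Z) ->
  (`|a| <= c * height_rat (a%:~R / b%:~R))%N.
Proof.
move=> b0 c0 hg; have [k [k0 ea eb]] := height_rat_frac a b0.
have kc : (`|k| <= c)%N.
  apply: (dvdn_leq c0); have := hg k.
  have -> : (k %| a)%Z by apply/dvdzP; exists (numq (a%:~R / b%:~R)); rewrite mulrC.
  have -> : (k %| b)%Z by apply/dvdzP; exists (denq (a%:~R / b%:~R)); rewrite mulrC.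
  by move=> /(_ isT isT); rewrite dvdzE.
by rewrite [in X in (X <= _)%N]ea abszM leq_mul //; exact: leq_maxl.
Qed.

Lemma absz_le_add (u v : int) p q : (`|u| <= p -> `|v| <= q -> absz (u + v)%R <= p + q)%N.
Proof. lia. Qed.

Lemma absz_le_mul (u v : int) p q : (`|u| <= p -> `|v| <= q -> absz (u * v)%R <= p * q)%N.
Proof. by rewrite abszM; exact: leq_mul. Qed.

End RationalHeight.

Section Heights.
Context (n : nat) (n_gt0 : (0 < n)%N).

Local Notation N := (n%:R : rat).
Local Notation E := (twist (natr_twist n_gt0)).
Implicit Types P Q : ec_point E.

Let N_gt0 : 0 < N. Proof. by rewrite ltr0n. Qed.

Definition abscissa P : option rat := omap fst (val P).

Definition height P : nat :=
  if abscissa P is Some x then height_rat x else 1.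

Lemma height_gt0 P : (0 < height P)%N.
Proof. by rewrite /height; case: abscissa => // x; exact: height_rat_gt0. Qed.

Lemma abscissa_sign P Q : abscissa P = abscissa Q -> P = Q \/ P = - Q.
Proof.
case: P Q => -[[x1 y1]|] h1 [] [[x2 y2]|] h2 //=; last by left; exact: val_inj.
rewrite /abscissa /= => -[ex].
have [e|ne] := eqVneq (exist (on_curve E) _ h1 : ec_point E) (exist (on_curve E) _ h2).
  by left.
have [e|ne'] := eqVneq (exist (on_curve E) _ h1 : ec_point E) (- (exist (on_curve E) _ h2 : ec_point E)).
  by right.
by case/eqP: (ec_neq_abscissa ne ne').
Qed.

Lemma height_finite B :
  exists l : seq (option rat), forall P, (height P <= B)%N -> abscissa P \in l.
Proof.
pose ints := [seq i%:Z - B%:Z | i <- iota 0 (2 * B).+1].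
exists (None :: [seq Some (a%:~R / b%:~R) | a <- ints, b <- ints]) => P.
rewrite /height; case: (abscissa P) => [x|_]; last exact: mem_head.
rewrite /height_rat geq_max => /andP[ha hb].
rewrite inE; apply/orP; right; rewrite -[x in Some x]divq_num_den.
have mem (z : int) : (`|z| <= B)%N -> z \in ints.
  move=> hz; apply/mapP; exists (absz (z + B%:Z)); last by lia.
  by rewrite mem_iota; lia.
by apply/allpairsP; exists (numq x, denq x); rewrite /= !mem.
Qed.

Lemma abscissa_double P : P *+ 2 != 0 -> exists2 x, abscissa P = Some x &
  x * (x ^+ 2 - N ^+ 2) != 0 /\
  abscissa (P *+ 2) = Some ((x ^+ 2 + N ^+ 2) ^+ 2 / (4%:R * x * (x ^+ 2 - N ^+ 2))).
Proof.
case: P => -[[x y]|] hP; last first.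
  by move=> /eqP[]; apply: etrans (mul0rn _ 2); congr (_ *+ 2); exact: val_inj.
move=> h; have y0 : y != 0.
  apply: contraNneq h => y0; rewrite mulr2n addr_eq0; apply/eqP/val_inj.
  by rewrite /= y0; congr (Some (_, _)); ring.
have ey : y ^+ 2 = x * (x ^+ 2 - N ^+ 2).
  by move: (hP); rewrite on_twist => /eqP ->; ring.
exists x => //; split; first by rewrite -ey expf_neq0.
rewrite mulr2n /abscissa /= eqxx ifF; last first.
  apply/negbTE; rewrite mul0r !addr0 -mulr2n -mulr_natl mulf_neq0 //.
rewrite /=; congr Some.
have -> : 4%:R * x * (x ^+ 2 - N ^+ 2) = 4%:R * y ^+ 2 by rewrite ey; ring.
have -> : (x ^+ 2 + N ^+ 2) ^+ 2 =
  (3%:R * x ^+ 2 - N ^+ 2) ^+ 2 - 8%:R * x * y ^+ 2 by rewrite ey; ring.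
by field.
Qed.

(** With [x = m / D] the duplication formula gives the fraction
    with numerator [(m^2 + n^2 D^2)^2], which is at least the fourth power of
    the height.  A common divisor with the denominator
    [4 m D (m^2 - n^2 D^2)] divides [64 n^12], so little is lost by
    cancellation. *)
Lemma height_double P : (height P ^ 4 <= 64 * n ^ 12 * height (P *+ 2))%N.
Proof.
have [P2|P2] := eqVneq (P *+ 2) 0.
  rewrite P2 /height /= muln1.
  have hx (z : int) : (`|z| <= n)%N -> (height_rat z%:~R ^ 4 <= 64 * n ^ 12)%N.
    move=> hz; have h1 : (height_rat z%:~R <= n)%N.
      have := @height_rat_le z 1 isT; rewrite divr1 => /leq_trans; apply.
      by rewrite geq_max hz.
    apply: leq_trans (_ : n ^ 4 <= _)%N; first by rewrite leq_exp2r.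
    apply: leq_trans (leq_pmull _ _) => //.
    by rewrite leq_pexp2l.
  have := two_torsion P2; rewrite !inE => /or4P[] /eqP ->.
  - by rewrite exp1n; have := hx 0 isT; apply: leq_trans; rewrite expn_gt0 height_rat_gt0.
  - by rewrite /T0; case: twist_roots => h1 h2 h3; exact: (hx 0).
  - by rewrite /TN; case: twist_roots => h1 h2 h3; exact: (hx n%:Z).
  - rewrite /TM; case: twist_roots => h1 h2 h3; have := hx (- n%:Z).
    by rewrite abszN rmorphN; apply.
have [x ex [nz e2]] := abscissa_double P2.
rewrite /height ex e2 {e2}.
set m := numq x; set D := denq x.
have D0 : D%:~R != 0 :> rat by rewrite intr_eq0 denq_neq0.
have exm : x = m%:~R / D%:~R by rewrite divq_num_den.
pose a : int := (m ^+ 2 + (n%:Z * D) ^+ 2) ^+ 2.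
pose b : int := 4%:Z * m * D * (m ^+ 2 - (n%:Z * D) ^+ 2).
have eb : b%:~R = 4%:R * x * (x ^+ 2 - N ^+ 2) * D%:~R ^+ 4 :> rat.
  by rewrite exm /b !(rmorphM, rmorphB, rmorphXn) /=; field.
have ea : a%:~R = (x ^+ 2 + N ^+ 2) ^+ 2 * D%:~R ^+ 4 :> rat.
  by rewrite exm /a !(rmorphM, rmorphD, rmorphXn) /=; field.
have b0 : b != 0.
  rewrite -(intr_eq0 rat) eb mulf_neq0 ?expf_neq0 // -mulrA mulf_neq0 //.
have -> : (x ^+ 2 + N ^+ 2) ^+ 2 / (4%:R * x * (x ^+ 2 - N ^+ 2)) = a%:~R / b%:~R.
  rewrite ea eb; field.
  move: nz; rewrite mulf_eq0 negb_or => /andP[-> ->].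
  by rewrite D0.
apply: leq_trans (_ : `|a| <= _)%N; last first.
  apply: height_rat_ge => //; first by rewrite muln_gt0 expn_gt0 n_gt0.
  move=> g ga gb.
  have coD k : coprimez g (D ^+ k).
    apply: coprimezXr; have /coprimezP[[u v] /= euv] : coprimez (m ^+ 2) D.
      by apply: coprimezXl; exact: coprime_num_den.
    have : coprimez a D.
      apply: coprimezXl; apply/coprimezP.
      exists (u, v - u * n%:Z ^+ 2 * D) => /=; rewrite -euv; ring.
    case/dvdzP: ga => q -> /coprimezP[[s t] /= est].
    by apply/coprimezP; exists (s * q, t) => /=; rewrite -est; ring.
  pose w := m ^+ 2 - (n%:Z * D) ^+ 2.
  have g1 : (g %| 64%:Z * n%:Z ^+ 4 * m ^+ 4)%Z.
    rewrite -(Gauss_dvdzl _ (coD 4)).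
    have -> : 64%:Z * n%:Z ^+ 4 * m ^+ 4 * D ^+ 4 =
        a * (4%:Z * w ^+ 2 - 4%:Z * a + 32%:Z * n%:Z ^+ 2 * m ^+ 2 * D ^+ 2)
        - b * (n%:Z ^+ 2 * b) by rewrite /a /b /w; ring.
    by rewrite rpredB // dvdz_mulr.
  rewrite -(Gauss_dvdzl _ (coD 8)).
  have -> : (64 * n ^ 12)%N%:Z * D ^+ 8 = a * (64%:Z * n%:Z ^+ 4 * w ^+ 2)
      - 64%:Z * n%:Z ^+ 4 * m ^+ 4 * (m ^+ 4 - 2%:Z * n%:Z ^+ 4 * D ^+ 4).
    by rewrite PoszM -[(n ^ 12)%N%:Z]natz natrX natz /a /w; ring.
  by rewrite rpredB // dvdz_mulr.
rewrite /a abszX; apply: leq_trans (_ : (`|m| ^ 2 + `|D| ^ 2) ^ 2 <= _)%N.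
  rewrite /height_rat -/m -/D -[4%N]/(2 * 2)%N expnM leq_exp2r //.
  by case/orP: (leq_total `|m| `|D|) => h;
    rewrite ?(maxn_idPr h) ?(maxn_idPl h) (leq_addl, leq_addr).
rewrite leq_exp2r // exprMn.
have -> : absz (m ^+ 2 + n%:Z ^+ 2 * D ^+ 2) = (`|m| ^ 2 + n ^ 2 * `|D| ^ 2)%N.
  have -> : m ^+ 2 + n%:Z ^+ 2 * D ^+ 2 = (`|m| ^ 2 + n ^ 2 * `|D| ^ 2)%N%:Z.
    by rewrite PoszD PoszM -!abszX !gez0_abs ?sqr_ge0.
  by [].
by rewrite leq_add2l leq_pmull // expn_gt0 n_gt0.
Qed.

Lemma abscissa_add P Q x y x0 y0 : val P = Some (x, y) -> val Q = Some (x0, y0) ->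
  x != x0 -> abscissa (P + Q) =
  Some (((x * x0 - N ^+ 2) * (x + x0) - 2%:R * y * y0) / (x - x0) ^+ 2).
Proof.
case: P => /= P hP eP; case: Q => /= Q hQ eQ; subst P Q => ne.
rewrite /abscissa /= (negPf ne) /=; congr Some.
have d1 : x - x0 != 0 by rewrite subr_eq0.
have d2 : x0 - x != 0 by rewrite subr_eq0 eq_sym.
have e1 : y ^+ 2 = x * (x - N) * (x + N).
  by move: (hP); rewrite on_twist => /eqP.
have e2 : y0 ^+ 2 = x0 * (x0 - N) * (x0 + N).
  by move: (hQ); rewrite on_twist => /eqP.
have -> : (x * x0 - N ^+ 2) * (x + x0) - 2%:R * y * y0 =
   y ^+ 2 + y0 ^+ 2 - 2%:R * y * y0 - (x + x0) * (x - x0) ^+ 2.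
  by rewrite e1 e2; ring.
by field; rewrite d1 d2.
Qed.

(** In the addition formula the ordinate [y] of [P] enters
    only through the integer [z = y D^2], whose square is
    [D m (m^2 - n^2 D^2)].  Numerator and denominator of the abscissa of
    [P + Q] are then bounded by multiples of the square of the height of
    [P]. *)
Lemma height_translate Q : exists C, forall P,
  (height (P + Q)%R <= C * height P ^ 2)%N.
Proof.
case eQ : (val Q) => [[x0 y0]|]; last first.
  exists 1%N => P; have -> : Q = 0 by exact: val_inj.
  by rewrite addr0 mul1n -{1}[height P]expn1 leq_pexp2l // height_gt0.
pose a := numq x0; pose b := denq x0; pose c := numq y0; pose d := denq y0.
(* Bounds for the numerator and the denominator of the abscissa of the sum,
   in units of the square of the height. *)
pose C1 := (`|d| * ((`|a| + n ^ 2 * `|b|) * (`|b| + `|a|))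
   + 2 * (1 + n) * `|c| * `|b| ^ 2)%N.
pose C2 := (`|d| * (`|b| + `|a|) ^ 2)%N.
exists (height Q + height (Q *+ 2) + 1 + C1 + C2)%N => P.
case eP : (val P) => [[x y]|]; last first.
  have -> : P = 0 by exact: val_inj.
  by rewrite add0r muln1 -!addnA leq_addr.
have hP2 : (0 < height P ^ 2)%N by rewrite expn_gt0 height_gt0.
have [exx|ne] := eqVneq x x0.
  have : abscissa P = abscissa Q by rewrite /abscissa eP eQ exx.
  move=> /abscissa_sign[->|->].
    rewrite -mulr2n; set K := (_ + C2)%N.
    apply: (@leq_trans K); first by rewrite /K -!addnA; apply: leq_trans (leq_addl (height Q) _); exact: leq_addr.
    by rewrite leq_pmulr // expn_gt0 height_gt0.
  rewrite addNr; set K := (_ + C2)%N.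
  apply: (@leq_trans K); first by rewrite -[height 0]/1%N /K addn1 !addSn.
  by rewrite leq_pmulr // expn_gt0 height_gt0.
rewrite {1}/height (abscissa_add eP eQ ne).
have -> : height P = height_rat x by rewrite /height /abscissa eP.
set H := height_rat x; set m := numq x; set D := denq x.
have hm : (`|m| <= H)%N by exact: leq_maxl.
have hD : (`|D| <= H)%N by exact: leq_maxr.
have D0 : D%:~R != 0 :> rat by rewrite intr_eq0 denq_neq0.
have b0 : b%:~R != 0 :> rat by rewrite intr_eq0 denq_neq0.
have d0 : d%:~R != 0 :> rat by rewrite intr_eq0 denq_neq0.
have ex : x = m%:~R / D%:~R by rewrite divq_num_den.
have ex0 : x0 = a%:~R / b%:~R by rewrite divq_num_den.
have ey0 : y0 = c%:~R / d%:~R by rewrite divq_num_den.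
have e1 : y ^+ 2 = x * (x - N) * (x + N).
  by have := valP P; rewrite eP on_twist => /eqP.
pose k := D * m * (m - n%:Z * D) * (m + n%:Z * D).
have ek : (y * D%:~R ^+ 2) ^+ 2 = k%:~R.
  rewrite exprMn e1 ex /k !(rmorphM, rmorphB, rmorphD) /=; field.
  exact: D0.
have [z ez] := rat_sq_int ek.
have hz : (`|z| <= (1 + n) * H ^ 2)%N.
  have ezk : z ^+ 2 = k by apply: (@intr_inj rat); rewrite rmorphXn /= -ez.
  rewrite -leq_sqr -abszX ezk.
  have -> : (((1 + n) * H ^ 2) ^ 2 = H * H * (H + n * H) * (H + n * H))%N by ring.
  have hn' (t : int) : (`|t| <= n * H -> absz (m + t)%R <= H + n * H)%N by exact: absz_le_add.
  rewrite /k; apply: absz_le_mul; first apply: absz_le_mul; first exact: absz_le_mul.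
    by apply: hn'; rewrite abszN; exact: absz_le_mul.
  by apply: hn'; exact: absz_le_mul.
pose u := d * ((m * a - n%:Z ^+ 2 * D * b) * (m * b + a * D)) - 2%:Z * z * c * b ^+ 2.
pose v := d * (m * b - a * D) ^+ 2.
have nz : m%:~R * b%:~R - a%:~R * D%:~R != 0 :> rat.
  apply: contraNneq ne => h; rewrite ex ex0 eqr_div //.
  by rewrite -subr_eq0 h.
have v0 : v != 0.
  rewrite -(intr_eq0 rat) /v !(rmorphM, rmorphXn, rmorphB) /=.
  by rewrite mulf_neq0 // expf_neq0.
have -> : ((x * x0 - N ^+ 2) * (x + x0) - 2%:R * y * y0) / (x - x0) ^+ 2 =
    u%:~R / v%:~R.
  have -> : y = z%:~R / D%:~R ^+ 2 by rewrite -ez mulfK // expf_neq0.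
  rewrite /u /v !(rmorphM, rmorphXn, rmorphB, rmorphD) /= ex ex0 ey0.
  field; rewrite D0 b0 d0 /=.
  by rewrite nz.
apply: leq_trans (height_rat_le _ v0) _.
have hu : (`|u| <= C1 * H ^ 2)%N.
  rewrite /u; have -> : (C1 * H ^ 2 =
    `|d| * ((H * `|a| + n ^ 2 * H * `|b|) * (H * `|b| + `|a| * H))
     + 2 * ((1 + n) * H ^ 2) * `|c| * `|b| ^ 2)%N by rewrite /C1; ring.
  apply: absz_le_add; last first.
    rewrite abszN; apply: absz_le_mul; last by rewrite abszX.
    by apply: absz_le_mul => //; exact: absz_le_mul.
  apply: absz_le_mul => //; apply: absz_le_mul; apply: absz_le_add.
  - exact: absz_le_mul.
  - by rewrite abszN; apply: absz_le_mul => //; apply: absz_le_mul.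
  - exact: absz_le_mul.
  - exact: absz_le_mul.
have hv : (`|v| <= C2 * H ^ 2)%N.
  rewrite /v; have -> : (C2 * H ^ 2 = `|d| * (H * `|b| + `|a| * H) ^ 2)%N.
    by rewrite /C2; ring.
  apply: absz_le_mul => //; rewrite abszX leq_exp2r //.
  by apply: absz_le_add; rewrite ?abszN; exact: absz_le_mul.
rewrite geq_max; apply/andP; split.
  apply: leq_trans hu _; rewrite leq_mul2r; apply/orP; right.
  by apply: leq_trans (leq_addr C2 _); exact: leq_addl.
by apply: leq_trans hv _; rewrite leq_mul2r leq_addl orbT.
Qed.

Lemma height_descent Q : exists B, forall P y, P = Q + y *+ 2 ->
  (height y ^ 2 <= B * height P)%N.
Proof.
have [C hC] := height_translate (- Q); exists (64 * n ^ 12 * C)%N => P y eP.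
rewrite -leq_sqr -expnM; apply: leq_trans (height_double y) _.
have -> : y *+ 2 = P + - Q by rewrite eP addrC addrA addNr add0r.
apply: leq_trans (leq_mul (leqnn _) (hC P)) _.
rewrite mulnA expnMn leq_mul2r; apply/orP; right.
by case: (64 * n ^ 12 * C)%N => // k; rewrite expnS leq_pmulr.
Qed.

End Heights.

(** * Ranks of congruent number curves *)

Section Rank.
Context (F : fieldType) (E : ellCurve F).

Lemma ec_mulzE (P : ec_point E) (m : int) : ec_mulz P m = P *~ m.
Proof.
have it k : iter k (ec_add P) (ec_zero E) = P *+ k.
  by elim: k => [|k IH]; rewrite ?mulr0n // iterS IH mulrS.
by case: m => k; rewrite /ec_mulz it.
Qed.

Lemma ec_lin_indepE r (P : 'I_r -> ec_point E) :
  ec_lin_indep P <-> forall c, int_comb P c = 0 -> forall i, c i = 0.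
Proof.
by split=> h c hc; apply: h; rewrite -[RHS]hc; apply: eq_bigr => i _;
  rewrite ec_mulzE.
Qed.

(** A bound for the size of independent families is needed to
    exclude the default value in the definition of the rank. *)
Lemma ec_rank_spec k :
  (forall s (Q : 'I_s -> ec_point E), ec_lin_indep Q -> (s <= k)%N) ->
  (ec_rank E <= k)%N /\
  forall s (Q : 'I_s -> ec_point E), ec_lin_indep Q -> (s <= ec_rank E)%N.
Proof.
move=> hk.
pose A := fun r => `[< exists P : 'I_r -> ec_point E, ec_lin_indep P >].
have A0 : exists r, A r.
  by exists 0%N; apply/asboolP; exists (fun=> 0) => c _ [].
have Ak r : A r -> (r <= k)%N by move=> /asboolP[P]; exact: hk.
case: (ex_maxnP A0 Ak) => r /asboolP hr hmax.
rewrite /ec_rank; case: xgetP => [m -> [[P hP] hm]|/(_ r)[]].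
  by split=> //; exact: hk hP.
by split=> // s Q hQ; apply: hmax; apply/asboolP; exists Q.
Qed.

End Rank.

(** Let [m] be minimal with [m P = 0].  If [m] is odd, then [P]
    is divisible by [2].  If [m = 2 k], then [k P] is 2-torsion; for odd [k]
    it is congruent to [P] modulo [2 A], and for even [k] it is divisible by
    [2], hence zero. *)
Lemma infinite_order (A : zmodType) (P : A) :
  (forall t y : A, t *+ 2 = 0 -> P + t <> y *+ 2) ->
  (forall y : A, y *+ 2 *+ 2 = 0 -> y *+ 2 = 0) ->
  forall m, (0 < m)%N -> P *+ m <> 0.
Proof.
move=> hP hT; elim/ltn_ind => m IH m0 h.
have half k : P *+ k = P *+ odd k + P *+ k./2 *+ 2.
  by rewrite -{1}[k]odd_double_half mulrnDr -muln2 mulrnA.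
have [mo|me] := boolP (odd m).
  apply: (hP 0 (- (P *+ m./2))); first by rewrite mul0rn.
  apply/eqP; rewrite addr0 mulNrn -addr_eq0; apply/eqP.
  by rewrite -[RHS]h (half m) mo.
have mh : P *+ m./2 *+ 2 = 0 by rewrite -[RHS]h (half m) (negPf me) add0r.
have [ho|he] := boolP (odd m./2).
  apply: (hP (- (P *+ m./2)) (- (P *+ m./2./2))).
    by rewrite mulNrn mh oppr0.
  by rewrite mulNrn {1}(half m./2) ho mulr1n opprD addrA subrr add0r.
apply: (IH m./2).
- by rewrite -divn2 ltn_Pdiv.
- by rewrite half_gt0; case: m m0 me {IH h half mh he} => [|[|]].
have e : P *+ m./2 = P *+ m./2./2 *+ 2 by rewrite {1}(half m./2) (negPf he) add0r.
by rewrite e; apply: hT; rewrite -e.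
Qed.

Section RankOfTwists.
Context (n : nat) (n_gt0 : (0 < n)%N) (hn : descent_number n).

Local Notation N := (n%:R : rat).
Local Notation E := (twist (natr_twist n_gt0)).
Implicit Types P Q : ec_point E.

Lemma rank_le_classes k (ds : 'I_k -> nat) :
  (forall P d1 d2 d3, normal (n_gt0 := n_gt0) P d1 d2 d3 ->
     d1 = 1%N \/ exists i, d1 = ds i) ->
  forall s (Q : 'I_s -> ec_point E), ec_lin_indep Q -> (s <= k)%N.
Proof.
move=> hds s Q /ec_lin_indepE hQ.
have [g hg] := descent_step hn hds.
have /choice[B hB] := @height_descent n n_gt0.
pose ts := [:: 0; T0 n_gt0; TN n_gt0; TM n_gt0].
pose Bt s := (\max_(t <- ts) B (s + t)%R)%N.
pose B0 := maxn (Bt 0) (\max_i Bt (g i)).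
apply: (@rank_le_generators _ k g) hQ.
apply: (@infinite_descent _ _ (@abscissa n n_gt0) (@height n n_gt0) _ _ k g B0).
- exact: abscissa_sign.
- exact: height_finite.
move=> P; have [u [t [y [eP t2 hu]]]] := hg P.
exists u, t, y; split=> //.
apply: leq_trans (hB (u + t) P y eP) _; rewrite leq_mul2r; apply/orP; right.
have Bu : (B (u + t)%R <= Bt u)%N.
  by apply: (@leq_bigmax_seq _ ts xpredT (fun t => B (u + t)%R)) => //; exact: two_torsion.
apply: leq_trans Bu _; rewrite /B0; case: hu => [->|[i ->]].
  exact: leq_maxl.
by apply: leq_trans (leq_maxr _ _); exact: (leq_bigmax (F := fun i => Bt (g i))).
Qed.

(** If [d1], [d2], [d3] are all different from [1], they are all equal
    to [k], and their product [k^3] is not a square. *)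
Lemma rank_eq0 k :
  (forall d, (d %| n)%N -> (d %% 8 = 1)%N -> d = 1%N \/ d = k) ->
  ec_rank E = 0%N.
Proof.
move=> hk; apply/eqP; rewrite -leqn0.
have [] // := @ec_rank_spec _ E 0.
apply: (@rank_le_classes 0 (fun=> 0%N)) => P d1 d2 d3 hP; left.
have [_ [[v1 v2 v3] [m1 m2 m3] [w ew] h1]] := hP.
have [d10 d20 d30] := normal_pos hP.
have [_ hs _] := hn.
have [//|e1] := hk d1 v1 m1.
have [e|e2] := hk d2 v2 m2; first by have [] := h1 (or_intror (or_introl e)).
have [e|e3] := hk d3 v3 m3; first by have [] := h1 (or_intror (or_intror e)).
move: ew; rewrite e2 e3 -e1 => ew.
apply: (@sqfree_eq_of_mul d1 1 (w %/ d1)) => //; first exact: sqfree_dvd hs v1.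
  by move=> p pp; rewrite dvdn1 -(exp1n 2) eqn_exp2r // neq_ltn prime_gt1 // orbT.
have dw : (d1 %| w)%N by rewrite -(@dvdn_pexp2r _ _ 2) // -ew -mulnA dvdn_mull // mulnn.
apply/eqP; rewrite -(eqn_pmul2r (_ : 0 < d1 ^ 2)%N) ?expn_gt0 ?d10 //.
by rewrite muln1 -expnMn divnK // -ew mulnA.
Qed.

Lemma is_sq_delta_double e (he : cubic_root E e) P : is_sq (delta e (P *+ 2)).
Proof.
have [r _ ->] := delta_addE P P he; exists (delta e P * r); ring.
Qed.

Lemma delta_TM : delta (E := E) 0 (TM n_gt0) = - N.
Proof.
rewrite /TM; case: twist_roots => h1 h2 h3; rewrite delta_torsion.
by rewrite oppr_eq0 gt_eqF ?ltr0n // subr0.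
Qed.

(** The classes of the points of order two under the
    first component of the descent map are [-1], [n] and [-n]. *)
Lemma infinite_order_twist P d r : delta 0 P = d%:R * r ^+ 2 ->
  (0 < d)%N -> sqfree d -> d <> 1%N -> d <> n -> n <> 1%N ->
  forall m, (0 < m)%N -> P *+ m <> 0.
Proof.
move=> eP d_gt0 sd d1 dn n1.
have [r0 _ _] := twist_roots n_gt0.
have nz X : delta (E := E) 0 X != 0 := delta_neq0 (@erefl _ 0 : ec_a1 E = 0) (@erefl _ 0 : ec_a3 E = 0) r0 X.
have [_ sn _] := hn; have N0 : 0 < N by rewrite ltr0n.
have s1 : sqfree 1.
  by move=> p pp; rewrite dvdn1 -(exp1n 2) eqn_exp2r // neq_ltn prime_gt1 // orbT.
have rnz : r != 0 by apply: contraNneq (nz P) => h; rewrite eP h expr0n mulr0.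
have nonsq k z : (0 < k)%N -> sqfree k -> k <> 1%N -> k%:R <> z ^+ 2 :> rat.
  by move=> k0 sk k1 h; apply: k1; apply: (@sqfree_unique_rat k 1 z) => //; rewrite mul1r.
have neg (z w : rat) : 0 < z -> - z <> w ^+ 2.
  by move=> z0 h; have := sqr_ge0 w; rewrite -h oppr_ge0 leNgt z0.
apply: infinite_order.
- move=> t y t2 e; have [z ez] := is_sq_delta_double r0 y.
  have [q q0 eq] := delta_addE P t r0.
  rewrite -e eq eP in ez.
  have := two_torsion t2; rewrite !inE => /or4P[] /eqP et; rewrite et in ez.
  + apply: (nonsq d (z / (r * q)) d_gt0 sd d1); move: ez; rewrite /delta /= => ez.
    rewrite expr_div_n -ez; field.
    by rewrite rnz q0.
  + rewrite (delta_T0 n_gt0).1 in ez.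
    apply: (neg d%:R (z / (r * q * N))); rewrite ?ltr0n // expr_div_n -ez; field.
    by rewrite rnz q0 gt_eqF.
  + rewrite (delta_TN n_gt0).1 in ez; apply: dn.
    apply: (@sqfree_unique_rat _ _ (z / (r * q * N))) => //.
    rewrite expr_div_n -ez; field.
    by rewrite rnz q0 gt_eqF.
  + rewrite delta_TM in ez.
    apply: (neg (d%:R * N) (z / (r * q))); first by rewrite mulr_gt0 ?ltr0n.
    rewrite expr_div_n -ez; field.
    by rewrite rnz q0.
- move=> y /two_torsion; have [z ez] := is_sq_delta_double r0 y.
  rewrite !inE => /or4P[] /eqP ey; rewrite ey // in ez *; exfalso.
  + by move: ez; rewrite (delta_T0 n_gt0).1; apply: neg; rewrite exprn_gt0.
  + by move: ez; rewrite (delta_TN n_gt0).1; exact: nonsq.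
  + by move: ez; rewrite delta_TM; exact: neg.
Qed.

Lemma rank_gt0 P k : (forall m, (0 < m)%N -> P *+ m <> 0) ->
  (forall s (Q : 'I_s -> ec_point E), ec_lin_indep Q -> (s <= k)%N) ->
  (0 < ec_rank E)%N.
Proof.
move=> hP /ec_rank_spec[_ h]; apply: (h 1%N (fun=> P)).
apply/ec_lin_indepE => c; rewrite /int_comb big_ord1 => hc i.
rewrite ord1; case: (c ord0) hc => m; rewrite -?pmulrn.
  by case: m => // m /hP; case.
by rewrite NegzE mulrNz => /eqP; rewrite oppr_eq0 => /eqP /hP; case.
Qed.

End RankOfTwists.

Section ConcreteRanks.

Definition residue_check (p : nat) : bool :=
  all (fun u => all (fun v =>
    ((p %| u ^ 2 + v ^ 2) ==> (u == 0)) &&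
    ((u ^ 2 == 2 * v ^ 2 %[mod p]) ==> (u == 0)))%N (iota 0 p)) (iota 0 p).

Lemma descent_prime_check p : prime p -> (p %% 8 = 3)%N -> residue_check p ->
  descent_prime p.
Proof.
move=> pp p8 /allP chk.
have mem u : (u %% p \in iota 0 p)%N by rewrite mem_iota ltn_mod prime_gt0.
split=> // u v h; have /allP/(_ _ (mem v))/andP[h1 h2] := chk _ (mem u).
  move/implyP: h1; rewrite /dvdn -modnDm !modnXm modnDm -/(dvdn _ _) h.
  by move=> /(_ isT).
move/implyP: h2; rewrite modnXm -modnMmr modnXm modnMmr h eqxx.
by move=> /(_ isT).
Qed.

Lemma descent_number1419 : descent_number 1419.
Proof.
have pr p : prime p -> (p %| 1419)%N -> p \in [:: 3; 11; 43]%N.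
  move=> pp pd; have : p \in primes 1419 by rewrite mem_primes pp pd.
  by have -> : primes 1419 = [:: 3; 11; 43]%N by vm_compute.
split=> // p pp.
  apply/negP => h; have := pr p pp (dvdn_trans (dvdn_exp _ (dvdnn p)) h).
  by move=> /(_ isT); rewrite !inE => /or3P[] /eqP ep; rewrite ep in h.
move=> /(pr p pp); rewrite !inE => /or3P[] /eqP ->;
  by apply: descent_prime_check; vm_compute.
Qed.

Lemma rank_small n (n_gt0 : (0 < n)%N) :
  n \in [:: 1; 3; 11; 33; 43; 129; 473]%N ->
  ec_rank (twist (natr_twist n_gt0)) = 0%N.
Proof.
move=> hn; have nd : (n %| 1419)%N.
  by move: hn; rewrite !inE; do 6![case/orP; first by move=> /eqP ->]; move=> /eqP ->.
apply: (@rank_eq0 n n_gt0 (descent_number_dvd descent_number1419 nd) n) => d dn d8.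
have : d \in divisors n by rewrite -dvdn_divisors.
have chk : all (fun d => (d %% 8 == 1)%N ==> (d == 1%N) || (d == n)) (divisors n).
  move: hn; rewrite !inE.
  do 6![case/orP; first by move=> /eqP ->; vm_compute].
  by move=> /eqP ->; vm_compute.
by move=> /(allP chk)/implyP; rewrite d8 => /(_ isT)/orP[] /eqP ->; [left|right].
Qed.

Lemma natr_frac_neq0 (F : numFieldType) (k a b : nat) :
  (0 < k)%N -> (0 < a)%N -> (0 < b)%N -> k%:R * (a%:R / b%:R) ^+ 2 != 0 :> F.
Proof.
by rewrite !lt0n -!(pnatr_eq0 F) => k0 a0 b0; rewrite mulf_neq0 // expf_neq0 // mulf_neq0 // invr_eq0.
Qed.

(** From [27 * 16 * (27 - 16) * (27 + 16) = 1419 * 12^2]: the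
    right triangle with legs [27^2 - 16^2] and [2 * 27 * 16] has area [1419]
    times a square. *)
Lemma point1419 (n_gt0 : (0 < 1419)%N) : exists x y,
  [/\ on_curve (twist (natr_twist n_gt0)) (Some (x, y)), x != 0 &
      x = 473%:R * (9%:R / 4%:R) ^+ 2].
Proof.
exists (473%:R * (9%:R / 4%:R) ^+ 2), (1419%:R ^+ 2 * 12%:R / 256%:R); split.
- by rewrite on_twist; apply/eqP; field.
- exact: natr_frac_neq0.
- exact: erefl.
Qed.

(** The divisors of [1419] that are congruent to [1] modulo [8] are
    [1], [33], [129] and [473]; the class of the given point is [473]. *)
Lemma rank1419 (n_gt0 : (0 < 1419)%N) :
  (0 < ec_rank (twist (natr_twist n_gt0)) <= 3)%N.
Proof.
have dn := descent_number1419.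
have bound : forall s (Q : 'I_s -> ec_point (twist (natr_twist n_gt0))),
    ec_lin_indep Q -> (s <= 3)%N.
  apply: (@rank_le_classes 1419 n_gt0 dn 3 (fun i => nth 0 [:: 33; 129; 473] i)%N).
  move=> P d1 d2 d3 [_ [[v1 _ _] [m1 _ _] _ _]].
  have : d1 \in divisors 1419 by rewrite -dvdn_divisors.
  have : all (fun d => (d %% 8 == 1)%N ==> (d \in [:: 1; 33; 129; 473]%N)) (divisors 1419).
    by vm_compute.
  move=> /allP h /h/implyP; rewrite m1 => /(_ isT).
  rewrite !inE => /or4P[] /eqP ->; first by left.
  - by right; exists (@Ordinal 3 0 isT).
  - by right; exists (@Ordinal 3 1 isT).
  - by right; exists (@Ordinal 3 2 isT).
have [le _] := ec_rank_spec bound; rewrite le andbT.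
have [x [y [hP x0 ex]]] := point1419 n_gt0.
apply: (@rank_gt0 1419 n_gt0 (exist (on_curve _) _ hP) 3 _ bound).
apply: (@infinite_order_twist 1419 n_gt0 dn _ 473 (9%:R / 4%:R)).
- by rewrite -ex -[LHS]/(if x == 0 then _ else x - 0) (negPf x0) subr0.
- by [].
- by apply: (@sqfree_dvd _ 1419); [case: dn | vm_compute].
- exact/eqP.
- exact/eqP.
- exact/eqP.
Qed.

End ConcreteRanks.

(** * Completion of a valued field *)

Section Completion.
Local Open Scope classical_set_scope.
Local Open Scope quotient_scope.
Context (R : realType) (K : fieldType) (a : absval R K).
Implicit Types u v : nat -> K.

Definition cauchy_seq u := forall e : R, 0 < e ->
  exists N, forall i j, (N <= i)%N -> (N <= j)%N -> a (u i - u j) < e.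

Definition null_seq u := forall e : R, 0 < e ->
  exists N, forall i, (N <= i)%N -> a (u i) < e.

Lemma abs0 : a 0 = 0.
Proof. by apply/eqP; rewrite abs_eq0. Qed.

Lemma absV x : a x^-1 = (a x)^-1.
Proof.
have [->|x0] := eqVneq x 0; first by rewrite invr0 abs0 invr0.
by apply: (mulfI (_ : a x != 0)); rewrite ?abs_eq0 // -absM !divff ?abs_eq0 // abs1.
Qed.

Lemma abs_subC x y : a (x - y) = a (y - x).
Proof. by rewrite -absN opprB. Qed.

Lemma abs_triangle z x y : a (x - y) <= a (x - z) + a (z - y).
Proof. by apply: le_trans (abs_leD a _ _); rewrite addrA subrK. Qed.

Lemma abs_dist x y : `|a x - a y| <= a (x - y).
Proof.
have h s t : a s - a t <= a (s - t).
  by rewrite lerBlDr; have := abs_leD a (s - t) t; rewrite subrK.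
by rewrite ler_norml h andbT lerNl opprB abs_subC h.
Qed.

Lemma cauchy_cst c : cauchy_seq (fun=> c).
Proof. by move=> e e0; exists 0%N => i j _ _; rewrite subrr abs0. Qed.

Lemma cauchyB u v : cauchy_seq u -> cauchy_seq v -> cauchy_seq (u - v).
Proof.
move=> hu hv e e0; have e2 : 0 < e / 2 by rewrite divr_gt0.
have [N hN] := hu _ e2; have [M hM] := hv _ e2.
exists (maxn N M) => i j; rewrite !geq_max => /andP[i1 i2] /andP[j1 j2].
have -> : (u - v) i - (u - v) j = (u i - u j) + (v j - v i).
  by rewrite !fctE; ring.
apply: le_lt_trans (abs_leD a _ _) _; rewrite [ltRHS](splitr e).
by apply: ltrD; [exact: hN|exact: hM].
Qed.

Lemma cauchy_bounded u : cauchy_seq u ->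
  exists2 M : R, 0 < M & forall i, a (u i) <= M.
Proof.
move=> /(_ 1 ltr01)[N hN].
exists (1 + a (u N) + \sum_(i < N) a (u i)).
  by rewrite ltr_pwDl ?sumr_ge0 // => [|i _]; rewrite ?abs_ge0 // ltr_pwDl // abs_ge0.
move=> i; have [ltiN|leNi] := ltnP i N.
  rewrite (bigD1 (Ordinal ltiN)) //= addrCA lerDl addr_ge0 //.
    by rewrite addr_ge0 // abs_ge0.
  by apply: sumr_ge0 => j _; exact: abs_ge0.
apply: le_trans (_ : 1 + a (u N) <= _); last first.
  by rewrite lerDl sumr_ge0 // => j _; exact: abs_ge0.
rewrite -{1}[u i](subrK (u N)); apply: le_trans (abs_leD a _ _) _.
by rewrite lerD2r ltW // hN.
Qed.

Lemma cauchyM u v : cauchy_seq u -> cauchy_seq v -> cauchy_seq (u * v).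
Proof.
move=> hu hv e e0; have [A A0 hA] := cauchy_bounded hu.
have [B B0 hB] := cauchy_bounded hv.
have [N hN] := hu (e / 2 / B) ltac:(by rewrite !divr_gt0).
have [M hM] := hv (e / 2 / A) ltac:(by rewrite !divr_gt0).
exists (maxn N M) => i j; rewrite !geq_max => /andP[i1 i2] /andP[j1 j2].
have -> : (u * v) i - (u * v) j = (u i - u j) * v i + u j * (v i - v j).
  by rewrite !fctE; ring.
apply: le_lt_trans (abs_leD a _ _) _; rewrite !absM [ltRHS](splitr e).
apply: ltrD.
  apply: le_lt_trans (_ : a (u i - u j) * B < _).
    by rewrite ler_wpM2l ?abs_ge0.
  by rewrite -ltr_pdivlMr // hN.
apply: le_lt_trans (_ : A * a (v i - v j) < _).
  by rewrite ler_wpM2r ?abs_ge0.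
by rewrite mulrC -ltr_pdivlMr // hM.
Qed.

Definition cauchyb : {pred nat -> K} := fun u => `[< cauchy_seq u >].

Lemma cauchy_subring : subring_closed cauchyb.
Proof.
split=> [|u v /asboolP hu /asboolP hv|u v /asboolP hu /asboolP hv];
  apply/asboolP.
- exact: cauchy_cst.
- exact: cauchyB.
- exact: cauchyM.
Qed.

HB.instance Definition _ := GRing.isSubringClosed.Build (nat -> K) cauchyb
  cauchy_subring.

Definition cseq := {u : nat -> K | u \in cauchyb}.
HB.instance Definition _ := SubChoice.copy cseq {u : nat -> K | u \in cauchyb}.
HB.instance Definition _ := [SubChoice_isSubComNzRing of cseq by <:].

Definition terms (s : cseq) : nat -> K := \val s.

Implicit Types s t : cseq.

Lemma terms_cauchy s : cauchy_seq (terms s).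
Proof. by have /asboolP := valP s. Qed.

Definition cseq_of (u : nat -> K) (hu : cauchy_seq u) : cseq :=
  exist _ u (asboolT hu : u \in cauchyb).

Definition nullb : {pred cseq} := fun s => `[< null_seq (terms s) >].

Lemma null_ideal : idealr_closed nullb.
Proof.
split.
- by apply/asboolP => e e0; exists 0%N => i _; rewrite [terms 0 i]/= abs0.
- apply/asboolP => /(_ 1 ltr01)[N /(_ N (leqnn N))].
  by rewrite [terms 1 N]/= abs1 ltxx.
move=> u v w /= /asboolP hv /asboolP hw; apply/asboolP => e e0.
have [M M0 hM] := cauchy_bounded (@terms_cauchy u).
have [N1 h1] := hv (e / 2 / M) ltac:(by rewrite !divr_gt0).
have [N2 h2] := hw (e / 2) ltac:(by rewrite !divr_gt0).
exists (maxn N1 N2) => i; rewrite geq_max => /andP[i1 i2].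
have -> : terms (u * v + w) i = terms u i * terms v i + terms w i by [].
apply: le_lt_trans (abs_leD a _ _) _; rewrite absM [ltRHS](splitr e).
apply: ltrD; last exact: h2.
apply: le_lt_trans (_ : M * a (terms v i) < _).
  by rewrite ler_wpM2r ?abs_ge0.
by rewrite mulrC -ltr_pdivlMr // h1.
Qed.

HB.instance Definition _ := isIdealr.Build cseq nullb null_ideal.

Definition completion := {ideal_quot nullb}.
HB.instance Definition _ := GRing.ComNzRing.on completion.

(** A Cauchy sequence, seen as its limit in the
    completion. *)
Definition limit_class (s : cseq) : completion := \pi_completion s.

Lemma limit_classE s t : (limit_class s = limit_class t) <-> null_seq (terms (s - t)).
Proof.
split=> [/eqP|h].
  by rewrite -Quotient.idealrBE => /asboolP.
by apply/eqP; rewrite -Quotient.idealrBE; apply/asboolP.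
Qed.

Lemma limit_classP (x : completion) : exists s, x = limit_class s.
Proof. by exists (repr x); rewrite /limit_class reprK. Qed.

Lemma limit_classB s t : limit_class (s - t) = limit_class s - limit_class t.
Proof. exact: rmorphB. Qed.

Lemma limit_classM s t : limit_class (s * t) = limit_class s * limit_class t.
Proof. exact: rmorphM. Qed.

Lemma limit_class1 : limit_class 1 = 1.
Proof. exact: rmorph1. Qed.

(** The limit is the supremum of the eventual lower bounds of
    the sequence of absolute values. *)
Lemma abs_limit_exists s : exists l : R, forall e : R, 0 < e ->
  exists N, forall i, (N <= i)%N -> `|a (terms s i) - l| < e.
Proof.
pose S := [set x : R | exists N, forall i, (N <= i)%N -> x <= a (terms s i)].
have [M M0 hM] := cauchy_bounded (@terms_cauchy s).
have S0 : S !=set0 by exists 0, 0%N => i _; rewrite abs_ge0.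
have Sub : has_ubound S.
  by exists M => x [N hN]; apply: le_trans (hN N (leqnn N)) (hM N).
exists (sup S) => e e0; have e3 : 0 < e / 3 by rewrite divr_gt0.
have [N hN] := terms_cauchy s e3; exists N => i leNi.
have osc j : (N <= j)%N -> `|a (terms s i) - a (terms s j)| < e / 3.
  by move=> leNj; apply: le_lt_trans (abs_dist _ _) _; exact: hN.
have lo : a (terms s i) - e / 3 <= sup S.
  apply: ub_le_sup => //; exists N => j /osc; rewrite ltr_norml => /andP[_ h].
  lra.
have up : sup S <= a (terms s i) + e / 3.
  apply: ge_sup => // x [N' hN']; have := hN' _ (leq_maxl N' N).
  have := osc _ (leq_maxr N' N); rewrite ltr_norml => /andP[h _] h'.
  lra.
rewrite ltr_norml; apply/andP; split; lra.
Qed.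

Definition abs_limit s : R := projT1 (cid (abs_limit_exists s)).

Lemma abs_limitP s (e : R) : 0 < e ->
  exists N, forall i, (N <= i)%N -> `|a (terms s i) - abs_limit s| < e.
Proof. by rewrite /abs_limit; case: cid => l /= h; exact: h. Qed.

Lemma abs_limit_unique s (l : R) :
  (forall e : R, 0 < e -> exists N, forall i, (N <= i)%N -> `|a (terms s i) - l| < e) ->
  abs_limit s = l.
Proof.
move=> h; apply/eqP; rewrite -subr_eq0 -normr_le0; apply/ler_addgt0Pr => e e0.
have e2 : 0 < e / 2 by rewrite divr_gt0.
have [N hN] := abs_limitP s e2; have [M hM] := h _ e2.
have := hN _ (leq_maxl N M); have := hM _ (leq_maxr N M).
rewrite add0r !ltr_norml => /andP[h1 h2] /andP[h3 h4].
by rewrite ler_norml; apply/andP; split; lra.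
Qed.

Lemma abs_limit_class s t : limit_class s = limit_class t ->
  abs_limit s = abs_limit t.
Proof.
move=> /limit_classE hst; apply: abs_limit_unique => e e0.
have e2 : 0 < e / 2 by rewrite divr_gt0.
have [N hN] := hst _ e2; have [M hM] := abs_limitP t e2.
exists (maxn N M) => i; rewrite geq_max => /andP[i1 i2].
have := hM _ i2; have := le_lt_trans (abs_dist _ _) (hN _ i1).
rewrite !ltr_norml => /andP[h1 h2] /andP[h3 h4]; apply/andP; split; lra.
Qed.

Definition cabs (x : completion) : R := abs_limit (repr x).

Lemma cabsE s : cabs (limit_class s) = abs_limit s.
Proof. by apply: abs_limit_class; rewrite /limit_class reprK. Qed.

Lemma limit_class_eq0 s : (limit_class s = 0) <-> null_seq (terms s).
Proof.
have := limit_classE s 0; rewrite subr0 => <-.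
by have -> : limit_class 0 = 0 by exact: rmorph0.
Qed.

Lemma abs_limit_eq0 s : (abs_limit s = 0) <-> null_seq (terms s).
Proof.
split=> [h e e0|h].
  have [N hN] := abs_limitP s e0; exists N => i /hN.
  by rewrite h subr0 ger0_norm ?abs_ge0.
apply: abs_limit_unique => e /h[N hN]; exists N => i /hN.
by rewrite subr0 ger0_norm ?abs_ge0.
Qed.

Lemma cabs_ge0 x : 0 <= cabs x.
Proof.
have [s ->] := limit_classP x; rewrite cabsE; apply/ler_addgt0Pr => e /(abs_limitP s).
move=> [N /(_ _ (leqnn N))]; rewrite ltr_norml => /andP[_ h].
have := abs_ge0 a (terms s N); lra.
Qed.

Lemma cabs_eq0 x : (cabs x == 0) = (x == 0).
Proof.
have [s ->] := limit_classP x; rewrite cabsE.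
by apply/eqP/eqP => [/abs_limit_eq0/limit_class_eq0|/limit_class_eq0/abs_limit_eq0].
Qed.

Lemma cabsM x y : cabs (x * y) = cabs x * cabs y.
Proof.
have [s ->] := limit_classP x; have [t ->] := limit_classP y.
rewrite -limit_classM !cabsE; apply: abs_limit_unique => e e0.
have [M M0 hM] := cauchy_bounded (@terms_cauchy s).
have L0 : 0 <= abs_limit t by rewrite -cabsE cabs_ge0.
have e1 : 0 < e / 2 / M by rewrite !divr_gt0.
have e2 : 0 < e / 2 / (abs_limit t + 1) by rewrite !divr_gt0 // ltr_wpDl.
have [N1 h1] := abs_limitP t e1; have [N2 h2] := abs_limitP s e2.
exists (maxn N1 N2) => i; rewrite geq_max => /andP[i1 i2].
have -> : terms (s * t) i = terms s i * terms t i by [].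
rewrite absM (_ : _ - _ = a (terms s i) * (a (terms t i) - abs_limit t)
  + abs_limit t * (a (terms s i) - abs_limit s)); last by ring.
apply: le_lt_trans (ler_normD _ _) _; rewrite [ltRHS](splitr e) !normrM.
apply: ltr_leD.
  apply: le_lt_trans (_ : M * `|a (terms t i) - abs_limit t| < _).
    by rewrite ler_wpM2r // ger0_norm ?abs_ge0.
  by rewrite mulrC -ltr_pdivlMr // h1.
apply: le_trans (_ : (abs_limit t + 1) * `|a (terms s i) - abs_limit s| <= _).
  by rewrite ler_wpM2r // ger0_norm // lerDl.
by rewrite mulrC -ler_pdivlMr ?ltr_wpDl // ltW // h2.
Qed.

Lemma cabs_leD x y : cabs (x + y) <= cabs x + cabs y.
Proof.
have [s ->] := limit_classP x; have [t ->] := limit_classP y.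
have -> : limit_class s + limit_class t = limit_class (s + t).
  by symmetry; exact: rmorphD.
rewrite !cabsE; apply/ler_addgt0Pr => e e0.
have e3 : 0 < e / 3 by rewrite divr_gt0.
have [N1 h1] := abs_limitP s e3; have [N2 h2] := abs_limitP t e3.
have [N3 h3] := abs_limitP (s + t) e3.
pose N := maxn N1 (maxn N2 N3).
have := h1 N (leq_maxl _ _).
have := h2 N (leq_trans (leq_maxl _ _) (leq_maxr _ _)).
have := h3 N (leq_trans (leq_maxr _ _) (leq_maxr _ _)).
have := abs_leD a (terms s N) (terms t N).
have -> : terms (s + t) N = terms s N + terms t N by [].
rewrite !ltr_norml => h /andP[a1 a2] /andP[b1 b2] /andP[c1 c2]; lra.
Qed.

(** The absolute values of the terms of a sequence that does
    not tend to zero are eventually bounded below, so the inverses form a Cauchy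
    sequence. *)
Lemma completion_inv_ex (x : completion) : x != 0 -> exists y, y * x = 1.
Proof.
have [s ->] := limit_classP x => x0.
have l0 : 0 < abs_limit s by rewrite lt_neqAle eq_sym -cabsE cabs_eq0 x0 cabs_ge0.
have l2 : 0 < abs_limit s / 2 by rewrite divr_gt0.
have [N hN] := abs_limitP s l2.
have big i : (N <= i)%N -> abs_limit s / 2 < a (terms s i).
  by move=> /hN; rewrite ltr_norml => /andP[h _]; lra.
have nz i : (N <= i)%N -> terms s i != 0.
  by move=> /big h; rewrite -(abs_eq0 a) gt_eqF // (lt_trans l2).
pose v i := (terms s i)^-1.
have hv : cauchy_seq v.
  move=> e e0; have [M hM] := @terms_cauchy s (e * (abs_limit s / 2) ^+ 2) ltac:(by rewrite mulr_gt0 // exprn_gt0).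
  exists (maxn N M) => i j; rewrite !geq_max => /andP[i1 i2] /andP[j1 j2].
  have -> : v i - v j = (terms s j - terms s i) / (terms s i * terms s j).
    by rewrite /v; field; rewrite !nz.
  rewrite absM absV ltr_pdivrMr; last first.
    by rewrite absM mulr_gt0 // (lt_trans l2) // big.
  apply: lt_le_trans (hM j i j2 i2) _.
  rewrite ler_wpM2l ?(ltW e0) // absM expr2.
  by apply: ler_pM; rewrite ?(ltW l2) // ltW // big.
exists (limit_class (cseq_of hv)); rewrite -limit_classM -limit_class1.
apply/limit_classE => e e0; exists N => i leNi.
have -> : terms (cseq_of hv * s - 1) i = v i * terms s i - 1 by [].
by rewrite /v mulVf ?nz // subrr abs0.
Qed.

Definition completion_inv (x : completion) : completion :=
  if x == 0 then 0 else xget 0 [set y | y * x = 1].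

Lemma completion_mulVf x : x != 0 -> completion_inv x * x = 1.
Proof.
move=> x0; rewrite /completion_inv (negPf x0).
have [y hy] := completion_inv_ex x0.
by case: xgetP => [z _ //|/(_ y)].
Qed.

Lemma completion_inv0 : completion_inv 0 = 0.
Proof. by rewrite /completion_inv eqxx. Qed.

HB.instance Definition _ := GRing.ComNzRing_isField.Build completion
  completion_mulVf completion_inv0.

Definition constant_seq (c : K) : cseq := cseq_of (cauchy_cst c).

Definition embed (c : K) : completion := limit_class (constant_seq c).

Lemma embed_is_zmod_morphism : zmod_morphism embed.
Proof.
by move=> c d; rewrite /embed -limit_classB; congr limit_class; exact: val_inj.
Qed.

Lemma embed_is_monoid_morphism : monoid_morphism embed.
Proof.
split; first by rewrite -limit_class1 /embed; congr limit_class; exact: val_inj.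
by move=> c d; rewrite /embed -limit_classM; congr limit_class; exact: val_inj.
Qed.

HB.instance Definition _ := GRing.isZmodMorphism.Build K completion embed
  embed_is_zmod_morphism.
HB.instance Definition _ := GRing.isMonoidMorphism.Build K completion embed
  embed_is_monoid_morphism.

Lemma cabs_embed c : cabs (embed c) = a c.
Proof.
rewrite cabsE; apply: abs_limit_unique => e e0; exists 0%N => i _.
by rewrite [terms _ _]/= subrr normr0.
Qed.

Lemma cabs_nontrivial : exists2 x : completion, x != 0 & cabs x != 1.
Proof.
have [c c0 hc] := abs_nontrivial a; exists (embed c); last by rewrite cabs_embed.
by rewrite -cabs_eq0 cabs_embed abs_eq0.
Qed.

Definition completion_abs : absval R completion :=
  AbsVal cabs_ge0 cabs_eq0 cabsM cabs_leD cabs_nontrivial.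

Lemma embed_approx s (e : R) : 0 < e ->
  exists N, forall i, (N <= i)%N -> cabs (limit_class s - embed (terms s i)) < e.
Proof.
move=> e0; have e2 : 0 < e / 2 by rewrite divr_gt0.
have [N hN] := terms_cauchy s e2; exists N => i leNi.
rewrite /embed -limit_classB cabsE.
have [M /(_ _ (leq_maxr N M))] := abs_limitP (s - constant_seq (terms s i)) e2.
have -> : terms (s - constant_seq (terms s i)) (maxn N M) =
  terms s (maxn N M) - terms s i by [].
have := hN _ _ (leq_maxl N M) leNi.
rewrite ltr_norml => h /andP[h1 h2]; lra.
Qed.

Lemma embed_dense_pt (x : completion) (e : R) : 0 < e ->
  exists c, cabs (x - embed c) < e.
Proof.
have [s ->] := limit_classP x => /(embed_approx s)[N hN].
by exists (terms s N); exact: hN.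
Qed.

Lemma completion_sqrt (w : K) (u : nat -> K) : cauchy_seq u ->
  null_seq (fun i => u i ^+ 2 - w) -> exists z : completion, z ^+ 2 = embed w.
Proof.
move=> hu hw; exists (limit_class (cseq_of hu)); rewrite expr2 -limit_classM.
apply/limit_classE; have -> // : terms (cseq_of hu * cseq_of hu - constant_seq w)
  = (fun i => u i ^+ 2 - w) by [].
Qed.

End Completion.

(** * Local compactness of completions *)

Section UltrafilterCover.
Local Open Scope classical_set_scope.

Lemma ultra_finite_cover (T : Type) (F : set_system T) (FU : UltraFilter F)
    (I : eqType) (B : set T) (f : I -> set T) (s : seq I) :
  F B -> (forall y, B y -> exists2 c, c \in s & f c y) -> exists c, F (f c).
Proof.
elim: s B => [|c s IH] B FB hB.
  by have [y /hB[]] := filter_ex FB.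
have [Fc|Fc] := in_ultra_setVsetC (f c) FU; first by exists c.
apply: (IH _ (filterI FB Fc)) => y [/hB[d]]; rewrite inE.
by move=> /orP[/eqP ->|ds] hd // _; exists d.
Qed.

End UltrafilterCover.

Section LocallyCompact.
Local Open Scope classical_set_scope.
Context (R : realType) (K : fieldType) (a : absval R K).

Local Notation L := (completion a).
Local Notation V := (valued (completion_abs a)).

Lemma valued_ballE (x y : V) (e : R) :
  ball x e y = (cabs ((x : L) - (y : L)) < e) :> Prop.
Proof. by []. Qed.

Lemma cabs_subC (x y : L) : cabs (x - y) = cabs (y - x).
Proof. exact: (abs_subC (completion_abs a)). Qed.

Lemma cabs_triangle (z x y : L) : cabs (x - y) <= cabs (x - z) + cabs (z - y).
Proof. exact: (abs_triangle (completion_abs a)). Qed.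

Lemma embed_dense : dense (range (@embed R K a) : set V).
Proof.
move=> O [x Ox] oO; have /nbhs_ballP[e /= e0 sub] : nbhs x O by exact: open_nbhs_nbhs.
have [c hc] := @embed_dense_pt _ _ a (x : L) e e0.
exists (embed a c); split; last by exists c.
by apply: sub; rewrite valued_ballE.
Qed.

Definition totally_bounded_unit_ball := forall e : R, 0 < e ->
  exists s : seq K, forall x, a x <= 1 -> exists2 c, c \in s & a (x - c) < e.

Hypothesis tb : totally_bounded_unit_ball.

(** With radius [1 / 4], two elements of [K] that are within [1 / 4] of points
    of the disc and of its centre differ by an element of the unit ball. *)
Definition closed_disc (p : L) : set V := [set y : V | cabs ((y : L) - p) <= 1 / 4].

(** An element of the disc is first approximated by an element of
    [K]; the radius is small enough for the difference to an approximation of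
    the centre to lie in the unit ball of [K]. *)
Lemma disc_cover (p : L) (e : R) : 0 < e -> exists s : seq K,
  forall y : L, closed_disc p y -> exists2 c, c \in s & cabs (embed a c - y) < e.
Proof.
move=> e0; have e2 : 0 < e / 2 by rewrite divr_gt0.
have q0 : 0 < 1 / 4 :> R by lra.
have [p' hp'] := embed_dense_pt p q0.
have [s hs] := tb e2; exists [seq p' + c | c <- s] => y; rewrite /closed_disc /= => hy.
have m0 : 0 < Num.min (e / 2) (1 / 4) by rewrite lt_min e2.
have [y' hy'] := embed_dense_pt y m0; rewrite lt_min in hy'.
have /andP[y1 y2] := hy'.
have : a (y' - p') <= 1.
  rewrite -(cabs_embed a) rmorphB /=.
  have := cabs_triangle y (embed a y') (embed a p').
  have := cabs_triangle p y (embed a p').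
  by rewrite [cabs (embed a y' - y)]cabs_subC; lra.
move=> /hs[c cs hc]; exists (p' + c); first by apply/mapP; exists c.
have := cabs_triangle (embed a y') (embed a (p' + c)) y.
rewrite -rmorphB cabs_embed [cabs (embed a y' - y)]cabs_subC abs_subC.
have -> : y' - (p' + c) = y' - p' - c by ring.
lra.
Qed.

(** Given an ultrafilter on the disc, total boundedness
    yields balls of radius [1 / k] with centres in [K] that belong to it.
    Any two of them meet, so the centres form a Cauchy sequence, and the
    ultrafilter converges to its limit. *)
Lemma closed_disc_compact (p : L) : compact (closed_disc p).
Proof.
rewrite compact_ultra => F FU FB.
have FF := @ultra_proper _ F FU.
have Fl := @filter_filter _ F FF.
have filtS := @filterS _ F Fl; have filtI := @filterI _ F Fl.
have filt_ex := @filter_ex _ F FF.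
have cover (e : R) : 0 < e -> exists c, F [set y : V | cabs (embed a c - (y : L)) < e].
  move=> /(disc_cover p)[s hs].
  exact: (@ultra_finite_cover _ F FU _ _
    (fun c => [set y : V | cabs (embed a c - (y : L)) < e]) s FB hs).
have pos (k : nat) : 0 < k.+1%:R^-1 :> R by rewrite invr_gt0 ltr0n.
have /choice[u hu] : forall k : nat, exists c,
    F [set y : V | cabs (embed a c - (y : L)) < k.+1%:R^-1].
  by move=> k; apply: cover; exact: pos.
have small (e : R) : 0 < e -> exists N, forall k, (N <= k)%N -> k.+1%:R^-1 < e.
  move=> e0; exists (Num.truncn e^-1) => k leNk.
  rewrite invf_plt ?posrE ?ltr0n //.
  apply: lt_le_trans (truncnS_gt _) _.
  by rewrite ler_nat ltnS.
have hcau : cauchy_seq a u.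
  move=> e e0; have e2 : 0 < e / 2 by rewrite divr_gt0.
  have [N hN] := small _ e2; exists N => i j iN jN.
  have [y [hi hj]] := filt_ex _ (filtI _ _ (hu i) (hu j)).
  rewrite -(cabs_embed a) rmorphB /=; apply: le_lt_trans (cabs_triangle y _ _) _.
  rewrite [cabs (y - _)]cabs_subC [ltRHS](splitr e).
  by apply: ltrD; [apply: lt_trans hi _|apply: lt_trans hj _]; exact: hN.
pose x : L := limit_class (cseq_of hcau).
have Fx (e : R) : 0 < e -> F [set y : V | cabs (x - (y : L)) < e].
  move=> e0; have e2 : 0 < e / 2 by rewrite divr_gt0.
  have [N hN] := small _ e2; have [M hM] := embed_approx (cseq_of hcau) e2.
  pose k := maxn N M.
  apply: (filtS _ _ _ (hu k)) => y /= hy.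
  apply: le_lt_trans (cabs_triangle (embed a (u k)) _ _) _.
  rewrite [ltRHS](splitr e); apply: ltrD; first exact: (hM k (leq_maxr _ _)).
  by apply: lt_trans hy _; exact: hN (leq_maxl _ _).
exists x; split.
  rewrite /closed_disc /=; apply/ler_addgt0Pr => e /Fx Fe.
  have [y [hy1 hy2]] := filt_ex _ (filtI _ _ Fe FB).
  apply: le_trans (cabs_triangle y _ _) _; rewrite addrC.
  by apply: lerD => //; exact: ltW.
move=> B /nbhs_ballP[e /= e0 sub].
by apply: (filtS _ _ _ (Fx e e0)) => y hy; apply: sub.
Qed.

Lemma completion_locally_compact : locally_compact [set: V].
Proof.
move=> x _; exists (closed_disc x); last first.
  split; first exact: closed_disc_compact.
  exact: (compact_closed (@metric_hausdorff R V) (@closed_disc_compact x)).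
apply/nbhs_ballP; exists (1 / 4); first by rewrite /=; lra.
by move=> y; rewrite valued_ballE /closed_disc /= cabs_subC => /ltW.
Qed.

Definition completion_localField : localField R :=
  LocalField completion_locally_compact.

End LocallyCompact.

(** * Absolute values of the rational numbers *)

Lemma bernoulli (R : realType) (d : R) k : 0 <= d ->
  1 + k%:R * d <= (1 + d) ^+ k.
Proof.
move=> d0; elim: k => [|k IH]; first by rewrite mul0r addr0 expr0.
rewrite exprS; apply: le_trans (_ : (1 + d) * (1 + k%:R * d) <= _).
  have h : 0 <= d * (k%:R * d) by rewrite !mulr_ge0.
  by rewrite -natr1; lra.
by rewrite ler_wpM2l // addr_ge0.
Qed.

Section RationalAbsval.
Context (R : realType) (a : absval R rat).

Definition approx_sq (x : rat) : Prop := exists u : nat -> rat,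
  cauchy_seq a u /\ null_seq a (fun i => u i ^+ 2 - x).

Lemma exprn_small (r e : R) : 0 <= r -> r < 1 -> 0 < e -> exists k, r ^+ k < e.
Proof.
move=> r0 r1 e0; have [->|rn0] := eqVneq r 0; first by exists 1%N; rewrite expr1.
have rp : 0 < r by rewrite lt_neqAle eq_sym rn0.
pose d := r^-1 - 1; have d0 : 0 < d by rewrite subr_gt0 invf_gt1.
have bern k : 1 + k%:R * d <= r^-1 ^+ k.
  have -> : r^-1 = 1 + d by rewrite /d; ring.
  by apply: bernoulli; exact: ltW.
exists (Num.truncn (e^-1 / d)).+1; set k := _.+1.
have hk : e^-1 < k%:R * d by rewrite -ltr_pdivrMr //; exact: truncnS_gt.
have : e^-1 < r^-1 ^+ k by apply: lt_le_trans (bern k); rewrite (lt_le_trans hk) // lerDr.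
by rewrite exprVn ltf_pV2 ?posrE ?exprn_gt0.
Qed.

Lemma abs_exprn x k : a (x ^+ k) = a x ^+ k.
Proof. by elim: k => [|k IH]; rewrite ?expr0 ?abs1 // !exprS absM IH. Qed.

Lemma abs_intr (z : int) : a z%:~R = a `|z|%N%:R.
Proof. by case: z => n //; rewrite NegzE mulrNz absN. Qed.

Section Nonarchimedean.
Hypothesis abs_nat_le1 : forall n : nat, a n%:R <= 1.

Lemma abs_int_le1 (z : int) : a z%:~R <= 1.
Proof. by rewrite abs_intr. Qed.

(** The least positive integer of absolute value less than [1] is
    prime. *)
Lemma small_prime : exists2 l, prime l & a l%:R < 1.
Proof.
have [n0 n1] : exists n : nat, (0 < n)%N && (a n%:R < 1).
  have [x x0 ax] := abs_nontrivial a; apply: contrapT => h.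
  have one (m : nat) : (0 < m)%N -> a m%:R = 1.
    move=> m0; apply/eqP; rewrite eq_le abs_nat_le1 leNgt; apply/negP => lt.
    by apply: h; exists m; rewrite m0.
  case/negP: ax; rewrite -[x]divq_num_den absM absV !abs_intr.
  by rewrite !one ?absz_gt0 ?numq_eq0 ?denq_neq0 // divr1.
have ex : exists n : nat, (0 < n)%N && (a n%:R < 1) by exists n0.
case: (ex_minnP ex) => n /andP[n_gt0 an] nmin.
exists n => //; apply/primeP; split.
  rewrite ltnNge; apply/negP => n1'; have en : n = 1%N by lia.
  by move: an; rewrite en abs1 ltxx.
move=> d /dvdnP[c ec]; have [d0 c0] : (0 < d)%N /\ (0 < c)%N.
  by move: n_gt0; rewrite ec muln_gt0 => /andP[].
move: an; rewrite ec natrM absM => an.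
have [d1|d1] := eqVneq d 1%N; first by [].
have [c1|c1] := eqVneq c 1%N; first by rewrite c1 mul1n eqxx orbT.
have one m : (0 < m)%N -> (m < n)%N -> a m%:R = 1.
  move=> m0 mn; apply/eqP; rewrite eq_le abs_nat_le1 leNgt; apply/negP => lt.
  by have := nmin m; rewrite m0 lt => /(_ isT); rewrite leqNgt mn.
by move: an; rewrite !one ?mul1r ?ltxx // ec; nia.
Qed.

Context (l : nat) (l_prime : prime l) (l_small : a l%:R < 1).

Lemma small_power (e : R) : 0 < e -> exists k, a (l ^ k)%N%:R < e.
Proof.
move=> e0; have [k hk] := exprn_small (abs_ge0 a l%:R) l_small e0.
by exists k; rewrite natrX abs_exprn.
Qed.

Lemma abs_dvd_le (z : int) k : ((l ^ k)%N%:Z %| z)%Z -> a z%:~R <= a (l ^ k)%N%:R.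
Proof.
move=> /dvdzP[q ->]; rewrite intrM absM -[leRHS]mul1r.
by apply: ler_wpM2r; rewrite ?abs_ge0 ?abs_int_le1.
Qed.

Lemma small_power_le k j (e : R) : (k <= j)%N -> a (l ^ k)%N%:R < e -> a (l ^ j)%N%:R < e.
Proof.
move=> kj; apply: le_lt_trans; apply: (@abs_dvd_le (l ^ j)%N%:Z).
by rewrite dvdzE /= dvdn_exp2l.
Qed.

(** Powers of [m] and [l] are coprime, and a Bezout relation between
    them would write [1] as a sum of two elements of small absolute value. *)
Lemma abs_unit (m : nat) : ~~ (l %| m)%N -> a m%:R = 1.
Proof.
move=> lm; apply/eqP; rewrite eq_le abs_nat_le1 leNgt; apply/negP => am.
have h2 : 0 < 1 / 2 :> R by lra.
have [i hi] := exprn_small (abs_ge0 a m%:R) am h2.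
have [j hj] := small_power h2.
have : coprimez (m ^ i)%N%:Z (l ^ j)%N%:Z.
  by rewrite coprimezE !absz_nat coprimeXl // coprimeXr // coprime_sym prime_coprime.
case/coprimezP => -[u v] /= /(congr1 (fun z : int => a z%:~R)).
rewrite rmorphD !rmorphM /= abs1 => e1.
have := abs_leD a (u%:~R * (m ^ i)%N%:R) (v%:~R * (l ^ j)%N%:R).
rewrite e1 !absM [in a (m ^ i)%N%:R]natrX abs_exprn.
have b1 : a u%:~R * a m%:R ^+ i <= a m%:R ^+ i.
  by rewrite ler_piMl ?exprn_ge0 ?abs_ge0 ?abs_int_le1.
have b2 : a v%:~R * a (l ^ j)%N%:R <= a (l ^ j)%N%:R.
  by rewrite ler_piMl ?abs_ge0 ?abs_int_le1.
lra.
Qed.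

(** The integers [0, ..., l^k - 1] represent the unit
    ball modulo [l^k], as the denominators of its elements are prime to
    [l]. *)
Lemma nonarch_totally_bounded : totally_bounded_unit_ball a.
Proof.
move=> e /small_power[k hk].
exists [seq i%:R | i <- iota 0 (l ^ k)] => x ax.
have lk0 : (0 < l ^ k)%N by rewrite expn_gt0 prime_gt0.
pose m := numq x; pose n := `|denq x|%N.
have ex : x = m%:~R / n%:R.
  by rewrite -[LHS]divq_num_den -[denq x]absz_denq.
have n0 : n%:R != 0 :> rat by rewrite pnatr_eq0 -lt0n absz_gt0 denq_neq0.
have ln : ~~ (l %| n)%N.
  apply/negP => ln.
  have lm : ~~ (l %| `|m|)%N.
    apply/negP => lm; have : (l %| gcdn `|m| n)%N by rewrite dvdn_gcd lm.
    rewrite (eqP (coprime_num_den x)) dvdn1 => /eqP l1.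
    by have := l_prime; rewrite l1.
  move: ax; rewrite ex absM absV abs_intr abs_unit // mul1r => ax.
  have : a n%:R < 1.
    case/dvdnP: ln => q ->; rewrite natrM absM.
    by apply: le_lt_trans l_small; rewrite ler_piMl ?abs_ge0.
  have an0 : 0 < a n%:R by rewrite lt_neqAle abs_ge0 eq_sym abs_eq0 n0.
  by rewrite ltNge -(invf_le1 an0) ax.
have : coprimez n%:Z (l ^ k)%N%:Z.
  by rewrite coprimezE !absz_nat coprimeXr // coprime_sym prime_coprime.
case/coprimezP => -[u v] /= euv.
pose j := absz ((u * m) %% (l ^ k)%N%:Z)%Z.
have ej : (j%:Z = (u * m) %% (l ^ k)%N%:Z)%Z.
  by rewrite /j gez0_abs // modz_ge0 // eqz_nat -lt0n.
exists j%:R.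
  apply/mapP; exists j => //; rewrite mem_iota /= add0n -ltz_nat ej.
  by rewrite ltz_pmod // ltz_nat.
have -> : x - j%:R = (m - n%:Z * j%:Z)%:~R / n%:R.
  by rewrite ex intrB intrM; field.
rewrite absM absV (abs_unit ln) divr1; apply: le_lt_trans hk.
apply: abs_dvd_le; apply/dvdzP.
have := divz_eq (u * m) (l ^ k)%N%:Z; rewrite -ej => ed.
exists (v * m + n%:Z * ((u * m) %/ (l ^ k)%N%:Z)%Z).
have -> : j%:Z = u * m - ((u * m) %/ (l ^ k)%N%:Z)%Z * (l ^ k)%N%:Z.
  by apply/eqP; rewrite eq_sym subr_eq addrC; apply/eqP.
set q := ((u * m) %/ _)%Z.
transitivity (m * (u * n%:Z + v * (l ^ k)%N%:Z - n%:Z * u)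
  + n%:Z * q * (l ^ k)%N%:Z); last by ring.
by rewrite euv; ring.
Qed.

Lemma approx_sq_of_congruences (z : int) (u : nat -> int) :
  (forall k, ((l ^ k)%N%:Z %| u k.+1 - u k)%Z) ->
  (forall k, ((l ^ k)%N%:Z %| u k ^+ 2 - z)%Z) -> approx_sq z%:~R.
Proof.
move=> step sol; exists (fun k => (u k)%:~R).
have dv k j : ((l ^ k)%N%:Z %| u (k + j)%N - u k)%Z.
  elim: j => [|j IH]; first by rewrite addn0 subrr dvdz0.
  rewrite addnS -(subrK (u (k + j)%N) (u _.+1)) -addrA rpredD //.
  apply: dvdz_trans (step _); by rewrite dvdzE /= dvdn_exp2l // leq_addr.
split=> e e0.
  have e2 : 0 < e / 2 by rewrite divr_gt0.
  have [k hk] := small_power e2; exists k => i j ki kj.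
  apply: le_lt_trans (abs_triangle a (u k)%:~R _ _) _; rewrite [ltRHS](splitr e).
  have close t : (k <= t)%N -> a ((u t)%:~R - (u k)%:~R) < e / 2.
    move=> kt; apply: le_lt_trans hk; rewrite -intrB; apply: abs_dvd_le.
    by rewrite -(subnKC kt); exact: dv.
  by apply: ltrD; [|rewrite abs_subC]; exact: close.
have [k hk] := small_power e0; exists k => i ki.
rewrite -rmorphXn -rmorphB /=; apply: le_lt_trans (abs_dvd_le (sol i)) _.
exact: small_power_le ki hk.
Qed.

End Nonarchimedean.

End RationalAbsval.

Section Archimedean.
Context (R : realType) (a : absval R rat).

(** This argument of Ostrowski turns estimates with a linear
    factor into sharp ones, by applying them to all powers. *)
Lemma linear_bound_le1 (r C : R) : 0 <= r ->
  (forall k : nat, r ^+ k <= C * k.+1%:R) -> r <= 1.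
Proof.
move=> r0 h; rewrite leNgt; apply/negP => r1.
pose d := r - 1; have d0 : 0 < d by rewrite subr_gt0.
have C0 : 0 < C by have := h 0%N; rewrite expr0 mulr1; exact: lt_le_trans.
have bern k : k%:R * d <= r ^+ k.
  have -> : r = 1 + d by rewrite /d; ring.
  by apply: le_trans (bernoulli k (ltW d0)); rewrite lerDr.
pose k := (Num.truncn (4 * C / d ^+ 2)).+1.
have k1 : 1 <= k%:R :> R by rewrite ler1n.
have d20 : 0 < d ^+ 2 by rewrite exprn_gt0.
have hk : 4 * C < k%:R * d ^+ 2 by rewrite -ltr_pdivrMr //; exact: truncnS_gt.
have := h (k * 2)%N; rewrite exprM -natr1 natrM leNgt => /negP; apply.
apply: lt_le_trans (_ : (k%:R * d) ^+ 2 <= _); last first.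
  by rewrite ler_pXn2r ?nnegrE ?exprn_ge0 ?mulr_ge0 // ?(ltW d0) // (le_trans ler01).
have -> : (k%:R * d) ^+ 2 = k%:R * (k%:R * d ^+ 2) by ring.
have : 4 * C * k%:R < k%:R * d ^+ 2 * k%:R by rewrite ltr_pM2r // (lt_le_trans ltr01).
have : C * 1 <= C * k%:R by rewrite ler_pM2l.
lra.
Qed.

(** Expand [t] in base [n]; it has at most [k] digits. *)
Lemma abs_digits (n : nat) : (1 < n)%N -> exists2 C : R, 0 <= C & forall k t : nat,
  (t < n ^ k)%N -> a t%:R <= C * k%:R * Num.max 1 (a n%:R) ^+ k.
Proof.
move=> n1; pose M := Num.max 1 (a n%:R).
have M1 : 1 <= M by rewrite /M le_max lexx.
pose C := \sum_(i < n) a i%:R; have C0 : 0 <= C by apply: sumr_ge0 => i _; exact: abs_ge0.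
exists C => // k; elim: k => [|k IH] t.
  by rewrite expn0 ltnS leqn0 => /eqP ->; rewrite abs0 mulr0 mul0r.
move=> ht; have n0 : (0 < n)%N by apply: ltn_trans n1.
have q_lt : (t %/ n < n ^ k)%N by rewrite ltn_divLR // -expnSr.
rewrite (divn_eq t n) natrD natrM; apply: le_trans (abs_leD a _ _) _; rewrite absM.
have r_le : a (t %% n)%:R <= C.
  have lt : (t %% n < n)%N by rewrite ltn_mod.
  rewrite /C (bigD1 (Ordinal lt)) //= lerDl; apply: sumr_ge0 => i _; exact: abs_ge0.
have Mk : 1 <= M ^+ k.+1 by rewrite exprn_ege1.
apply: le_trans (_ : C * k%:R * M ^+ k * M + C * M ^+ k.+1 <= _).
  apply: lerD.
    apply: ler_pM; rewrite ?abs_ge0 //; first exact: IH.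
    by rewrite /M le_max lexx orbT.
  by apply: le_trans r_le _; rewrite ler_peMr.
by rewrite -natr1 exprSr; lra.
Qed.

Lemma abs_le_power (n m i : nat) : (1 < n)%N -> (m < n ^ i)%N ->
  a m%:R <= Num.max 1 (a n%:R) ^+ i.
Proof.
move=> n1 mi; have [C C0 hC] := abs_digits n1.
set M := Num.max 1 (a n%:R) in hC *.
have M1 : 1 <= M by rewrite /M le_max lexx.
have Mi : 0 < M ^+ i by rewrite exprn_gt0 // (lt_le_trans ltr01).
rewrite -[leRHS]mul1r -ler_pdivrMr //.
have M0 : 0 < M := lt_le_trans ltr01 M1.
apply: (@linear_bound_le1 _ (C * M * i.+1%:R)).
  by rewrite divr_ge0 ?abs_ge0 // ltW.
move=> k; rewrite expr_div_n ler_pdivrMr ?exprn_gt0 // -abs_exprn -natrX.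
apply: le_trans (hC (i * k).+1 _ _) _.
  apply: (@leq_ltn_trans ((n ^ i) ^ k)); first by case: (k) => // j; rewrite leq_exp2r // ltnW.
  by rewrite -expnM ltn_exp2l.
rewrite -/M exprS -exprM.
have -> : C * (i * k).+1%:R * (M * M ^+ (i * k)) = C * M * M ^+ (i * k) * (i * k).+1%:R by ring.
have -> : C * M * i.+1%:R * k.+1%:R * M ^+ (i * k) =
  C * M * M ^+ (i * k) * (i.+1 * k.+1)%N%:R by rewrite natrM; ring.
by rewrite ler_wpM2l ?mulr_ge0 ?exprn_ge0 ?(ltW M0) // ler_nat; lia.
Qed.

Hypothesis abs_nat_gt1 : exists n : nat, 1 < a n%:R.

Lemma abs_ge2_gt1 (n : nat) : (1 < n)%N -> 1 < a n%:R.
Proof.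
move=> n1; rewrite ltNge; apply/negP => an; have [m] := abs_nat_gt1.
have mlt : (m < n ^ m)%N by exact: ltn_expl.
by have := abs_le_power n1 mlt; rewrite (max_idPl an) expr1n leNgt => /negP.
Qed.

Lemma abs_nat_mono (m n : nat) : (m <= n)%N -> a m%:R <= a n%:R.
Proof.
rewrite leq_eqVlt => /orP[/eqP -> //|mn].
have [n1|n1] := leqP n 1.
  have -> : m = 0%N by lia.
  by rewrite abs0 abs_ge0.
have := @abs_le_power n m 1 n1; rewrite expn1 expr1 => /(_ mn).
by rewrite (max_idPr _) // ltW // abs_ge2_gt1.
Qed.

Lemma abs_le1 (x : rat) : `|x| <= 1 -> a x <= 1.
Proof.
move=> hx; have d0 : 0 < `|denq x|%N%:R :> rat by rewrite ltr0n absz_gt0 denq_neq0.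
rewrite -[x]divq_num_den absM absV !abs_intr ler_pdivrMr ?mul1r; last first.
  by rewrite lt_neqAle abs_ge0 eq_sym abs_eq0 gt_eqF.
apply: abs_nat_mono; rewrite -(ler_nat rat).
move: hx; rewrite -{1}[x]divq_num_den normrM normfV -!intr_norm -!abszE.
by rewrite ler_pdivrMr ?mul1r.
Qed.

(** On the rationals the given absolute value is monotone in the usual
    one.  This is all that is used of the fact that it is a power of it. *)
Lemma abs_mono (x y : rat) : `|x| <= `|y| -> a x <= a y.
Proof.
have [->|y0] := eqVneq y 0; first by rewrite normr0 normr_le0 => /eqP ->.
move=> h; have -> : x = x / y * y by rewrite divfK.
rewrite absM ler_piMl ?abs_ge0 // abs_le1 // normrM normfV.
by rewrite ler_pdivrMr ?normr_gt0 // mul1r.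
Qed.

Lemma small_dyadic (e : R) : 0 < e -> exists k, a ((2 ^ k)%N%:R^-1) < e.
Proof.
move=> e0; have h2 := @abs_ge2_gt1 2 isT.
have i0 : 0 <= (a 2%:R)^-1 by rewrite invr_ge0 abs_ge0.
have i1 : (a 2%:R)^-1 < 1 by rewrite invf_lt1 // (lt_trans ltr01).
have [k hk] := exprn_small i0 i1 e0.
by exists k; rewrite absV natrX abs_exprn -exprVn.
Qed.

(** Elements of the unit ball have usual absolute value
    less than [2], because [2] lies outside; dyadic rationals with denominator
    [2^k] approximate them. *)
Lemma arch_totally_bounded : totally_bounded_unit_ball a.
Proof.
move=> e /small_dyadic[k hk]; set T := (2 ^ k)%N in hk.
have T0 : 0 < T%:R :> rat by rewrite ltr0n expn_gt0.
exists [seq (i%:Z - (2 * T)%N%:Z)%:~R / T%:R | i <- iota 0 (4 * T).+1] => x ax.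
have x2 : `|x| < 2%:R.
  rewrite ltNge; apply/negP => h; have := @abs_mono 2%:R x.
  rewrite normr_nat => /(_ h); rewrite leNgt => /negP; apply.
  by apply: le_lt_trans ax _; exact: abs_ge2_gt1.
pose j := Num.floor (x * T%:R).
have j_le : j%:~R <= x * T%:R := floor_le_tmp _.
have j_gt : x * T%:R < (j + 1)%:~R := floorD1_gt _.
have e2T : ((2 * T)%N%:Z)%:~R = 2%:R * T%:R :> rat by rewrite -natrM.
move: x2; rewrite ltr_norml -(ltr_pM2r T0) -[x < _](ltr_pM2r T0) mulNr.
move=> /andP[x_gt x_lt]; rewrite intrD in j_gt.
have l1 : - (2 * T)%N%:Z - 1 < j.
  by rewrite -(ltr_int rat) intrB intrN e2T; lra.
have l2 : j < (2 * T)%N%:Z by rewrite -(ltr_int rat) e2T; lra.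
exists (j%:~R / T%:R).
  apply/mapP; exists (absz (j + (2 * T)%N%:Z)); first by rewrite mem_iota /=; lia.
  by congr (_%:~R / _); lia.
apply: le_lt_trans hk; apply: abs_mono.
have -> : x - j%:~R / T%:R = (x * T%:R - j%:~R) / T%:R by field; rewrite gt_eqF.
rewrite normrM ler_piMl // ger0_norm ?subr_ge0 // lerBlDl.
by rewrite ltW.
Qed.

Lemma isqrt (m : nat) : exists s, (s ^ 2 <= m < s.+1 ^ 2)%N.
Proof.
have ex : exists s, (s ^ 2 <= m)%N by exists 0%N.
have ub s : (s ^ 2 <= m)%N -> (s <= m)%N by nia.
case: (ex_maxnP ex ub) => s hs hmax; exists s; rewrite hs ltnNge.
by apply/negP => /hmax; rewrite ltnn.
Qed.

(** Truncated binary expansions of the square root. *)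
Lemma arch_approx_sq (w : nat) : (0 < w)%N -> approx_sq a w%:R.
Proof.
move=> w0; have /choice[s hs] : forall k, exists s, (s ^ 2 <= w * 4 ^ k < s.+1 ^ 2)%N.
  by move=> k; exact: isqrt.
pose u k : rat := (s k)%:R / (2 ^ k)%N%:R.
have T0 k : 0 < (2 ^ k)%N%:R :> rat by rewrite ltr0n expn_gt0.
have T1 k : 1 <= (2 ^ k)%N%:R :> rat by rewrite ler1n expn_gt0.
have eT k : (4 ^ k)%N%:R = (2 ^ k)%N%:R ^+ 2 :> rat by rewrite -natrX -expnM mulnC expnM.
have s_ge k : (2 ^ k <= s k)%N.
  have /andP[_ h] := hs k; rewrite -ltnS -(ltn_sqr _ _.+1).
  apply: leq_ltn_trans h; rewrite -expnM mulnC expnM.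
  by rewrite leq_pmull.
have u_ge1 k : 1 <= u k by rewrite /u ler_pdivlMr // mul1r ler_nat.
have dist k : `|u k ^+ 2 - w%:R| <= (2 * w + 1)%N%:R * (2 ^ k)%N%:R^-1.
  have /andP[h1 h2] := hs k.
  have {}h1 : (s k)%:R ^+ 2 <= w%:R * (2 ^ k)%N%:R ^+ 2 :> rat.
    by rewrite -eT -natrX -natrM ler_nat.
  have {}h2 : w%:R * (2 ^ k)%N%:R ^+ 2 < ((s k)%:R + 1) ^+ 2 :> rat.
    by rewrite natr1 -eT -natrX -natrM ltr_nat.
  have h3 : (s k)%:R <= w%:R * (2 ^ k)%N%:R :> rat.
    have w1 : 1 <= w%:R :> rat by rewrite ler1n.
    rewrite -(@ler_pXn2r _ 2) ?nnegrE ?mulr_ge0 ?ler0n //; apply: le_trans h1 _.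
    by rewrite exprMn ler_wpM2r ?exprn_ge0 ?ler0n // expr2 ler_peMr ?ler0n.
  have Tk := T0 k; have Tk1 := T1 k; rewrite /u.
  move: h1 h2 h3 Tk Tk1; rewrite natrD natrM.
  move: (s k)%:R (2 ^ k)%N%:R => x T h1 h2 h3 Tk Tk1.
  have -> : (x / T) ^+ 2 - w%:R = (x ^+ 2 - w%:R * T ^+ 2) / T ^+ 2.
    by field; rewrite gt_eqF.
  rewrite normrM normfV normrX (gtr0_norm Tk) ler_pdivrMr ?exprn_gt0 //.
  have -> : (2%:R * w%:R + 1%:R) / T * T ^+ 2 = 2%:R * (w%:R * T) + T.
    by field; rewrite gt_eqF.
  have e2 : (x + 1) ^+ 2 = x ^+ 2 + 2%:R * x + 1 by ring.
  rewrite e2 in h2; move: h1 h2; move: (w%:R * T ^+ 2) (x ^+ 2) => q y h1 h2.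
  by rewrite ler_norml; apply/andP; split; lra.
have null : null_seq a (fun i => u i ^+ 2 - w%:R).
  move=> e e0; have c0 : 0 < a (2 * w + 1)%N%:R.
    by rewrite lt_neqAle abs_ge0 eq_sym abs_eq0 pnatr_eq0 addn1.
  have [k hk] := small_dyadic (divr_gt0 e0 c0); exists k => i ki.
  apply: le_lt_trans (_ : a ((2 * w + 1)%N%:R * (2 ^ k)%N%:R^-1) < _); last first.
    by rewrite absM mulrC -ltr_pdivlMr.
  apply: abs_mono; apply: le_trans (dist i) _.
  rewrite ger0_norm ?mulr_ge0 ?invr_ge0 // ?(ltW (T0 _)) //.
  by rewrite ler_wpM2l // lef_pV2 ?posrE // ler_nat leq_exp2l.
exists u; split=> // e e0; have e2 : 0 < e / 2 by rewrite divr_gt0.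
have [k hk] := null _ e2; exists k => i j ki kj.
apply: le_lt_trans (_ : a (u i ^+ 2 - u j ^+ 2) < _).
  apply: abs_mono; rewrite subr_sqr normrM ler_peMr //.
  by move: (u_ge1 i) (u_ge1 j) => ui uj; apply: le_trans (ler_norm _); lra.
apply: le_lt_trans (abs_triangle a w%:R _ _) _; rewrite [ltRHS](splitr e).
by apply: ltrD; [|rewrite abs_subC]; exact: hk.
Qed.

End Archimedean.

(** * Square classes in completions of the rational numbers *)

Section Hensel.

(** Here [S k x] says that [x] is a good approximate root
    at the [k]-th stage, and the step improves it. *)
Lemma hensel_sequence (l : nat) (z x0 : int) (S : nat -> int -> Prop) :
  S 0%N x0 ->
  (forall k x, S k x -> exists y, S k.+1 y /\ ((l ^ k)%N%:Z %| y - x)%Z) ->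
  (forall k x, S k x -> ((l ^ k)%N%:Z %| x ^+ 2 - z)%Z) ->
  exists u : nat -> int, (forall k, ((l ^ k)%N%:Z %| u k.+1 - u k)%Z) /\
    (forall k, ((l ^ k)%N%:Z %| u k ^+ 2 - z)%Z).
Proof.
move=> S0 step sol.
have /choice[f hf] : forall p : nat * int, exists y, S p.1 p.2 ->
    S p.1.+1 y /\ ((l ^ p.1)%N%:Z %| y - p.2)%Z.
  move=> [k x] /=; have [h|h] := pselect (S k x); last by exists 0.
  by have [y hy] := step _ _ h; exists y.
pose u := fix u k := if k is j.+1 then f (j, u j) else x0.
have Su k : S k (u k).
  by elim: k => [//|k IH] /=; exact: (hf (k, u k) IH).1.
exists u; split=> k; first exact: (hf (k, u k) (Su k)).2.
exact: sol.
Qed.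

(** Newton's iteration; [2 x] remains invertible modulo [l]. *)
Lemma hensel_odd (l : nat) (z x0 : int) : prime l -> odd l ->
  ~~ (l%:Z %| z)%Z -> (l%:Z %| x0 ^+ 2 - z)%Z ->
  exists u : nat -> int, (forall k, ((l ^ k)%N%:Z %| u k.+1 - u k)%Z) /\
    (forall k, ((l ^ k)%N%:Z %| u k ^+ 2 - z)%Z).
Proof.
move=> pl ol nz hx0.
have weak k y : ((l ^ k.+1)%N%:Z %| y)%Z -> ((l ^ k)%N%:Z %| y)%Z.
  by apply: dvdz_trans; rewrite dvdzE /= expnS dvdn_mull.
apply: (@hensel_sequence l z x0 (fun k x => ((l ^ k.+1)%N%:Z %| x ^+ 2 - z)%Z /\
  coprimez (2%:Z * x) l%:Z)).
- split; first by rewrite expn1.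
  rewrite coprimezMl; apply/andP; split.
    by rewrite coprimezE !absz_nat coprime2n.
  rewrite coprimez_sym coprimezE absz_nat prime_coprime //.
  apply: contra nz => lx; have -> : z = x0 ^+ 2 - (x0 ^+ 2 - z) by ring.
  by rewrite rpredB // dvdzE abszX dvdn_exp.
- move=> k x [hx co]; have /dvdzP[c ec] := hx.
  have /coprimezP[[s t] /= est] := co.
  set L := (l ^ k.+1)%N%:Z in hx ec *.
  exists (x - c * s * L); split; last first.
    by apply: weak; rewrite addrAC subrr add0r rpredN dvdz_mull.
  split.
    have -> : (l ^ k.+2)%N%:Z = l%:Z * L by rewrite expnS PoszM.
    have -> : (x - c * s * L) ^+ 2 - z =
        c * L * (1 - s * (2%:Z * x)) + (c * s) ^+ 2 * L ^+ 2.
      transitivity (x ^+ 2 - z - c * L * (s * (2%:Z * x)) + (c * s) ^+ 2 * L ^+ 2).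
        by ring.
      by rewrite ec; ring.
    have -> : 1 - s * (2%:Z * x) = t * l%:Z by rewrite -est; ring.
    apply: rpredD; apply/dvdzP; first by exists (c * t); ring.
    exists ((c * s) ^+ 2 * (l ^ k)%N%:Z).
    by rewrite /L expnS PoszM; ring.
  apply/coprimezP; exists (s, t + 2%:Z * c * s * s * (l ^ k)%N%:Z) => /=.
  by rewrite -est /L expnS PoszM; ring.
- by move=> k x [hx _]; exact: weak.
Qed.

(** At the [k]-th stage the congruence holds modulo [2^(k + 3)]; as
    [x] is odd, changing it by a multiple of [2^(k + 2)] gains one more
    power of [2]. *)
Lemma hensel_two (z : int) : (8%:Z %| 1 - z)%Z ->
  exists u : nat -> int, (forall k, ((2 ^ k)%N%:Z %| u k.+1 - u k)%Z) /\
    (forall k, ((2 ^ k)%N%:Z %| u k ^+ 2 - z)%Z).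
Proof.
move=> hz; apply: (@hensel_sequence 2 z 1 (fun k x =>
  ((2 ^ (k + 3))%N%:Z %| x ^+ 2 - z)%Z /\ (2%:Z %| 1 + x)%Z)).
- by rewrite expr1n.
- move=> k x [/dvdzP[c ec] /dvdzP[d ed]].
  have eM : (2 ^ (k + 3))%N%:Z = 8%:Z * (2 ^ k)%N%:Z by rewrite expnD PoszM mulrC.
  have eM' : (2 ^ (k.+1 + 3))%N%:Z = 16%:Z * (2 ^ k)%N%:Z.
    by rewrite addSn expnS PoszM eM; ring.
  rewrite eM in ec; set M := (2 ^ k)%N%:Z in eM' ec *.
  exists (x + 4%:Z * c * M); split.
    split; last by apply/dvdzP; exists (d + 2%:Z * c * M); rewrite addrA ed; ring.
    rewrite eM'; apply/dvdzP; exists (c * d + c ^+ 2 * M).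
    transitivity (x ^+ 2 - z + 8%:Z * x * c * M + 16%:Z * (c * M) ^+ 2); first by ring.
    rewrite ec; transitivity (8%:Z * c * M * (1 + x) + 16%:Z * (c * M) ^+ 2).
      by ring.
    by rewrite ed; ring.
  by rewrite addrAC subrr add0r dvdz_mull.
- move=> k x [hx _]; apply: dvdz_trans hx.
  by rewrite dvdzE /= expnD dvdn_mulr.
Qed.

End Hensel.

Section SquareClasses.

(** In terms of a generator of the multiplicative group, of
    two odd exponents the sum is even. *)
Lemma finfield_sq_index2 (F : finFieldType) (u v : F) : u != 0 -> v != 0 ->
  exists x, x ^+ 2 = u \/ x ^+ 2 = v \/ x ^+ 2 = u * v.
Proof.
move=> u0 v0.
have /cyclicP[g eg] : cyclic [set: {unit F}] := field_unit_group_cyclic _.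
have gen (w : F) : w != 0 -> exists i, w = FinRing.uval g ^+ i.
  rewrite -unitfE => wu; have : FinRing.unit F wu \in <[g]>%g by rewrite -eg inE.
  by case/cycleP => i ei; exists i; rewrite -[w]/(FinRing.uval (FinRing.unit F wu)) ei FinRing.val_unitX.
have [i ->] := gen _ u0; have [j ->] := gen _ v0.
have even k : ~~ odd k -> (FinRing.uval g ^+ k./2) ^+ 2 = FinRing.uval g ^+ k.
  by move=> ek; rewrite -exprM muln2 even_halfK.
have [io|ie] := boolP (odd i); last first.
  by exists (FinRing.uval g ^+ i./2); left; exact: even.
have [jo|je] := boolP (odd j); last first.
  by exists (FinRing.uval g ^+ j./2); right; left; exact: even.
exists (FinRing.uval g ^+ (i + j)./2); right; right; rewrite -exprD.
by apply: even; rewrite oddD io jo.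
Qed.

Lemma residue_index2 (l u v : nat) : prime l -> ~~ (l %| u)%N -> ~~ (l %| v)%N ->
  exists x : int, [\/ (l%:Z %| x ^+ 2 - u%:Z)%Z, (l%:Z %| x ^+ 2 - v%:Z)%Z |
    (l%:Z %| x ^+ 2 - (u * v)%N%:Z)%Z].
Proof.
move=> pl lu lv; have ch := pchar_Fp pl.
have zero (z : int) : (l%:Z %| z)%Z = (z%:~R == 0 :> 'F_l).
  rewrite dvdzE absz_nat (dvdn_pcharf ch); case: z => // k.
  by rewrite NegzE mulrNz oppr_eq0.
have nz w : ~~ (l %| w)%N -> w%:R != 0 :> 'F_l by rewrite (dvdn_pcharf ch).
have [x hx] := finfield_sq_index2 (nz _ lu) (nz _ lv).
exists (x : nat)%:Z.
have e w : x ^+ 2 = w%:R -> (l%:Z %| (x : nat)%:Z ^+ 2 - w%:Z)%Z.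
  move=> hw; rewrite zero rmorphB rmorphXn /= -[_%:~R]/((x : nat)%:R).
  by rewrite natr_Zp hw subrr.
case: hx => [|[|]] hx; [exact: Or31 (e _ hx)|exact: Or32 (e _ hx)|].
by apply: Or33; apply: e; rewrite natrM.
Qed.

End SquareClasses.

Section LocalSquares.
Context (R : realType) (a : absval R rat).

Lemma approx_sq_self (x : rat) : approx_sq a (x ^+ 2).
Proof.
exists (fun=> x); split; first exact: cauchy_cst.
by move=> e e0; exists 0%N => i _; rewrite subrr abs0.
Qed.

Definition sign_sq (m : nat) : Prop :=
  exists s : bool, approx_sq a ((-1) ^+ s * m%:R).

(** The integer [w] represents the nontrivial class, if
    there is one: [w = 1] at infinity, [w = 3] at [2], [w = l] at [l = 3],
    [11], [43], and otherwise one of the three numbers that is not a square,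
    if any. *)
Lemma local_square_classes : exists w : nat, (0 < w)%N /\
  forall m, m \in [:: 3; 11; 43]%N -> sign_sq m \/ sign_sq (m * w).
Proof.
have pos m : approx_sq a m%:R -> sign_sq m.
  by move=> h; exists false; rewrite expr0 mul1r.
have neg (m : nat) : approx_sq a (- m%:Z)%:~R -> sign_sq m.
  by rewrite rmorphN => h; exists true; rewrite expr1 mulN1r.
have [[n hn]|hna] := pselect (exists n : nat, 1 < a n%:R).
  exists 1%N; split=> // m hm; left; apply: pos.
  have abs_gt : exists n : nat, 1 < a n%:R by exists n.
  by apply: (arch_approx_sq abs_gt); move: hm; rewrite !inE => /or3P[] /eqP ->.
have hle (n : nat) : a n%:R <= 1.
  by rewrite leNgt; apply/negP => h; apply: hna; exists n.
have [l pl ls] := small_prime hle.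
have lift (z x : int) : odd l -> ~~ (l%:Z %| z)%Z -> (l%:Z %| x ^+ 2 - z)%Z ->
    approx_sq a z%:~R.
  move=> ol nz hx; have [u [h1 h2]] := hensel_odd pl ol nz hx.
  exact: (approx_sq_of_congruences hle ls h1 h2).
have [l2|lodd] := even_prime pl.
  have two m : (8%:Z %| 1 - m%:Z)%Z -> approx_sq a m%:R.
    have ls2 : a 2%:R < 1 by rewrite -l2.
    move=> /hensel_two[u [h1 h2]].
    exact: (@approx_sq_of_congruences _ _ hle 2 ls2 m%:Z u h1 h2).
  exists 3%N; split=> // m; rewrite !inE => /or3P[] /eqP ->; right; apply: pos; exact: two.
have prime_case : l \in [:: 3; 11; 43]%N ->
    forall m, m \in [:: 3; 11; 43]%N -> sign_sq m \/ sign_sq (m * l).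
  rewrite !inE => /or3P[] /eqP el m; rewrite !inE => /or3P[] /eqP ->; subst l.
  - by right; apply: pos; rewrite natrM -expr2; exact: approx_sq_self.
  - by left; apply: neg; apply: (lift _ 1%:Z).
  - by left; apply: pos; apply: (lift 43%:Z 1).
  - by left; apply: pos; apply: (lift 3%:Z 5).
  - by right; apply: pos; rewrite natrM -expr2; exact: approx_sq_self.
  - by left; apply: neg; apply: (lift _ 1%:Z).
  - by left; apply: neg; apply: (lift _ 13%:Z).
  - by left; apply: pos; apply: (lift 11%:Z 21).
  - by right; apply: pos; rewrite natrM -expr2; exact: approx_sq_self.
have [lin|lnotin] := boolP (l \in [:: 3; 11; 43]%N).
  by exists l; split; [exact: prime_gt0|exact: prime_case].
have unit m : m \in [:: 3; 11; 43]%N -> ~~ (l %| m)%N.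
  move=> hm; have pm : prime m by move: hm; rewrite !inE => /or3P[] /eqP ->.
  by rewrite dvdn_prime2 //; apply: contraNneq lnotin => ->.
have dichotomy m m' : m \in [:: 3; 11; 43]%N -> m' \in [:: 3; 11; 43]%N ->
    [\/ approx_sq a m%:R, approx_sq a m'%:R | approx_sq a (m * m')%N%:R].
  move=> /unit um /unit um'; have [x hx] := residue_index2 pl um um'.
  case: hx => hx; [apply: Or31; apply: (lift m%:Z x) => //|
    apply: Or32; apply: (lift m'%:Z x) => //|
    apply: Or33; apply: (lift (m * m')%N%:Z x) => //].
  by rewrite dvdzE /= Euclid_dvdM // negb_or um.
have [[m0 [hm0 n0]]|hall] := pselect (exists m, m \in [:: 3; 11; 43]%N /\ ~ approx_sq a m%:R).
  exists m0; split; first by move: hm0; rewrite !inE => /or3P[] /eqP ->.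
  move=> m hm; case: (dichotomy m m0 hm hm0) => h; [left|by []|right]; exact: pos.
exists 1%N; split=> // m hm; left; apply: pos; apply: contrapT => h.
by apply: hall; exists m.
Qed.

Lemma rational_totally_bounded : totally_bounded_unit_ball a.
Proof.
have [hn|hna] := pselect (exists n : nat, 1 < a n%:R).
  exact: arch_totally_bounded.
have hle (n : nat) : a n%:R <= 1.
  by rewrite leNgt; apply/negP => h; apply: hna; exists n.
by have [l pl ls] := small_prime hle; exact: (nonarch_totally_bounded hle pl ls).
Qed.

End LocalSquares.

(** * Sums of local invariants over a family of twists *)

Section LocalSum.
Context (R : realType) (L : localField R) (iota : {rmorphism rat -> L}).
Context (lambda : forall L : localField R, ellCurve L -> int).
Hypothesis lambda_inv : local_invariant lambda.

Definition loc_twist (n : nat) (n_gt0 : (0 < n)%N) : int :=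
  lambda (ec_map iota (twist (natr_twist n_gt0))).

Definition loc_sq (k : nat) : Prop :=
  exists (s : bool) (z : L), z ^+ 2 = iota ((-1) ^+ s * k%:R).

Lemma loc_sqM k k' : loc_sq k -> loc_sq k' -> loc_sq (k * k').
Proof.
move=> [s [z hz]] [t [y hy]]; exists (s (+) t), (z * y).
by rewrite exprMn hz hy -rmorphM natrM signr_addb; congr (iota _); ring.
Qed.

Lemma loc_sq_cancel k w : (0 < w)%N -> loc_sq (k * w ^ 2) -> loc_sq k.
Proof.
move=> w0 [s [z hz]]; exists s, (z / iota w%:R).
have nz : iota w%:R != 0 by rewrite fmorph_eq0 pnatr_eq0 -lt0n.
apply: (mulIf (expf_neq0 2 nz)); rewrite -exprMn divfK // hz -rmorphXn -rmorphM.
by congr (iota _); rewrite natrM natrX; ring.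
Qed.

Lemma lf_isomorphism_id : lf_isomorphism (idfun : {rmorphism L -> L}).
Proof. by exists idfun; split=> // x; exact: cvg_id. Qed.

(** If [n m] is plus or minus [z^2], then [u = z / m] satisfies
    [u^4 m^2 = n^2], so scaling by [u] is an isomorphism. *)
Lemma loc_twist_eq n m (n_gt0 : (0 < n)%N) (m_gt0 : (0 < m)%N) :
  loc_sq (n * m) -> loc_twist n_gt0 = loc_twist m_gt0.
Proof.
move=> [s [z hz]].
have mz : iota m%:R != 0 by rewrite fmorph_eq0 pnatr_eq0 -lt0n.
have nz : iota n%:R != 0 by rewrite fmorph_eq0 pnatr_eq0 -lt0n.
apply: (lambda_inv lf_isomorphism_id).
exists (z / iota m%:R), 0, 0, 0; split.
  rewrite mulf_neq0 ?invr_eq0 //; have : z ^+ 2 != 0.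
    by rewrite hz rmorphM mulf_neq0 // ?natrM ?rmorphM ?mulf_neq0 // fmorph_eq0 signr_eq0.
  by rewrite expf_eq0.
have z4 : (z / iota m%:R) ^+ 4 * iota m%:R ^+ 2 = iota n%:R ^+ 2.
  have z2 : (z ^+ 2) ^+ 2 = (iota n%:R * iota m%:R) ^+ 2.
    rewrite hz natrM 2!rmorphM [LHS]exprMn -[iota ((-1) ^+ s) ^+ 2]rmorphXn.
    by rewrite sqrr_sign rmorph1 mul1r.
  have -> : (z / iota m%:R) ^+ 4 = (z ^+ 2) ^+ 2 / (iota m%:R ^+ 2) ^+ 2.
    by rewrite expr_div_n !exprSr !expr0 !mul1r !mulrA.
  rewrite z2; move: (iota n%:R) (iota m%:R) mz => x y y0.
  by field; exact: y0.
rewrite /= !rmorph0 !rmorphN !rmorphXn; split; try by ring.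
by rewrite mulrN z4; ring.
Qed.

Context (w : nat) (w_gt0 : (0 < w)%N).

Definition class_is (b : bool) (k : nat) : Prop :=
  if b then loc_sq (k * w) else loc_sq k.

Lemma class_isM b b' k k' : class_is b k -> class_is b' k' ->
  class_is (b (+) b') (k * k').
Proof.
case: b; case: b' => /= h h'; have := loc_sqM h h'.
- have -> : (k * w * (k' * w) = k * k' * w ^ 2)%N by ring.
  exact: loc_sq_cancel.
- by rewrite mulnAC.
- by rewrite mulnA.
- by [].
Qed.

Lemma class_isE b k (k_gt0 : (0 < k)%N) : class_is b k ->
  loc_twist k_gt0 = if b then loc_twist w_gt0 else loc_twist (ltn0Sn 0).
Proof.
case: b => /= h; apply: loc_twist_eq; first exact: h.
by rewrite muln1; exact: h.
Qed.

(** The values are [lambda(E_1)] or [lambda(E_w)] according to a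
    homomorphism from the group of order eight to [Z/2]; a nontrivial one takes
    each value four times. *)
Lemma loc_sum_dvd4 :
  (forall m, m \in [:: 3; 11; 43]%N -> loc_sq m \/ loc_sq (m * w)) ->
  exists t : int, loc_twist (ltn0Sn 0) + loc_twist (ltn0Sn 2)
   + loc_twist (ltn0Sn 10) + loc_twist (ltn0Sn 32) + loc_twist (ltn0Sn 42)
   + loc_twist (ltn0Sn 128) + loc_twist (ltn0Sn 472) + loc_twist (ltn0Sn 1418)
   = t * 4.
Proof.
move=> h.
have cls m : m \in [:: 3; 11; 43]%N -> exists b, class_is b m.
  by move=> /h[]; [exists false|exists true].
have [b1 c1] := cls 3%N isT; have [b2 c2] := cls 11%N isT.
have [b3 c3] := cls 43%N isT.
have c12 := class_isM c1 c2; have c13 := class_isM c1 c3.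
have c23 := class_isM c2 c3; have c123 := class_isM c12 c3.
rewrite (class_isE (ltn0Sn 2) c1) (class_isE (ltn0Sn 10) c2).
rewrite (class_isE (ltn0Sn 42) c3) (class_isE (ltn0Sn 32) c12).
rewrite (class_isE (ltn0Sn 128) c13) (class_isE (ltn0Sn 472) c23).
rewrite (class_isE (ltn0Sn 1418) c123).
move: (loc_twist w_gt0) (loc_twist (ltn0Sn 0)) => x y.
case: (b1) (b2) (b3) => [] [] []; solve [exists (x + y); rewrite /=; ring|exists (2 * y); rewrite /=; ring].
Qed.

End LocalSum.

Lemma completion_exists (R : realType) (v : place R rat) :
  exists p : {L : localField R & {rmorphism rat -> L}},
    is_completion v (projT2 p) /\
    forall x, approx_sq (repr v) x -> exists z : projT1 p, z ^+ 2 = projT2 p x.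
Proof.
have tb := rational_totally_bounded (repr v).
exists (existT (fun L : localField R => {rmorphism rat -> L})
  (completion_localField tb)
  (@embed R rat (repr v) : {rmorphism rat -> completion (repr v)})); split.
  split; first exact: embed_dense.
  exists (repr v); first by rewrite reprK.
  by move=> x; exact: cabs_embed.
by move=> x [u [cu hu]]; exact: completion_sqrt cu hu.
Qed.

Lemma fsbig_seq_setT (I : choiceType) (f : I -> int) (r : seq I) : uniq r ->
  (forall i, f i != 0 -> i \in r) ->
  \sum_(i \in [set: I]%classic) f i = \sum_(i <- r) f i.
Proof.
move=> ur hr; rewrite -(@fsbig_fwiden _ _ _ _ r [set` r]%classic f) //; last first.
  by move=> i [].
by symmetry; apply: fsbig_widen => // i [_ /= ni]; apply/eqP; apply: contraT => /hr.
Qed.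

Theorem theorem1 (R : realType) :
  ~ @sum_of_local_invariants R int
      (fun (K : fieldExtType rat) (E : ellCurve K) => Posz (ec_rank E)).
Proof.
move=> [lambda lambda_inv hsum].
have /choice[c hc] := @completion_exists R.
pose K : fieldExtType rat := rat^o.
pose E n (n_gt0 : (0 < n)%N) : ellCurve K := twist (natr_twist n_gt0).
pose f n (n_gt0 : (0 < n)%N) (v : place R K) : int :=
  loc_twist (projT2 (c v)) lambda n_gt0.
have hE n (n_gt0 : (0 < n)%N) : finite_set [set v | f n n_gt0 v != 0]%classic /\
    (ec_rank (twist (natr_twist n_gt0)))%:Z = \sum_(v \in [set: place R K]%classic) f n n_gt0 v.
  exact: (hsum K (E n n_gt0) (fun v => projT1 (c v))
    (fun v => projT2 (c v)) (fun v => (hc v).1)).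
have [r [ur hr]] : exists r : seq (place R K), uniq r /\
  forall k, k \in [:: 0; 2; 10; 32; 42; 128; 472; 1418]%N ->
    forall v, f k.+1 (ltn0Sn k) v != 0 -> v \in r.
  elim: [:: 0; 2; 10; 32; 42; 128; 472; 1418]%N => [|k ks [r [ur hr]]].
    by exists [::].
  have /finite_seqP[s hs] := (hE k.+1 (ltn0Sn k)).1.
  exists (undup (s ++ r)); split; first exact: undup_uniq.
  move=> j; rewrite inE => /orP[/eqP ->|jks] v hv; rewrite mem_undup mem_cat.
    have : [set` s]%classic v by rewrite -hs.
    by move=> /= ->.
  by rewrite (hr j jks v hv) orbT.
have sumE k : k \in [:: 0; 2; 10; 32; 42; 128; 472; 1418]%N ->
    (ec_rank (twist (natr_twist (ltn0Sn k))))%:Z = \sum_(v <- r) f k.+1 (ltn0Sn k) v.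
  move=> hk; rewrite (hE _ (ltn0Sn k)).2; apply: fsbig_seq_setT => // v.
  exact: hr.
have loc v : exists t : int, f 1 (ltn0Sn 0) v + f 3 (ltn0Sn 2) v
   + f 11 (ltn0Sn 10) v + f 33 (ltn0Sn 32) v + f 43 (ltn0Sn 42) v
   + f 129 (ltn0Sn 128) v + f 473 (ltn0Sn 472) v + f 1419 (ltn0Sn 1418) v = t * 4.
  have [w [w0 hw]] := local_square_classes (repr v).
  apply: (loc_sum_dvd4 lambda_inv w0) => m /hw[] [s hs]; [left|right];
    by have [z hz] := (hc v).2 _ hs; exists s, z.
have /choice[t ht] := loc.
have sum0 k : k \in [:: 0; 2; 10; 32; 42; 128; 472; 1418]%N ->
    k.+1 \in [:: 1; 3; 11; 33; 43; 129; 473]%N ->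
    \sum_(v <- r) f k.+1 (ltn0Sn k) v = 0.
  by move=> h1 h2; rewrite -sumE // rank_small.
have /andP[rk1 rk2] := rank1419 (ltn0Sn 1418).
have tot : (ec_rank (twist (natr_twist (ltn0Sn 1418))))%:Z = (\sum_(v <- r) t v) * 4.
  rewrite mulr_suml -(eq_bigr _ (fun v _ => ht v)) !big_split /=.
  rewrite (sum0 0) // (sum0 2) // (sum0 10) // (sum0 32) // (sum0 42) //.
  by rewrite (sum0 128) // (sum0 472) // !add0r sumE.
move: rk1 rk2 tot; move: (ec_rank _) (\sum_(v <- r) t v) => rk T; lia.
Qed.
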